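(* Let $n\ge 1$ and let $\lambda=(\lambda_1,\lambda_2,2^\ell,1^{n-2\ell-\lambda_1-\lambda_2})\vdash n$ with $\lambda_1\geq\lambda_2\geq 2$ and $\ell\ge 0$ (a partition contained in a double hook but not in a hook). Let $m:=n-2\ell-\lambda_1-\lambda_2+2$. If $\lambda_1=\lambda_2$, then \[ \langle \mathrm{Frob}(R_n^{(0,2)};u,v), s_\lambda\rangle = (uv)^{\ell+\lambda_2-1}\bigl(uv[m-2]_{u,v}+[m]_{u,v}+[m-1]_{u,v}\bigr). \] If $\lambda_1>\lambda_2$, then \[ \langle \mathrm{Frob}(R_n^{(0,2)};u,v), s_\lambda\rangle = (uv)^{\ell+\lambda_2-1}\bigl(uv[m-1]_{u,v}+uv[m-2]_{u,v}+[m]_{u,v}+[m-1]_{u,v}\bigr). \]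
   Context: Let $\mathbb{Q}[\boldsymbol{\theta}_n,\boldsymbol{\xi}_n]$ be the $\mathbb{Q}$-algebra generated by $2n$ pairwise anticommuting variables $\theta_1,\dots,\theta_n,\xi_1,\dots,\xi_n$ (the exterior algebra on them), with $\mathfrak{S}_n$ acting diagonally by permuting indices. The diagonal fermionic coinvariant ring $R_n^{(0,2)}$ is its quotient by the ideal generated by all $\mathfrak{S}_n$-invariant elements with zero constant term; it is bigraded, $(R_n^{(0,2)})_{i,j}$ being spanned by images of monomials with $i$ variables $\theta$ and $j$ variables $\xi$. $\mathrm{Frob}(R_n^{(0,2)};u,v)=\sum_{i,j}F\,\mathrm{char}((R_n^{(0,2)})_{i,j})u^iv^j$ with $F$ the Frobenius characteristic, and $\langle\cdot,\cdot\rangle$ is the Hall inner product, so $\langle \mathrm{Frob}(R_n^{(0,2)};u,v), s_\lambda\rangle$ is the bigraded multiplicity of the irreducible $\mathfrak{S}_n$-representation indexed by $\lambda$. Notation: $[k]_{u,v}:=u^{k-1}+u^{k-2}v+\cdots+v^{k-1}$ for $k\ge1$, and $[k]_{u,v}:=0$ for $k\le 0$. *)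

(* Defs.v *)
(* exterior algebra modelled concretely on its monomial basis,
   S_n-modules as matrices over rat, symmetric functions as polynomials in n
   variables (multinomials). *)
From HB Require Import structures.
From mathcomp Require Import all_boot all_order all_algebra all_fingroup.
From mathcomp Require Import mpoly.
From Stdlib Require Import ClassicalEpsilon.

Set Implicit Arguments.
Unset Strict Implicit.
Unset Printing Implicit Defensive.

Import Order.TTheory GRing.Theory.
Local Open Scope ring_scope.

Notation bmon_ n := ({set 'I_n} * {set 'I_n})%type.

Section Fermionic.
Variable n : nat.

(* Monomial basis of Q[theta_n, xi_n]: a pair (S, T) stands for
   theta_{s_1} ... theta_{s_k} xi_{t_1} ... xi_{t_l}, s_1<..<s_k, t_1<..<t_l. *)
Local Notation bmon := (bmon_ n).
Definition dimE := #|{: bmon}|.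
Definition bof (i : 'I_dimE) : bmon := enum_val i.

(* (-1)^(number of pairs a in S, b in S' with b < a): sign of sorting
   theta_S theta_S' *)
Definition merge_sign (S S' : {set 'I_n}) : rat :=
  (-1) ^+ #|[set p : 'I_n * 'I_n | [&& p.1 \in S, p.2 \in S' & (p.2 < p.1)%N]]|.

Definition bmul (b1 b2 : bmon) : rat * bmon :=
  (if [disjoint b1.1 & b2.1] && [disjoint b1.2 & b2.2] then
     (-1) ^+ (#|b1.2| * #|b2.1|) * merge_sign b1.1 b2.1 * merge_sign b1.2 b2.2
   else 0,
   (b1.1 :|: b2.1, b1.2 :|: b2.2)).

(* matrix (row-vector convention) of x |-> m1 * x * m2 *)
Definition mulmx_mon (m1 m2 : bmon) : 'M[rat]_dimE :=
  \matrix_(i, j)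
    let: (c1, b1) := bmul m1 (bof i) in
    let: (c2, b2) := bmul b1 m2 in
    if b2 == bof j then c1 * c2 else 0.

(* sign of sorting theta_{s(s_1)} ... theta_{s(s_k)} *)
Definition act_sign (s : 'S_n) (S : {set 'I_n}) : rat :=
  (-1) ^+ #|[set p : 'I_n * 'I_n |
             [&& p.1 \in S, p.2 \in S, (p.1 < p.2)%N & (s p.2 < s p.1)%N]]|.

(* diagonal action: s theta_i = theta_(s i), s xi_i = xi_(s i) *)
Definition rho (s : 'S_n) : 'M[rat]_dimE :=
  \matrix_(i, j)
    let: (A, B) := bof i in
    if bof j == ((s @: A), (s @: B)) :> bmon
    then act_sign s A * act_sign s B else 0.

Definition invariants : 'M[rat]_dimE :=
  (\bigcap_(s : 'S_n) kermx (rho s - 1%:M))%MS.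

Definition no_const : 'M[rat]_dimE :=
  \matrix_(i, j) (if (i == j) && (bof i != ((set0, set0) : bmon))
                  then 1 else 0).

Definition coinv_ideal : 'M[rat]_dimE :=
  (\sum_(m1 : bmon) \sum_(m2 : bmon)
      ((invariants :&: no_const)%MS *m mulmx_mon m1 m2))%MS.

Definition bideg (i j : nat) : 'M[rat]_dimE :=
  \matrix_(a, b) (if (a == b) && (#|(bof a).1| == i) && (#|(bof a).2| == j)
                  then 1 else 0).

(* trace of A restricted to the (A-stable) row space U *)
Definition restr_trace (U A : 'M[rat]_dimE) : rat :=
  \tr (row_base U *m A *m pinvmx (row_base U)).

(* character of (R_n^{(0,2)})_{i,j} = E_{i,j} / (E_{i,j} cap I) *)
Definition coinv_char (i j : nat) (s : 'S_n) : rat :=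
  restr_trace (bideg i j) (rho s)
  - restr_trace (bideg i j :&: coinv_ideal)%MS (rho s).

(* symmetric functions in n variables (enough for degree n) *)
Definition psum (k : nat) : {mpoly rat[n]} := \sum_(i < n) 'X_i ^+ k.

Definition pcycle (s : 'S_n) : {mpoly rat[n]} :=
  \prod_(C in porbits s) psum #|C|.

Definition frob (chi : 'S_n -> rat) : {mpoly rat[n]} :=
  (n`!%:R)^-1 *: \sum_(s : 'S_n) chi s *: pcycle s.

(* partitions of n, as row-length functions on rows 0..n-1 *)
Definition part := {ffun 'I_n -> 'I_n.+1}.
Definition is_partition (mu : part) : bool :=
  [forall i : 'I_n, forall j : 'I_n, (i <= j)%N ==> (mu j <= mu i)%N]
  && (\sum_(i < n) (mu i : nat) == n)%N.

(* semistandard Young tableaux of shape mu with entries in 'I_n;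
   cell (r, c) is in mu iff c < mu r; outside cells the filling is 0 *)
Definition ssyt (mu : part) (T : {ffun 'I_n * 'I_n -> 'I_n}) : bool :=
  [&& [forall rc : 'I_n * 'I_n, (mu rc.1 <= rc.2)%N ==> (val (T rc) == 0%N)],
      [forall rc : 'I_n * 'I_n, forall rc' : 'I_n * 'I_n,
         [&& rc.1 == rc'.1, (rc.2 < rc'.2)%N & (rc'.2 < mu rc'.1)%N]
           ==> (T rc <= T rc')%N] &
      [forall rc : 'I_n * 'I_n, forall rc' : 'I_n * 'I_n,
         [&& rc.2 == rc'.2, (rc.1 < rc'.1)%N & (rc'.2 < mu rc'.1)%N]
           ==> (T rc < T rc')%N]].

Definition schur (mu : part) : {mpoly rat[n]} :=
  \sum_(T : {ffun 'I_n * 'I_n -> 'I_n} | ssyt mu T)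
     \prod_(rc : 'I_n * 'I_n | (rc.2 < mu rc.1)%N) 'X_(T rc).

(* Hall inner product <f, s_lam>: the coefficient of s_lam in the (unique)
   expansion of f in the orthonormal Schur basis *)
Definition schur_expansion (f : {mpoly rat[n]}) : part -> rat :=
  epsilon (inhabits (fun _ : part => 0))
    (fun c : part -> rat => f = \sum_(mu : part | is_partition mu) c mu *: schur mu).

Definition hall_schur (f : {mpoly rat[n]}) (lam : part) : rat :=
  schur_expansion f lam.

(* <Frob(R_n^{(0,2)}; u, v), s_lam> as a polynomial in u = 'X_0, v = 'X_1 *)
Definition coinv_mult (lam : part) : {mpoly rat[2]} :=
  \sum_(i < n.+1) \sum_(j < n.+1)
     hall_schur (frob (coinv_char i j)) lam *: ('X_0 ^+ i * 'X_1 ^+ j).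

End Fermionic.

Definition part_of_seq (n : nat) (s : seq nat) : part n :=
  [ffun i : 'I_n => inord (nth 0%N s i)].

Definition qint (k : nat) : {mpoly rat[2]} :=
  \sum_(a < k) 'X_0 ^+ a * 'X_1 ^+ (k.-1 - a).

(* Main.v *)
Require Import Defs.
From HB Require Import structures.
From mathcomp Require Import all_boot all_order all_algebra all_fingroup.
From mathcomp Require Import mpoly ring lra zify.

(* Let E be the exterior algebra, tau and chi the sums of the theta_i and of the xi_i, and
   omega = sum_i theta_i xi_i.  Averaging monomials over S_n shows that the coinvariant ideal is
   generated by tau, chi and omega.  With respect to the monomial inner product, multiplication
   by omega and its adjoint satisfy the sl_2 relations, so on the joint kernel K of the adjoints
   of tau and chi, omega behaves as a Lefschetz operator: the character of the (i, j) component
   of the quotient is k_(i,j) - k_(i-1,j-1) for i + j < n and 0 otherwise, where k_(i,j) is the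
   character of K_(i,j), and sum e_(i,j) u^i v^j = (1 + u)(1 + v) sum k_(i,j) u^i v^j for the
   characters e_(i,j) of the components of E.

   The Frobenius characteristic of E is the degree n part of the product over the variables x of
   (1 + ux)(1 + vx) / ((1 - x)(1 - uvx)): its monomial coefficients count orbits of coloured
   sets.  By the bialternant formula the coefficient of s_lambda is then a Jacobi-Trudi
   determinant, which for a double hook factors as
     (1 + u)^2 (1 + v)^2 (uv)^(lambda_2 + l - 1) [lambda_1 - lambda_2 + 1]_(uv) [m - 1]_(u,v).
   Dividing by (1 + u)(1 + v), multiplying by 1 - uv and truncating to total degree < n gives
   the theorem. *)

(** The two cases of the theorem come from the truncation. With d = lambda_1 - lambda_2, the factor
    1 - uv telescopes [d + 1]_(uv) to 1 - (uv)^(d+1). Everything multiplied by (uv)^(d+1) lies in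
    degree at least n, and the top term of the rest lies in degree n - d, so it is lost exactly when
    d = 0. The obstacle on the algebraic side is that omega does not preserve K: its commutator with
    the adjoint of tau or chi is, up to sign, multiplication by the other of the two. The Lefschetz
    operator is therefore omega - tau chi / n, and the correction lowers the sl_2 weight from n - i
    - j to n - 1 - i - j. No representation theory of sl_2 is used; since the monomial inner product
    is positive definite over the rationals, comparing signs of squared norms gives the required
    injectivity. Quotients are avoided by passing to the kernel of a Laplacian. On the symmetric
    function side the Hall product is defined by choosing an expansion, so its value becomes
    accessible only after multiplication by the Vandermonde, which turns Schur polynomials into
    antisymmetrised monomials. *)

Set Implicit Arguments.
Unset Strict Implicit.
Unset Printing Implicit Defensive.
Import Order.TTheory GRing.Theory Num.Theory.
Local Open Scope ring_scope.

(** * Determinants of matrices with entries indexed by natural numbers *)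

Section NatDet.
Variable R : comNzRingType.
Implicit Types (f U : nat -> nat -> R).

(** Entries are indexed by naturals rather than ordinals, so that block splittings and shifts such
    as [p + i] need no casts. *)
Definition ndet k f : R := \det (\matrix_(i < k, j < k) f i j).

Lemma ndet_ext k f g :
  (forall i j, (i < k)%N -> (j < k)%N -> f i j = g i j) -> ndet k f = ndet k g.
Proof.
by move=> fg; congr (\det _); apply/matrixP=> i j; rewrite !mxE fg.
Qed.

Lemma ndet0 f : ndet 0 f = 1.
Proof. exact: det_mx00. Qed.

Lemma ndet1 f : ndet 1 f = f 0 0.
Proof. by rewrite /ndet det_mx11 mxE. Qed.

Lemma ndet2 f : ndet 2 f = f 0 0 * f 1 1 - f 0 1 * f 1 0.
Proof.
rewrite /ndet (expand_det_row _ 0) !big_ord_recl big_ord0 /cofactor !det_mx11 !mxE /=.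
by rewrite expr0 mul1r expr1 mulN1r mulrN addr0.
Qed.

Lemma ndet_trig k f :
    (forall i j, (i < j < k)%N -> f i j = 0) -> ndet k f = \prod_(i < k) f i i.
Proof.
move=> f0; rewrite /ndet det_trig; last first.
  by apply/is_trig_mxP => i j ij; rewrite mxE f0 // ij ltn_ord.
by apply: eq_bigr => i _; rewrite mxE.
Qed.

(** The form in which both the Toeplitz reduction and the recursion for alternants perform column
    operations. *)
Lemma ndet_mulr k f U : ndet k U = 1 ->
  ndet k (fun i j => \sum_(s < k) f i s * U s j) = ndet k f.
Proof.
move=> U1; rewrite -[RHS]mulr1 -U1 -det_mulmx; congr (\det _).
by apply/matrixP=> i j; rewrite !mxE; apply: eq_bigr => s _; rewrite !mxE.
Qed.

Lemma ndet_tr k f : ndet k (fun i j => f j i) = ndet k f.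
Proof. by rewrite /ndet -det_tr; congr (\det _); apply/matrixP=> i j; rewrite !mxE. Qed.

Lemma ndet_lblock p q f :
    (forall i j, (i < p)%N -> (j < q)%N -> f i (p + j)%N = 0) ->
  ndet (p + q) f = ndet p f * ndet q (fun i j => f (p + i)%N (p + j)%N).
Proof.
move=> f0; rewrite /ndet -(det_lblock _ (\matrix_(i < q, j < p) f (p + i)%N j)).
congr (\det _); apply/matrixP=> i j.
by case: (split_ordP i) => i' ->; case: (split_ordP j) => j' ->;
  rewrite ?block_mxEul ?block_mxEur ?block_mxEdl ?block_mxEdr !mxE //= f0.
Qed.

Lemma ndet_ublock p q f :
    (forall i j, (i < q)%N -> (j < p)%N -> f (p + i)%N j = 0) ->
  ndet (p + q) f = ndet p f * ndet q (fun i j => f (p + i)%N (p + j)%N).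
Proof.
move=> f0; rewrite -ndet_tr ndet_lblock => [|i j ip jq]; last by rewrite f0.
by rewrite ndet_tr [X in _ * X]ndet_tr.
Qed.

Lemma ndet_scale_rows k (c : nat -> R) f :
  ndet k (fun i j => c i * f i j) = (\prod_(i < k) c i) * ndet k f.
Proof.
rewrite /ndet /determinant mulr_sumr; apply: eq_bigr => s _.
rewrite mulrCA; congr (_ * _); rewrite -big_split /=.
by apply: eq_bigr => i _; rewrite !mxE.
Qed.

End NatDet.

(** * The Jacobi-Trudi determinant of the superalphabet (1, uv | u, v) *)

(* [shiftc h a b] is the coefficient h_(a - b), with h_k = 0 for k < 0. *)
Definition shiftc (R : nmodType) (h : nat -> R) (a b : nat) : R :=
  if (b <= a)%N then h (a - b)%N else 0.

Definition qnum (R : nzRingType) (q : R) (k : nat) : R := \sum_(e < k) q ^+ e.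

Definition qnum2 (R : nzRingType) (u v : R) (k : nat) : R :=
  \sum_(a < k) u ^+ a * v ^+ (k.-1 - a).

Section SuperJT.
Variables (R : comNzRingType) (u v : R).
Let q := u * v.

(* Coefficients of (1 + ut)(1 + vt) / ((1 - t)(1 - uvt)). *)
Definition superh (k : nat) : R :=
  if k is 0 then 1 else (1 + u) * (1 + v) * qnum q k.

(* Coefficients of (1 + ut)(1 + vt). *)
Definition elem2 (k : nat) : R :=
  match k with 0 => 1 | 1 => u + v | 2 => q | _ => 0 end.

Lemma qnumS (x : R) k : qnum x k.+1 = qnum x k + x ^+ k.
Proof. by rewrite /qnum big_ord_recr. Qed.

Lemma qnum0 (x : R) : qnum x 0 = 0.
Proof. by rewrite /qnum big_ord0. Qed.

Lemma qnum2S k : qnum2 u v k.+1 = v * qnum2 u v k + u ^+ k.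
Proof.
rewrite /qnum2 big_ord_recr /= subnn mulr1 mulr_sumr; congr (_ + _).
apply: eq_bigr => a _; rewrite mulrCA; congr (_ * _).
by case: k a => [[]//|k] a /=; rewrite -exprS subSn // -ltnS.
Qed.

Lemma qnum2SS k : qnum2 u v k.+2 = (u + v) * qnum2 u v k.+1 - q * qnum2 u v k.
Proof. rewrite !qnum2S /q exprS; ring. Qed.

(** Coefficient form of multiplying the generating series of [superh] by its denominator (1 - t)(1 -
    uvt). *)
Lemma superh_rec a b :
  shiftc superh a.+2 b - (1 + q) * shiftc superh a.+1 b + q * shiftc superh a b
  = shiftc elem2 a.+2 b.
Proof.
rewrite /shiftc; have [ba|ab] := leqP b a.
  rewrite (leqW ba) (leqW (leqW ba)) !subSn // ?(leqW ba) //.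
  case: (a - b)%N => [|k] /=.
    by rewrite !qnumS qnum0 /q; ring.
  by rewrite !qnumS !exprS; ring.
have [->|ab2] := eqVneq b a.+1.
  by rewrite leqnSn leqnn subnn subSn // subnn /= !qnumS qnum0 /q; ring.
have [->|ab3] := eqVneq b a.+2.
  by rewrite leqnn subnn ltnn /=; ring.
have -> : (b <= a.+2)%N = false by lia.
have -> : (b <= a.+1)%N = false by lia.
ring.
Qed.

(** Splitting the first b, respectively b + 1, powers off the long sums cancels all but one product.
    The left side is the 2 x 2 minor of the first two rows, up to the factors (1 + u)(1 + v). *)
Lemma qnum_exchange (x : R) a b : (b <= a)%N ->
  qnum x a.+1 * qnum x b.+1 - qnum x a.+2 * qnum x b = x ^+ b * qnum x (a - b).+1.
Proof.
move=> ba; have -> : qnum x a.+1 = qnum x b + x ^+ b * qnum x (a - b).+1.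
  rewrite /qnum mulr_sumr -(subnKC ba) -addnS big_split_ord /= addKn.
  by congr (_ + _); apply: eq_bigr => i _; rewrite exprD.
have -> : qnum x a.+2 = qnum x b.+1 + x ^+ b.+1 * qnum x (a - b).+1.
  rewrite /qnum mulr_sumr -(subnKC ba) -!addnS -addSnnS big_split_ord /= addKn.
  by congr (_ + _); apply: eq_bigr => i _; rewrite exprD.
have -> : qnum x b.+1 = 1 + x * qnum x b.
  rewrite /qnum big_ord_recl mulr_sumr.
  by congr (_ + _); apply: eq_bigr => i _; rewrite -exprS.
by rewrite exprS; ring.
Qed.


Definition jtrudi (h : nat -> R) (lam : nat -> nat) (i j : nat) : R :=
  shiftc h (lam i + j) i.

(* Right multiplication by the Toeplitz matrix of (1 - t)(1 - uvt). *)
Lemma superjt_reduce n lam :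
  ndet n (jtrudi superh lam) =
  ndet n (fun i j => match j with
    | 0 => shiftc superh (lam i) i
    | 1 => shiftc superh (lam i).+1 i - (1 + q) * shiftc superh (lam i) i
    | j'.+2 => shiftc elem2 (lam i + j'.+2) i
    end).
Proof.
(* These are the coefficients of (1 - t)(1 - uvt). Columns 0 and 1 have too few predecessors for the
   full recurrence, so [elem2] appears only from column 2 on. *)
pose c k := match k with 0 => 1 | 1 => - (1 + q) | 2 => q | _ => 0 end.
rewrite -(@ndet_mulr _ n _ (fun s j => shiftc c j s)); last first.
  rewrite -ndet_tr ndet_trig => [|i j /andP[ij _]].
    by apply: big1 => i _; rewrite /shiftc leqnn subnn.
  by rewrite /shiftc leqNgt ij.
apply: ndet_ext => i [|[|j]] ni nj.
- rewrite (bigD1 (Ordinal nj)) //= big1 => [|s]; last first.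
    rewrite -val_eqE /= => s0; rewrite /shiftc.
    by rewrite ifF ?mulr0 //; lia.
  by rewrite /jtrudi !addn0 addr0 /shiftc /= mulr1.
- rewrite (bigD1 (Ordinal nj)) //= (bigD1 (Ordinal (ltnW nj))) //= big1 => [|s]; last first.
    rewrite -!val_eqE /= => s0; rewrite /shiftc.
    by rewrite ifF ?mulr0 //; lia.
  by rewrite /jtrudi !addn0 addn1 {2 4}/shiftc /=; ring.
rewrite (bigD1 (Ordinal nj)) //= (bigD1 (Ordinal (ltnW nj))) /=; last first.
  by rewrite -val_eqE /=; lia.
rewrite (bigD1 (Ordinal (ltnW (ltnW nj)))) /=; last by rewrite -!val_eqE /=; lia.
rewrite big1 => [|s]; last first.
  rewrite -!val_eqE /= => s0; rewrite /shiftc.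
  case: leqP => sj; last by rewrite mulr0.
  by rewrite (_ : j.+2 - s = (j - s - 1).+3)%N ?mulr0 //; lia.
have -> : shiftc c j.+2 j.+2 = 1 by rewrite /shiftc leqnn subnn.
have -> : shiftc c j.+2 j.+1 = - (1 + q) by rewrite /shiftc leqnSn subSn // subnn.
have -> : shiftc c j.+2 j = q by rewrite /shiftc ifT ?subSn ?subnn //; lia.
by rewrite /jtrudi !addnS -superh_rec; ring.
Qed.

(** A row of length 2 has [elem2 2], that is uv, on the diagonal and only degrees above 2 to its
    right, so it contributes a factor uv. *)
Lemma ndet_elem2_two l w f :
    (forall i j, (i < l)%N -> f i j = shiftc elem2 (2 + j) i) ->
  ndet (l + w) f = q ^+ l * ndet w (fun i j => f (l + i)%N (l + j)%N).
Proof.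
move=> fE; rewrite ndet_lblock => [|i j il _]; last first.
  rewrite fE // /shiftc ifT; last by lia.
  by have -> : (2 + (l + j) - i = (l + j - i - 1).+3)%N by lia.
congr (_ * _); rewrite ndet_trig => [|i j /andP[ij jl]]; last first.
  rewrite fE ?(ltn_trans ij) // /shiftc ifT; last by lia.
  by have -> : (2 + j - i = (j - i - 1).+3)%N by lia.
rewrite (eq_bigr (fun=> q)) ?prodr_const ?card_ord // => i _.
by rewrite fE // /shiftc leq_addl addnK.
Qed.

(** The matrix is tridiagonal, with u + v on the diagonal, uv above and 1 below. Expansion along the
    first row gives the recurrence [qnum2SS], so the induction carries two consecutive sizes. *)
Lemma ndet_elem2_one k :
  ndet k (fun i j => shiftc elem2 (1 + j) i) = qnum2 u v k.+1.
Proof.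
suff : ndet k (fun i j => shiftc elem2 (1 + j) i) = qnum2 u v k.+1 /\
  ndet k.+1 (fun i j => shiftc elem2 (1 + j) i) = qnum2 u v k.+2 by case.
elim: k => [|k [IH1 IH2]]; split=> //.
- by rewrite ndet0 /qnum2 big_ord1 mulr1.
- by rewrite ndet1 /qnum2 !big_ord_recl big_ord0 /shiftc /= !addr0 mulr1 mul1r addrC.
rewrite qnum2SS -IH1 -IH2 {1}/ndet (expand_det_row _ 0) !big_ord_recl big1 => [|j _]; last first.
  by rewrite mxE /= /shiftc /= mul0r.
rewrite /cofactor !mxE /= addr0 /shiftc /= expr0 mul1r /= expr1 mulN1r mulrN.
congr (_ * _ - _ * _).
  by congr (\det _); apply/matrixP=> i j; rewrite !mxE /= /bump /= !add1n.
rewrite (expand_det_col _ 0) big_ord_recl big1 => [|i _]; last first.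
  by rewrite !mxE /= /bump /= mul0r.
rewrite !mxE /= /bump /= /cofactor addr0 /= expr0 !mul1r.
by congr (\det _); apply/matrixP=> i j; rewrite !mxE /= /bump /= !add1n.
Qed.

(** After the reduction the first two rows vanish from column 2 on, their indices exceeding the
    degree of [elem2]. The remaining rows have lengths 2, 1 and 0, and these blocks contribute
    (uv)^l, [k + 1]_(u,v) and 1. *)
Lemma superjt_double_hook lam1 lam2 l k z (lam : nat -> nat) :
    (2 <= lam2)%N -> (lam2 <= lam1)%N ->
    lam 0%N = lam1 -> lam 1%N = lam2 ->
    (forall i, (i < l)%N -> lam (2 + i)%N = 2) ->
    (forall i, (i < k)%N -> lam (2 + (l + i))%N = 1%N) ->
    (forall i, lam (2 + (l + (k + i)))%N = 0%N) ->
  ndet (2 + (l + (k + z))) (jtrudi superh lam) =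
  (1 + u) ^+ 2 * (1 + v) ^+ 2 * q ^+ (lam2 + l).-1
    * qnum q (lam1 - lam2).+1 * qnum2 u v k.+1.
Proof.
move=> h2 h12 l0 l1 ll lk lz; rewrite superjt_reduce ndet_lblock => [|[|[|//]] j _ _] /=.
- rewrite ndet2 /= (ndet_elem2_two (l := l)) => [|i j il]; last first.
    by rewrite ll // /shiftc -[in RHS](subnDl 2) -(leq_add2l 2) addnA addnC.
  rewrite (ndet_ublock (p := k)) => [|i j iz jk]; last first.
    by rewrite lz /shiftc ifF //; lia.
  rewrite [X in _ * (_ * (X * _))](_ : _ = qnum2 u v k.+1); last first.
    rewrite -ndet_elem2_one; apply: ndet_ext => i j ik jk.
    rewrite lk // /shiftc; case: leqP => h; case: leqP => h'; try lia; try by [].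
    by congr elem2; lia.
  rewrite [X in _ * (_ * (_ * X))](_ : _ = 1); last first.
    rewrite -ndet_tr ndet_trig => [|i j ij].
      have E a : shiftc elem2 a a = 1 by rewrite /shiftc leqnn subnn.
      by apply: big1 => i _; rewrite lz; exact: E.
    by rewrite lz /shiftc ifF //; lia.
  rewrite l0 l1 mulr1 /shiftc !subn0 /= ifT; last by lia.
  rewrite !subn1 /=.
  (* As lam2 - 1 >= 1, no entry of the minor is the exceptional [superh 0 = 1]; each one carries (1
     + u)(1 + v), whence the squares. *)
  case: lam2 h2 h12 {l1} => [//|[//|b]] _; case: lam1 {l0} => [//|a] ba.
  have := @qnum_exchange q a b.+1 ba; rewrite subSS => E.
  rewrite (_ : (b.+2 + l).-1 = b.+1 + l)%N // exprD.
  transitivity ((1 + u) ^+ 2 * (1 + v) ^+ 2 * (qnum q a.+1 * qnum q b.+2 - qnum q a.+2 * qnum q b.+1)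
    * q ^+ l * qnum2 u v k.+1); first by rewrite /superh /=; ring.
  by rewrite E; ring.
- by rewrite l0 /shiftc /= subn0 (_ : lam1 + _ = (lam1 + j).-1.+3)%N //; lia.
- rewrite l1 /shiftc ifT; last by lia.
  by rewrite (_ : lam2 + _ - 1 = (lam2 + j - 2).+3)%N //; lia.
Qed.

End SuperJT.

(** * The bialternant formula for Schur polynomials *)

Definition pext n (mu : part n) (j : nat) : nat :=
  oapp (fun j' : 'I_n => mu j' : nat) 0%N (insub j).

Definition perm_nat k (s : 'S_k) (j : nat) : nat :=
  oapp (fun j' : 'I_k => s j' : nat) 0%N (insub j).

Lemma perm_natE k (s : 'S_k) (j : 'I_k) : perm_nat s j = s j.
Proof. by rewrite /perm_nat valK. Qed.

Lemma pextE n (mu : part n) (j : 'I_n) : pext mu j = mu j.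
Proof. by rewrite /pext valK. Qed.

Lemma pext_geq n (mu : part n) j : (n <= j)%N -> pext mu j = 0%N.
Proof. by move=> nj; rewrite /pext insubF // ltnNge nj. Qed.

Lemma ndet_leibniz (R : comNzRingType) k (f : nat -> nat -> R) :
  ndet k f = \sum_(s : 'S_k) (-1) ^+ s * \prod_(j < k) f (perm_nat s j) j.
Proof.
rewrite -ndet_tr; apply: eq_bigr => s _; congr (_ * _).
by apply: eq_bigr => j _; rewrite mxE perm_natE.
Qed.

Lemma card_ord_below n m : (m <= n)%N -> #|[set c : 'I_n | (c < m)%N]| = m.
Proof.
move=> mn; rewrite -sum1dep_card -(big_ord_widen_cond _ predT (fun=> 1%N)) //.
by rewrite sum1_card card_ord.
Qed.

(** Applied to a row of a tableau, whose cells with entries below a bound form an initial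
    segment. *)
Lemma mem_down_closed n (A : {set 'I_n}) :
    (forall c c' : 'I_n, (c <= c')%N -> c' \in A -> c \in A) ->
  forall c, (c \in A) = (c < #|A|)%N.
Proof.
move=> dA c; have [cA|cA] := boolP (c \in A).
  apply/esym; rewrite -[X in (X <= _)%N](@card_ord_below n c.+1) //.
  by apply/subset_leq_card/subsetP => c'; rewrite inE ltnS => /dA; apply.
apply/esym/negbTE; rewrite -leqNgt -[X in (_ <= X)%N](@card_ord_below n c (ltnW (ltn_ord c))).
apply/subset_leq_card/subsetP => c'; rewrite inE ltnNge => c'A.
by apply: contra cA => /dA; apply.
Qed.

Section Bialternant.
Variables (R : comNzRingType) (x : nat -> R).

Definition alternant k (mu : nat -> nat) : R :=
  ndet k (fun i j => x i ^+ (mu j + (k.-1 - j))).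

(** With d = mu_(j+1) and d + e = mu_j, the exponents c of the quotient by a - b are exactly the row
    lengths allowed by interlacing. *)
Lemma geom_diff (a b : R) d e :
  a ^+ (d + e).+1 - b ^+ e.+1 * a ^+ d
  = (a - b) * \sum_(d <= c < (d + e).+1) a ^+ c * b ^+ (d + e - c).
Proof.
rewrite (_ : \sum_(d <= c < _) _ = \sum_(c < e.+1) a ^+ (c + d) * b ^+ (e - c)); last first.
  rewrite -{1}[d]add0n big_addn subSn ?leq_addr // addKn big_mkord.
  by apply: eq_bigr => i _; congr (_ * _ ^+ _); lia.
rewrite -addnS exprD [b ^+ _ * _]mulrC -mulrBr subrXX mulrCA; congr (_ * _).
rewrite mulr_sumr (reindex_inj rev_ord_inj) /=; apply: eq_bigr => i _.
by rewrite subSS subKn -1?ltnS // mulrA -exprD addnC.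
Qed.

(* Subtract from each column the multiple of the next one that kills its last entry. *)
Lemma alternantS k (mu : nat -> nat) :
    (forall j, (j < k)%N -> (mu j.+1 <= mu j)%N) ->
  alternant k.+1 mu = x k ^+ mu k * (\prod_(i < k) (x i - x k)) *
    ndet k (fun i j => \sum_(mu j.+1 <= b < (mu j).+1)
                          x i ^+ (b + (k.-1 - j)) * x k ^+ (mu j - b)).
Proof.
move=> dmu.
pose U s j : R := if s == j then 1
                  else if s == j.+1 then - x k ^+ (mu j - mu j.+1).+1 else 0.
rewrite /alternant -(@ndet_mulr _ k.+1 _ U); last first.
  rewrite ndet_trig => [|i j /andP[ij _]]; first by apply: big1 => i _; rewrite /U eqxx.
  by rewrite /U !ifF //; lia.
rewrite -addn1 ndet_ublock => [|[|//] j _ jk]; last first.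
  have jk1 : (j < k + 1)%N by lia.
  have jk2 : (j.+1 < k + 1)%N by lia.
  rewrite (bigD1 (Ordinal jk1)) //= (bigD1 (Ordinal jk2)) /=; last first.
    by rewrite -val_eqE /=; lia.
  rewrite big1 => [|s]; last first.
    by rewrite -!val_eqE /U /= => /andP[/negbTE-> /negbTE->]; rewrite mulr0.
  rewrite /U !eqxx ifF /=; last by lia.
  rewrite addn0 addr0 mulr1 mulrN -exprD; apply/eqP; rewrite subr_eq0; apply/eqP.
  by congr (_ ^+ _); have := dmu j jk; lia.
rewrite ndet1 mulrC -mulrA; congr (_ * _).
  have kk : (k < k + 1)%N by lia.
  rewrite (bigD1 (Ordinal kk)) //= big1 => [|s]; last first.
    rewrite -!val_eqE /U /= addn0 => /negbTE->; rewrite ifF ?mulr0 //.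
    by have := ltn_ord s; lia.
  by rewrite /U addn0 eqxx mulr1 addr0; congr (_ ^+ _); lia.
rewrite -(ndet_scale_rows k (fun i => x i - x k)); apply: ndet_ext => i j ik jk.
have jk1 : (j < k + 1)%N by lia.
have jk2 : (j.+1 < k + 1)%N by lia.
rewrite (bigD1 (Ordinal jk1)) //= (bigD1 (Ordinal jk2)) /=; last first.
  by rewrite -val_eqE /=; lia.
rewrite big1 => [|s]; last first.
  by rewrite -!val_eqE /U /= => /andP[/negbTE-> /negbTE->]; rewrite mulr0.
rewrite /U !eqxx ifF /=; last by lia.
have := @geom_diff (x i) (x k) (mu j.+1) (mu j - mu j.+1); rewrite subnKC ?dmu // => E.
under eq_bigr do rewrite exprD mulrAC.
rewrite -mulr_suml mulrA -E addr0 mulr1 mulrN mulrBl -exprD; congr (_ - _).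
  by congr (_ ^+ _); lia.
by rewrite mulrC -mulrA -exprD; congr (_ * _ ^+ _); lia.
Qed.

End Bialternant.

(** * Branching of semistandard tableaux by removal of the largest entry *)

Section Branching.
Variables (n : nat).
Implicit Types (mu nu : part n) (T : {ffun 'I_n * 'I_n -> 'I_n}).

Definition decreasing mu := forall i j : 'I_n, (i <= j)%N -> (mu j <= mu i)%N.

Definition ssyt_spec mu T : Prop :=
  [/\ forall r (c : 'I_n), (mu r <= c)%N -> T (r, c) = 0%N :> nat,
      forall r (c c' : 'I_n), (c < c')%N -> (c' < mu r)%N -> (T (r, c) <= T (r, c'))%N &
      forall (r r' c : 'I_n), (r < r')%N -> (c < mu r')%N -> (T (r, c) < T (r', c))%N].

Lemma ssytP mu T : reflect (ssyt_spec mu T) (ssyt mu T).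
Proof.
apply: (iffP and3P) => [[/forallP h1 /forallP h2 /forallP h3]|[h1 h2 h3]]; split.
- by move=> r c rc; apply/eqP; apply: (implyP (h1 (r, c))).
- move=> r c c' cc' c'mu; apply: (implyP (forallP (h2 (r, c)) (r, c'))).
  by rewrite /= eqxx cc'.
- move=> r r' c rr' cmu; apply: (implyP (forallP (h3 (r, c)) (r', c))).
  by rewrite /= eqxx rr'.
- by apply/forallP => -[r c]; apply/implyP => /h1 /eqP.
- apply/forallP => -[r c]; apply/forallP => -[r' c']; apply/implyP => /= /and3P[/eqP <-].
  exact: h2.
- apply/forallP => -[r c]; apply/forallP => -[r' c']; apply/implyP => /= /and3P[/eqP <-].
  exact: h3.
Qed.

Definition ssyt_below k mu T :=
  ssyt mu T && [forall rc : 'I_n * 'I_n, (rc.2 < mu rc.1)%N ==> (T rc < k)%N].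

Lemma ssyt_belowP k mu T :
  reflect (ssyt_spec mu T /\ forall r (c : 'I_n), (c < mu r)%N -> (T (r, c) < k)%N)
          (ssyt_below k mu T).
Proof.
apply: (iffP andP) => [[/ssytP hT /forallP h]|[/ssytP hT h]]; split=> //.
  by move=> r c; apply/implyP: (h (r, c)).
by apply/forallP => -[r c]; apply/implyP => /h.
Qed.

(** The skew shape mu / nu is a horizontal strip; [pext] supplies an empty row below the last
    one. *)
Definition interlacing mu nu := [forall r : 'I_n, (pext mu r.+1 <= nu r <= mu r)%N].

Lemma interlacing_lt mu nu (r r' : 'I_n) :
  decreasing mu -> interlacing mu nu -> (r < r')%N -> (mu r' <= nu r)%N.
Proof.
move=> dmu /forallP/(_ r)/andP[h _] rr'; apply: leq_trans h.
have rn : (r.+1 < n)%N by apply: leq_ltn_trans rr' _.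
by rewrite -[r.+1]/(val (Ordinal rn)) pextE; apply: dmu.
Qed.

Lemma interlacing_decreasing mu nu :
  decreasing mu -> interlacing mu nu -> decreasing nu.
Proof.
move=> dmu imn i j; rewrite leq_eqVlt => /orP[/eqP/val_inj-> //|ij].
apply: leq_trans (interlacing_lt dmu imn ij).
by case/andP: (forallP imn j).
Qed.

Section Step.
Variables (k : 'I_n) (mu : part n).
Hypothesis dmu : decreasing mu.

Let zero : 'I_n := Ordinal (leq_ltn_trans (leq0n k) (ltn_ord k)).

(** Cells with entries below k form the inner shape. [restrict] erases the other cells and [extend]
    refills them with k, which is the bijection behind the branching rule. *)
Let inner_cells T (r : 'I_n) := [set c : 'I_n | (c < mu r)%N && (T (r, c) < k)%N].

Let inner_shape T : part n := [ffun r => inord #|inner_cells T r|].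

Let restrict nu T : {ffun 'I_n * 'I_n -> 'I_n} :=
  [ffun rc : 'I_n * 'I_n => if (rc.2 < nu rc.1)%N then T rc else zero].

Let extend nu T : {ffun 'I_n * 'I_n -> 'I_n} :=
  [ffun rc : 'I_n * 'I_n => if (rc.2 < nu rc.1)%N then T rc
              else if (rc.2 < mu rc.1)%N then k else zero].

Let inner_shapeE T : ssyt_spec mu T ->
  forall r (c : 'I_n), (c < inner_shape T r)%N = (c < mu r)%N && (T (r, c) < k)%N.
Proof.
move=> [_ h _] r c; rewrite ffunE inordK; last first.
  by rewrite ltnS -[X in (_ <= X)%N]card_ord max_card.
rewrite -mem_down_closed ?inE // => c1 c2; rewrite leq_eqVlt !inE.
move=> /orP[/eqP/val_inj->//|c12] /andP[c2mu Tk].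
by rewrite (ltn_trans c12 c2mu) (leq_ltn_trans (h _ _ _ c12 c2mu) Tk).
Qed.

(** A cell with a cell of mu directly below it has an entry strictly smaller than one that is at
    most k, hence belongs to the inner shape. *)
Let inner_shape_interlacing T : ssyt_below k.+1 mu T -> interlacing mu (inner_shape T).
Proof.
move=> /ssyt_belowP[hT hk]; have hE := inner_shapeE hT; apply/forallP => r.
have le_mu : (inner_shape T r <= mu r)%N.
  rewrite leqNgt; apply/negP => lt.
  have cn : (mu r < n)%N by apply: leq_trans lt _; rewrite -ltnS.
  by have := hE r (Ordinal cn); rewrite /= lt ltnn.
rewrite le_mu andbT; case: (ltnP r.+1 n) => rn; last by rewrite pext_geq.
rewrite -[r.+1]/(val (Ordinal rn)) pextE leqNgt; apply/negP => lt.
have cn : (inner_shape T r < n)%N by apply: leq_trans lt _; rewrite -ltnS.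
have := hE r (Ordinal cn); rewrite /= ltnn; case: hT => _ _ h3.
have := h3 r (Ordinal rn) (Ordinal cn) (ltnSn _) lt.
have := hk (Ordinal rn) (Ordinal cn) lt; rewrite ltnS => h1 h2.
by rewrite (leq_trans h2 h1) andbT (leq_trans lt) // dmu //= leqnSn.
Qed.

Let extend_restrict nu T :
  ssyt_below k.+1 mu T -> inner_shape T = nu -> extend nu (restrict nu T) = T.
Proof.
move=> /ssyt_belowP[hT hk] hnu; apply/ffunP => -[r c]; rewrite !ffunE /=.
have := inner_shapeE hT r c; rewrite hnu => hE; case: (boolP (c < nu r)%N) => h1 //; case: ifP => h2.
  apply: val_inj => /=; apply/eqP; rewrite eqn_leq.
  have := hk r c h2; rewrite ltnS => ->; rewrite andbT leqNgt.
  by move: h1; rewrite hE h2.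
by apply: val_inj; case: hT => h _ _; rewrite /= h // leqNgt h2.
Qed.


(** An equality of Booleans, because it identifies the two summation ranges after [reindex_onto]. *)
Let extendP nu T : interlacing mu nu ->
  ssyt_below k nu T =
  (ssyt_below k.+1 mu (extend nu T) && (inner_shape (extend nu T) == nu))
  && (restrict nu (extend nu T) == T).
Proof.
move=> imn; have nu_mu r : (nu r <= mu r)%N by case/andP: (forallP imn r).
apply/idP/idP => [/ssyt_belowP[[h1 h2 h3] hk]|].
  apply/andP; split; last first.
    apply/eqP/ffunP => -[r c]; rewrite !ffunE /=; case: (boolP (c < nu r)%N) => // h.
    by apply: val_inj; rewrite /= h1 // leqNgt.
  apply/andP; split; last first.
    apply/eqP/ffunP => r; rewrite ffunE; apply: val_inj.
    have nun : (nu r <= n)%N by rewrite -ltnS.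
    rewrite [in RHS]/= -[RHS](card_ord_below nun) /= inordK; last first.
      by rewrite ltnS -[X in (_ <= X)%N]card_ord max_card.
    congr #|pred_of_set _|; apply/setP => c; rewrite !inE ffunE /=.
    case: (ltnP c (nu r)) => h; first by rewrite (leq_trans h (nu_mu r)) hk.
    by case: ifP; rewrite ?ltnn.
  apply/ssyt_belowP; split=> [|r c cmu]; last first.
    rewrite ffunE /= cmu; case: ifP => h; last exact: ltnSn.
    by apply: ltnW; apply: hk.
  split.
  - move=> r c mc; rewrite ffunE /= ltnNge (leq_trans (nu_mu r) mc) /=.
    by rewrite ltnNge mc.
  - move=> r c c' cc' c'mu; rewrite !ffunE /= c'mu (ltn_trans cc' c'mu).
    case: (ltnP c' (nu r)) => h'; first by rewrite (ltn_trans cc' h') h2.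
    by case: ifP => h //; apply: ltnW; apply: hk.
  - move=> r r' c rr' cmu; rewrite !ffunE /= cmu.
    have cnu : (c < nu r)%N by apply: leq_trans cmu (interlacing_lt dmu imn rr').
    by rewrite cnu; case: ifP => h; [apply: h3|apply: hk].
move=> /andP[/andP[/ssyt_belowP[hT hk] /eqP hnu] /eqP hr].
have hE r (c : 'I_n) : (c < nu r)%N -> extend nu T (r, c) = T (r, c).
  by move=> h; rewrite ffunE /= h.
have := inner_shapeE hT; rewrite hnu => hnuE; case: (hT) => h1 h2 h3.
apply/ssyt_belowP; split=> [|r c cnu]; last first.
  by have := hnuE r c; rewrite cnu hE // => /esym/andP[].
split.
- by move=> r c; rewrite leqNgt -{1}hr ffunE /= => /negbTE ->.
- move=> r c c' cc' c'nu; have := h2 r c c' cc' (leq_trans c'nu (nu_mu r)).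
  by rewrite !hE // (ltn_trans cc').
- move=> r r' c rr' cnu; have cmu := leq_trans cnu (nu_mu r').
  have := h3 r r' c rr' cmu; rewrite !hE //.
  exact: leq_trans cmu (interlacing_lt dmu imn rr').
Qed.

Lemma schur_below_branch (R : comNzRingType) (x : nat -> R) :
  \sum_(T | ssyt_below k.+1 mu T) \prod_(rc : 'I_n * 'I_n | (rc.2 < mu rc.1)%N) x (T rc)
  = \sum_(nu | interlacing mu nu)
     (\sum_(T | ssyt_below k nu T) \prod_(rc : 'I_n * 'I_n | (rc.2 < nu rc.1)%N) x (T rc))
     * x k ^+ (\sum_r (mu r - nu r)).
Proof.
rewrite (partition_big inner_shape (interlacing mu)) => [|T]; last first.
  exact: inner_shape_interlacing.
apply: eq_bigr => nu imn; rewrite mulr_suml.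
have nu_mu r : (nu r <= mu r)%N by case/andP: (forallP imn r).
rewrite (reindex_onto (extend nu) (restrict nu)) => [|T /andP[hT /eqP hnu]]; last first.
  exact: extend_restrict.
apply: eq_big => [T|T]; first by rewrite -extendP.
rewrite -extendP // => hT; rewrite (bigID (fun rc : 'I_n * 'I_n => rc.2 < nu rc.1)%N) /=; congr (_ * _).
  apply: eq_big => [[r c]|[r c]] /=; last by move=> /andP[_ h]; rewrite ffunE /= h.
  by case: (ltnP c (nu r)) => h; rewrite ?andbF // (leq_trans h (nu_mu r)).
rewrite (eq_bigr (fun=> x k)) => [|[r c] /= /andP[h1 h2]]; last first.
  by rewrite ffunE /= (negbTE h2) h1.
rewrite -prodrXr -(pair_big_dep predT (fun r c : 'I_n => (c < mu r)%N && ~~ (c < nu r)%N) (fun _ _ => x k)) /=.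
apply: eq_bigr => r _; rewrite prodr_const; congr (_ ^+ _).
have mun : (mu r <= n)%N by rewrite -ltnS.
rewrite -[in RHS](card_ord_below mun) -[in RHS](card_ord_below (leq_trans (nu_mu r) mun)).
rewrite -cardsDS; last first.
  by apply/subsetP => c; rewrite !inE => h; apply: leq_trans h (nu_mu r).
by apply: eq_card => c; rewrite !inE andbC.
Qed.

End Step.
End Branching.

(** * Schur polynomials as quotients of alternants *)

Section SchurBialternant.
Variables (n : nat) (R : comNzRingType) (x : nat -> R).
Implicit Types (mu nu : part n).

Definition schur_below k mu : R :=
  \sum_(T | ssyt_below k mu T) \prod_(rc : 'I_n * 'I_n | (rc.2 < mu rc.1)%N) x (T rc).

(** Entries increase strictly down the first column, so row r would need an entry at least r, hence
    at least k. *)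
Lemma schur_below_long k mu (r : 'I_n) :
  decreasing mu -> (k <= r)%N -> (0 < mu r)%N -> schur_below k mu = 0.
Proof.
move=> dmu kr mur; apply: big_pred0 => T; apply/negP => /ssyt_belowP[[_ _ h3] hk].
pose c0 : 'I_n := Ordinal (leq_ltn_trans (leq0n r) (ltn_ord r)).
have hT m (s : 'I_n) : s = m :> nat -> (0 < mu s)%N -> (m <= T (s, c0))%N.
  elim: m s => [//|m IH] s sm mus.
  have mn : (m < n)%N by rewrite -sm ltnW.
  have ms : (Ordinal mn < s)%N by rewrite /= sm.
  have mum : (0 < mu (Ordinal mn))%N by apply: leq_trans mus (dmu _ _ (ltnW ms)).
  exact: leq_ltn_trans (IH (Ordinal mn) erefl mum) (h3 _ _ c0 ms mus).
by have := leq_ltn_trans (leq_trans kr (hT r r erefl mur)) (hk r c0 mur); rewrite ltnn.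
Qed.

Lemma schur_below0 mu : (0 < n)%N -> (forall r, mu r = 0%N :> nat) -> schur_below 0 mu = 1.
Proof.
move=> n0 mu0; pose zero : 'I_n := Ordinal n0.
rewrite /schur_below (big_pred1 [ffun=> zero]) => [|T].
  by apply: big_pred0 => -[r c]; rewrite /= mu0.
apply/ssyt_belowP/eqP => [[[h1 _ _] _]|->].
  by apply/ffunP => -[r c]; apply: val_inj; rewrite ffunE /= h1 ?mu0.
by split; [split|] => [r c _|r c c' _|r r' c _|r c]; rewrite ?mu0 ?ffunE.
Qed.

(* The interlacing conditions on the rows are independent, so the sum over nu
   splits column by column in the alternant. *)
Lemma sum_interlacing k mu :
    (k < n)%N -> (forall r : 'I_n, (k < r)%N -> mu r = 0%N :> nat) ->
  \sum_(nu | interlacing mu nu && [forall r : 'I_n, (k <= r)%N ==> (nu r == 0%N :> nat)])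
     alternant x k (pext nu) * x k ^+ (\sum_r (mu r - nu r))
  = x k ^+ pext mu k *
    ndet k (fun i j => \sum_(pext mu j.+1 <= b < (pext mu j).+1)
                         x i ^+ (b + (k.-1 - j)) * x k ^+ (pext mu j - b)).
Proof.
move=> kn mu0; under eq_bigr do rewrite /alternant ndet_leibniz mulr_suml.
rewrite exchange_big /= ndet_leibniz mulr_sumr; apply: eq_bigr => s _.
rewrite mulrCA; under eq_bigr do rewrite -mulrA.
rewrite -mulr_sumr; congr (_ * _).
pose Q (r : 'I_n) (b : 'I_n.+1) :=
  (pext mu r.+1 <= b <= mu r)%N && ((k <= r)%N ==> (b == 0%N :> nat)).
pose F (r : 'I_n) (b : 'I_n.+1) :=
  (if (r < k)%N then x (perm_nat s r) ^+ (b + (k.-1 - r)) else 1) * x k ^+ (mu r - b).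
transitivity (\prod_(r < n) \sum_(b | Q r b) F r b).
  rewrite bigA_distr_big_dep; apply: eq_big => [nu|nu _].
    apply/andP/familyP => [[/forallP h1 /forallP h2] r|h].
      by rewrite unfold_in /Q h1 h2.
    by split; apply/forallP => r; have := h r; rewrite unfold_in => /andP[].
  rewrite big_split /= prodrXr; congr (_ * _).
  rewrite -big_mkcond /= (big_ord_widen n (fun j => x (perm_nat s j) ^+ (pext nu j + (k.-1 - j))) (ltnW kn)) /=.
  by apply: eq_bigr => r _; rewrite pextE.
rewrite (bigID (fun r : 'I_n => r < k)%N) /= mulrC; congr (_ * _); last first.
  rewrite (big_ord_widen n (fun j => \sum_(pext mu j.+1 <= b < (pext mu j).+1)
     x (perm_nat s j) ^+ (b + (k.-1 - j)) * x k ^+ (pext mu j - b)) (ltnW kn)) /=.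
  apply: eq_bigr => r rk; rewrite pextE big_geq_mkord.
  rewrite (big_ord_widen_cond n.+1 (fun b => pext mu r.+1 <= b)%N
      (fun b => x (perm_nat s r) ^+ (b + (k.-1 - r)) * x k ^+ (mu r - b))) //.
  apply: eq_big => b; last by rewrite /F rk.
  by rewrite /Q [(k <= r)%N]leqNgt rk /= andbT.
(* Row k is forced to become empty and contributes x_k to the power mu_k; the rows after it are
   already empty and contribute 1. *)
rewrite (bigD1 (Ordinal kn)) /=; last by rewrite ltnn.
rewrite [X in _ * X]big1 => [|r]; last first.
  rewrite -leqNgt -val_eqE /= => /andP[kr rk]; have {kr rk} kr : (k < r)%N by lia.
  have p0 : pext mu r.+1 = 0%N.
    case: (ltnP r.+1 n) => rn; last by rewrite pext_geq.
    by rewrite -[r.+1]/(val (Ordinal rn)) pextE mu0 //= ltnW.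
  rewrite (big_pred1 ord0) => [|b]; first by rewrite /F mu0 // ltnNge ltnW // expr0 mulr1.
  rewrite /Q p0 mu0 // (ltnW kr) leqn0 /= -val_eqE /=.
  by case: (nat_of_ord b).
have p0 : pext mu k.+1 = 0%N.
  case: (ltnP k.+1 n) => rn; last by rewrite pext_geq.
  by rewrite -[k.+1]/(val (Ordinal rn)) pextE mu0 /=.
rewrite mulr1 (big_pred1 ord0) => [|b].
  by rewrite /F /= ltnn mul1r subn0 -pextE.
rewrite /= /Q p0 /= leqnn /= -val_eqE /=; case: eqP => [->|_]; last by rewrite andbF.
by rewrite leq0n.
Qed.

(** Induction on the number of variables: [alternantS] and the branching rule peel off the last
    variable in the same way, and the product of the x_i - x_k is common to the alternants of mu and
    of 0. Inner shapes with more than k rows drop out by [schur_below_long]. *)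
Lemma schur_below_bialternant k mu :
    (0 < n)%N -> (k <= n)%N -> decreasing mu ->
    (forall r : 'I_n, (k <= r)%N -> mu r = 0%N :> nat) ->
  alternant x k (pext mu) = alternant x k (fun=> 0%N) * schur_below k mu.
Proof.
move=> n0; elim: k mu => [|k IH] mu kn dmu mu0.
  by rewrite /alternant !ndet0 schur_below0 ?mulr1 // => r; rewrite mu0.
rewrite [in RHS]alternantS // alternantS => [|j jk]; last first.
  have jn : (j.+1 < n)%N by apply: leq_trans kn.
  rewrite -[j.+1]/(val (Ordinal jn)) -[j]/(val (Ordinal (ltnW jn))) !pextE.
  exact: dmu.
rewrite -[LHS]mulrA [LHS]mulrCA -sum_interlacing //.
rewrite expr0 mul1r -[RHS]mulrA; congr (_ * _).
rewrite [ndet k _](_ : _ = alternant x k (fun=> 0%N)); last first.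
  by apply: ndet_ext => i j _ _; rewrite big_nat1 mulr1.
rewrite /schur_below (@schur_below_branch n (Ordinal kn) mu dmu) mulr_sumr.
rewrite [RHS](bigID (fun nu : part n => [forall r : 'I_n, (k <= r)%N ==> (nu r == 0%N :> nat)])) /=.
rewrite [X in _ = _ + X]big1 ?addr0 => [|nu /andP[inu]]; last first.
  rewrite negb_forall => /existsP[r]; rewrite negb_imply -lt0n => /andP[kr nur].
  rewrite -/(schur_below k nu) (schur_below_long _ kr nur) ?mul0r ?mulr0 //.
  exact: interlacing_decreasing inu.
apply: eq_bigr => nu /andP[inu /forallP nu0]; rewrite mulrA IH ?(ltnW kn) //.
  exact: interlacing_decreasing inu.
by move=> r kr; apply/eqP/(implyP (nu0 r)).
Qed.

End SchurBialternant.

(** * Extraction of Schur coefficients *)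

Section HallSchur.
Variable n : nat.
Hypothesis n_gt0 : (0 < n)%N.
Implicit Types (mu nu lam : part n) (f g : {mpoly rat[n]}) (m : 'X_{1..n}).

Local Notation "m # s" := [multinom m (s i) | i < n]
  (at level 40, left associativity, format "m # s").

Let xvar (i : nat) : {mpoly rat[n]} := oapp (fun j : 'I_n => 'X_j) 0 (insub i).

Let xvarE (i : 'I_n) : xvar i = 'X_i.
Proof. by rewrite /xvar valK. Qed.

Definition stair (mu : nat -> nat) : 'X_{1..n} := [multinom mu j + (n.-1 - j) | j < n].

Definition altpoly (mu : nat -> nat) : {mpoly rat[n]} :=
  \sum_(s : 'S_n) (-1) ^+ s *: msym s 'X_[stair mu].

Lemma altpolyE al : altpoly al = alternant xvar n al.
Proof.
rewrite /alternant ndet_leibniz; apply: eq_bigr => s _.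
case: (odd_perm s); rewrite ?expr1 ?expr0 ?scaleN1r ?scale1r ?mulN1r ?mul1r;
  do ?congr (- _); rewrite [in LHS]mpolyXE_id rmorph_prod /=;
  by apply: eq_bigr => j _; rewrite rmorphXn /= perm_natE xvarE /msym mmapX mmap1U mnmE.
Qed.

Definition antisym g := forall s : 'S_n, msym s g = (-1) ^+ s *: g.

Lemma altpoly_antisym al : antisym (altpoly al).
Proof.
move=> t; rewrite /altpoly raddf_sum scaler_sumr /= [RHS](reindex_inj (mulIg t)) /=.
apply: eq_bigr => s _; rewrite msymZ msymMm scalerA odd_permM signr_addb.
by rewrite mulrCA -expr2 sqrr_sign mulr1.
Qed.

Lemma antisym_mcoeff g m (s : 'S_n) : antisym g -> g@_(m#s) = (-1) ^+ s * g@_m.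
Proof. by move=> ag; rewrite -mcoeff_sym ag mcoeffZ. Qed.

(** If the two exponents were equal, the transposition would kill the coefficient; if they
    increased, the transposed exponent would be a larger element of the support. *)
Lemma antisym_mlead g (i j : 'I_n) : antisym g -> g != 0 -> (i < j)%N ->
  (mlead g j < mlead g i)%N.
Proof.
move=> ag g0 ij; set m := mlead g; have mg : g@_m != 0 by rewrite mleadc_eq0.
have ij' : i != j by rewrite -val_eqE /= neq_ltn ij.
have gt : g@_(m#(tperm i j)) = - g@_m.
  by rewrite antisym_mcoeff // odd_tperm ij' expr1 mulN1r.
rewrite ltn_neqAle; apply/andP; split.
  apply/negP => /eqP mij; have mt : m#(tperm i j) = m.
    by apply/mnmP => k; rewrite mnmE; case: tpermP => // ->.
  by move: gt mg; rewrite mt => h; have -> : g@_m = 0 by lra; rewrite eqxx.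
case: leqP => // h; have: (m < m#(tperm i j))%O.
  apply/ltmcP; first by rewrite mdeg_mperm.
  exists i => [k lt_ki|]; last by rewrite mnmE tpermL.
  by rewrite mnmE tpermD // neq_ltn ?lt_ki ?(ltn_trans lt_ki ij) orbC.
have: m#(tperm i j) \in msupp g by rewrite mcoeff_msupp gt oppr_eq0.
by move/msupp_le_mlead; rewrite leNgt => /negbTE ->.
Qed.

Lemma perm_increasing (s : 'S_n) :
  (forall i j : 'I_n, (i < j)%N -> (s i < s j)%N) -> s = 1%g.
Proof.
move=> h; have le (i : 'I_n) : (i <= s i)%N.
  case: i; elim=> [//|i IH] ilt.
  exact: leq_ltn_trans (IH (ltnW ilt)) (h (Ordinal (ltnW ilt)) (Ordinal ilt) (ltnSn i)).
have E : (\sum_(i < n) (i : nat) = \sum_(i < n) (s i : nat))%N.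
  exact: (reindex_inj (@perm_inj _ s)).
apply/permP => i; rewrite perm1; apply: val_inj => /=; apply/eqP; rewrite eq_sym.
have := @leqif_sum _ predT (fun i : 'I_n => i == s i :> nat) (fun i => i : nat) (fun i => s i : nat).
move=> /(_ (fun i _ => leqif_eq (le i))) [_]; rewrite E eqxx => /esym/forallP/(_ i).
by [].
Qed.

Lemma stair_lt mu (i j : 'I_n) :
  decreasing mu -> (i < j)%N -> (stair (pext mu) j < stair (pext mu) i)%N.
Proof.
move=> dmu ij; rewrite !mnmE !pextE; have := dmu _ _ (ltnW ij).
by have := ltn_ord j; lia.
Qed.

Lemma stair_inj mu nu : stair (pext mu) = stair (pext nu) -> mu = nu.
Proof.
move=> /mnmP E; apply/ffunP => i; apply: val_inj; have := E i.
by rewrite !mnmE !pextE => /addIn.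
Qed.

(** Both staircase-shifted exponents decrease strictly, and only the identity rearranges one
    strictly decreasing sequence into another. *)
Lemma altpoly_coeff mu lam : decreasing mu -> decreasing lam ->
  (altpoly (pext mu))@_(stair (pext lam)) = (mu == lam)%:R.
Proof.
move=> dmu dlam; rewrite raddf_sum /= (bigD1 1%g) //= big1 => [|s s1].
  rewrite addr0 odd_perm1 scale1r msym1m mcoeffX; congr (_ : bool)%:R.
  by apply/eqP/eqP => [/stair_inj|->].
rewrite mcoeffZ msymX mcoeffX; case: eqP => [E|]; last by rewrite mulr0.
case/eqP: s1; apply: invg_inj; rewrite invg1; apply: perm_increasing => i j ij.
have Ei k : stair (pext lam) k = stair (pext mu) (s^-1%g k) by rewrite -E [LHS]mnmE.
have := stair_lt dlam ij; rewrite !Ei.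
case: (ltngtP (s^-1%g i) (s^-1%g j)) => // [h|/val_inj ->]; last by rewrite ltnn.
by move=> h'; have := ltn_trans h' (stair_lt dmu h); rewrite ltnn.
Qed.

Let Delta := altpoly (fun=> 0%N).

Lemma schur_altpoly mu : decreasing mu -> Delta * schur mu = altpoly (pext mu).
Proof.
move=> dmu; rewrite /Delta !altpolyE schur_below_bialternant // => [|r nr]; last first.
  by have := ltn_ord r; rewrite ltnNge nr.
congr (_ * _); apply: eq_big => [T|T _].
  by apply/idP/andP => [hT|[]//]; split=> //; apply/forallP => rc; rewrite ltn_ord implybT.
by apply: eq_bigr => rc _; rewrite xvarE.
Qed.

Let zerop : part n := [ffun=> ord0].

Let stair0 : stair (fun=> 0%N) = stair (pext zerop).
Proof.
by apply/mnmP => i; rewrite !mnmE pextE ffunE.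
Qed.

Let Delta_neq0 : Delta != 0.
Proof.
have dz : decreasing zerop by move=> i j _; rewrite !ffunE.
apply/eqP => D0; have := altpoly_coeff dz dz.
have -> : altpoly (pext zerop) = Delta by rewrite /Delta /altpoly stair0.
by rewrite D0 mcoeff0 eqxx => /eqP; rewrite eq_sym oner_eq0.
Qed.

Lemma is_partitionP mu :
  reflect (decreasing mu /\ (\sum_(i < n) mu i = n)%N) (is_partition mu).
Proof.
apply: (iffP andP) => [[/forallP h /eqP]|[h /eqP]]; split=> //.
  by move=> i j; apply/implyP/(forallP (h i)).
by apply/forallP => i; apply/forallP => j; apply/implyP/h.
Qed.

(** The difference of the two sides is antisymmetric. Were it nonzero, its leading exponent would
    decrease strictly, hence be a partition of n plus the staircase, and at those exponents the
    coefficients cancel. *)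
Lemma antisym_expansion g :
    antisym g -> g \is (n + \sum_(j < n) (n.-1 - j)).-homog ->
  g = \sum_(mu : part n | is_partition mu) g@_(stair (pext mu)) *: altpoly (pext mu).
Proof.
move=> ag hg; apply/eqP; rewrite -subr_eq0; set d := _ - _; apply/negPn/negP => d0.
have ad : antisym d.
  move=> s; rewrite /d msymB ag scalerBr; congr (_ - _); rewrite raddf_sum scaler_sumr /=.
  by apply: eq_bigr => mu _; rewrite msymZ altpoly_antisym !scalerA mulrC.
have hd : d \is (n + \sum_(j < n) (n.-1 - j)).-homog.
  apply: rpredB => //; apply: rpred_sum => mu /is_partitionP[_ Emu]; apply: rpredZ.
  apply: rpred_sum => s _; apply: rpredZ; rewrite msymX dhomogX /= mdeg_mperm mdegE.
  apply/eqP; rewrite -[X in (X + _)%N]Emu -big_split; apply: eq_bigr => i _.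
  by rewrite mnmE pextE.
have lt := antisym_mlead ad d0; set m := mlead d in lt.
have md : mdeg m = (n + \sum_(j < n) (n.-1 - j))%N by apply: (dhomog_mf hd); apply: mlead_supp.
(* A strictly decreasing exponent dominates the staircase, so subtracting the staircase leaves row
   lengths. *)
have ge (i : 'I_n) : (n.-1 - i <= m i)%N.
  have [k] := ubnP (n.-1 - i); elim: k i => [//|k IH] i ik.
  case: (ltnP i.+1 n) => h; last by rewrite (_ : n.-1 - i = 0)%N //; lia.
  have := lt i (Ordinal h) (ltnSn i); have := IH (Ordinal h); rewrite /=; lia.
have sm : (\sum_(i < n) (m i - (n.-1 - i)) = n)%N.
  apply/eqP; rewrite -(eqn_add2r (\sum_(j < n) (n.-1 - j))) -md mdegE -big_split /=.
  by apply/eqP; apply: eq_bigr => i _; rewrite subnK.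
pose mu : part n := [ffun i => inord (m i - (n.-1 - i))].
have muE i : mu i = (m i - (n.-1 - i))%N :> nat.
  rewrite ffunE inordK // ltnS -[X in (_ <= X)%N]sm (bigD1 i) //=; exact: leq_addr.
have dmu : decreasing mu.
  move=> i j; rewrite leq_eqVlt => /orP[/eqP/val_inj-> //|]; rewrite !muE.
  have [k] := ubnP (j - i); elim: k j => [//|k IH] j jk ij.
  case: (ltnP i.+1 j) => h.
    have jn : (j.-1 < n)%N by apply: leq_ltn_trans (ltn_ord j); lia.
    have h1 : (m j < m (Ordinal jn))%N by apply: lt => /=; lia.
    have h2 : (m (Ordinal jn) - (n.-1 - j.-1) <= m i - (n.-1 - i))%N.
      by apply: (IH (Ordinal jn)) => /=; lia.
    by apply: leq_trans h2; have := ltn_ord j; lia.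
  have := lt i j ij; have := ge i; have := ge j; have := ltn_ord j; lia.
have pmu : is_partition mu.
  by apply/is_partitionP; split=> //; under eq_bigr do rewrite muE.
have ms : m = stair (pext mu) by apply/mnmP => i; rewrite mnmE pextE muE subnK.
have : d@_m != 0 by rewrite mleadc_eq0.
rewrite /d mcoeffB raddf_sum (bigD1 mu) //= big1 => [|nu /andP[/is_partitionP[dnu _] nm]].
  by rewrite mcoeffZ ms altpoly_coeff // eqxx mulr1 addr0 subrr eqxx.
by rewrite mcoeffZ ms altpoly_coeff // (negbTE nm) mulr0.
Qed.

(** The coefficients are picked by [epsilon], so an expansion must first be exhibited: it comes from
    that of the antisymmetric product of f with the Vandermonde. Multiplying the chosen expansion by
    the Vandermonde then isolates each coefficient at its own exponent, whichever choice was
    made. *)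
Theorem hall_schurE f lam :
    f \is symmetric -> f \is n.-homog -> is_partition lam ->
  hall_schur f lam = (Delta * f)@_(stair (pext lam)).
Proof.
move=> sf hf plam; rewrite /hall_schur /schur_expansion.
set P := (fun c : part n -> rat => _); set c := ClassicalEpsilon.epsilon _ _.
have hc : P c.
  apply: ClassicalEpsilon.epsilon_spec; exists (fun mu => (Delta * f)@_(stair (pext mu))).
  apply: (mulfI Delta_neq0); rewrite mulr_sumr [LHS]antisym_expansion.
  - apply: eq_bigr => mu /is_partitionP[dmu _].
    by rewrite -schur_altpoly // scalerAr.
  - by move=> s; rewrite msymM (issymP _ sf) altpoly_antisym scalerAl.
  - rewrite addnC; apply: dhomogM => //; apply: rpred_sum => s _; apply: rpredZ.
    rewrite msymX dhomogX /= mdeg_mperm mdegE; apply/eqP.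
    by apply: eq_bigr => i _; rewrite mnmE.
case/is_partitionP: (plam) => dlam _.
rewrite hc mulr_sumr raddf_sum (bigD1 lam) //= big1 => [|nu /andP[/is_partitionP[dnu _] nm]].
  by rewrite -scalerAr schur_altpoly // mcoeffZ altpoly_coeff // eqxx mulr1 addr0.
by rewrite -scalerAr schur_altpoly // mcoeffZ altpoly_coeff // (negbTE nm) mulr0.
Qed.

End HallSchur.

(** * Signs of the action on exterior monomials *)

Section Signs.
Variable n : nat.
Implicit Types (s t : 'S_n) (A B S : {set 'I_n}) (i j : 'I_n).

Lemma merge_signE A B : merge_sign A B = \prod_(a in A) \prod_(b in B) (-1) ^+ (b < a)%N.
Proof.
rewrite pair_big /= /merge_sign -prodr_const big_mkcond [RHS]big_mkcond /=.
apply: eq_bigr => -[a b] _; rewrite inE /=.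
by case: (a \in A); case: (b \in B); case: (b < a)%N.
Qed.

Lemma act_signE s A :
  act_sign s A = \prod_(a in A) \prod_(b in A) (-1) ^+ ((a < b) && (s b < s a))%N.
Proof.
rewrite pair_big /= /act_sign -prodr_const big_mkcond [RHS]big_mkcond /=.
apply: eq_bigr => -[a b] _; rewrite inE /=.
by case: (a \in A); case: (b \in A); case: (a < b)%N; case: (s b < s a)%N.
Qed.

Lemma act_sign0 s : act_sign s set0 = 1.
Proof. by rewrite act_signE big_set0. Qed.

Lemma act_signU1 s i A : i \notin A ->
  act_sign s (i |: A)
  = act_sign s A * \prod_(b in A) (-1) ^+ ((b < i)%N (+) (s b < s i)%N).
Proof.
move=> iA; rewrite !act_signE big_setU1 //= big_setU1 //= ltnn mul1r.
under [X in _ * X = _]eq_bigr do rewrite big_setU1 //=.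
rewrite big_split /= mulrA -big_split /= mulrC; congr (_ * _); apply: eq_bigr => b bA.
rewrite -signr_addb; congr (_ ^+ _).
have bi : b != i by apply: contraNneq iA => <-.
have sbi : s b != s i by rewrite (inj_eq perm_inj).
move: bi sbi; case: (ltngtP b i) => [_|_|/val_inj->]; rewrite ?eqxx // => _.
  by case: (ltngtP (s b) (s i)) => [_|_|/val_inj->]; rewrite ?eqxx.
by case: (ltngtP (s b) (s i)) => [_|_|/val_inj->]; rewrite ?eqxx.
Qed.

Lemma act_sign_sqr s A : act_sign s A * act_sign s A = 1.
Proof. by rewrite /act_sign -expr2 sqrr_sign. Qed.

Lemma set_ind (P : {set 'I_n} -> Prop) :
  P set0 -> (forall i A, i \notin A -> P A -> P (i |: A)) -> forall A, P A.
Proof.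
move=> P0 PU A; have [k] := ubnP #|A|; elim: k A => [//|k IH] A Ak.
have [->//|[i iA]] := set_0Vmem A; rewrite -(setD1K iA).
by apply: PU; [rewrite !inE eqxx|apply: IH; move: Ak; rewrite (cardsD1 i) iA].
Qed.

Lemma imset_setU1 s i A : s @: (i |: A) = s i |: (s @: A).
Proof. by rewrite imsetU imset_set1. Qed.

(** Cocycle rule for inversions: order reversals between a new element and the old ones add modulo 2
    along a composite. *)
Lemma act_signM s t A : act_sign (s * t)%g A = act_sign s A * act_sign t (s @: A).
Proof.
elim/set_ind: A => [|i A iA IH]; first by rewrite imset0 !act_sign0 mulr1.
have siA : s i \notin s @: A by rewrite (mem_imset _ _ (@perm_inj _ s)).
rewrite imset_setU1 !act_signU1 //.
rewrite IH mulrACA; congr (_ * _).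
rewrite big_imset /=; last by move=> ? ? _ _; apply: perm_inj.
rewrite -big_split; apply: eq_bigr => b _ /=; rewrite -signr_addb !permM.
by case: (_ < _)%N; case: (_ < _)%N; case: (_ < _)%N.
Qed.

Lemma act_sign_fixed s A : {in A, forall i, s i = i} -> act_sign s A = 1.
Proof.
move=> sA; rewrite act_signE big1 // => a aA; rewrite big1 // => b bA.
by rewrite !sA //; case: ltngtP.
Qed.

Lemma act_sign_tperm i j A : i != j -> i \in A -> j \in A ->
  act_sign (tperm i j) A = -1.
Proof.
move=> ij iA jA; have jA' : j \in A :\ i by rewrite !inE eq_sym ij.
rewrite -(setD1K iA) -(setD1K jA') !act_signU1 ?inE ?eqxx ?(negbTE ij) ?andbF //.
rewrite act_sign_fixed => [|b]; last first.
  by rewrite !inE => /and3P[bj bi _]; rewrite tpermD // eq_sym.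
rewrite mul1r big_setU1 ?inE ?eqxx //= tpermL tpermR mulrCA -big_split /= big1 => [|b].
  by move: ij; rewrite -val_eqE mulr1; case: ltngtP => //=; rewrite expr1.
rewrite !inE => /and3P[bj bi _]; rewrite tpermD 1?eq_sym // -signr_addb.
by case: (_ < _)%N; case: (_ < _)%N.
Qed.

Lemma act_sign_tperm_out i j A : i \notin A -> j \notin A -> act_sign (tperm i j) A = 1.
Proof.
move=> iA jA; apply: act_sign_fixed => k kA.
by rewrite tpermD //; [apply: contraNneq iA => ->|apply: contraNneq jA => ->].
Qed.

(** A new fixed point i contributes the signs of b < i and of s b < i over all old b, and these two
    products agree because s permutes the old set. *)
Lemma act_sign_setU_fixed s A B : s @: A = A -> [disjoint A & B] ->
  {in B, forall i, s i = i} -> act_sign s (A :|: B) = act_sign s A.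
Proof.
move=> sA; elim/set_ind: B => [|i B iB IH]; first by rewrite setU0.
rewrite disjoints_subset => /subsetP dAB fB.
have fB' : {in B, forall i, s i = i} by move=> k kB; rewrite fB // !inE kB orbT.
have iA : i \notin A by apply/negP => /dAB; rewrite !inE eqxx.
have dAB' : [disjoint A & B].
  by rewrite disjoints_subset; apply/subsetP => k /dAB; rewrite !inE negb_or => /andP[].
rewrite setUCA act_signU1 ?inE ?negb_or ?iA // IH //.
rewrite fB ?inE ?eqxx //; under eq_bigr do rewrite signr_addb.
rewrite big_split /=; set X := \prod_(k in _) _; set Y := \prod_(k in _) _.
have -> : X = Y.
  rewrite /X -[A in LHS]sA.
  have sB : s @: B = B.
    by rewrite -[RHS]imset_id; apply: eq_in_imset.
  rewrite -[B in LHS]sB -imsetU big_imset //=; last by move=> ? ? _ _; apply: perm_inj.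
rewrite /Y -expr2 -prodrXl big1 ?mulr1 // => k _; exact: sqrr_sign.
Qed.

End Signs.

(** * Counting colourings up to permutation *)

Section OrbitCount.
Variables (n : nat) (C : finType).
Implicit Types (g : {ffun 'I_n -> C}) (k : {ffun C -> 'I_n.+1}).

Definition content g : {ffun C -> 'I_n.+1} := [ffun c => inord #|[set i | g i == c]|].

Definition stab g : {set 'S_n} := [set s : 'S_n | [forall i, g (s i) == g i]].

Lemma stabP g (s : 'S_n) : reflect (forall i, g (s i) = g i) (s \in stab g).
Proof.
by rewrite inE; apply: (iffP forallP) => h i; [apply/eqP|rewrite h].
Qed.

Lemma contentE g c : content g c = #|[set i | g i == c]| :> nat.
Proof. by rewrite ffunE inordK // ltnS -[X in (_ <= X)%N]card_ord max_card. Qed.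

Lemma content_sum g : (\sum_c content g c = n)%N.
Proof.
rewrite -[RHS]card_ord -sum1_card (partition_big g predT) //=.
by apply: eq_bigr => c _; rewrite contentE sum1dep_card.
Qed.

Lemma content_count g c : count_mem c [tuple g i | i < n] = content g c.
Proof.
rewrite contentE -sum1_count big_tuple -sum1dep_card.
by apply: eq_bigl => i; rewrite tnth_mktuple.
Qed.

Lemma content_exists k : (\sum_c k c = n)%N -> exists g, content g = k.
Proof.
move=> kn; pose s := flatten [seq nseq (k c) c | c <- enum C].
have szs : size s == n.
  rewrite size_flatten /shape -map_comp sumnE big_map big_enum /=; apply/eqP.
  by rewrite -[RHS]kn; apply: eq_bigr => c _; rewrite size_nseq.
exists [ffun i => tnth (Tuple szs) i]; apply/ffunP => c; apply: val_inj.
rewrite /= -content_count (_ : [tuple _ | i < n] = Tuple szs); last first.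
  by apply: eq_from_tnth => i; rewrite tnth_mktuple ffunE.
rewrite /= count_flatten -map_comp sumnE big_map big_enum /= (bigD1 c) //= big1.
  by rewrite count_nseq /= eqxx mul1n addn0.
by move=> c' c'c; rewrite count_nseq /= (negbTE c'c).
Qed.

Lemma content_perm g0 g :
  content g0 = content g -> exists t : 'S_n, forall i, g i = g0 (t i).
Proof.
move=> E; have : perm_eq [tuple g i | i < n] [tuple g0 i | i < n].
  by apply/allP => c _ /=; rewrite !content_count E.
case/tuple_permP => t Et; exists t => i.
have := congr1 (fun s => nth (g i) s i) Et.
by rewrite -!tnth_nth !tnth_mktuple.
Qed.

(** Colourings of one content form a single orbit, and the permutations carrying a base colouring to
    g form a coset of the stabiliser of g. *)
Lemma sum_card_stab k : (\sum_c k c = n)%N ->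
  (\sum_(g | content g == k) #|stab g| = n`!)%N.
Proof.
move=> kn; have [g0 g0k] := content_exists kn.
rewrite -card_Sn -sum1_card.
rewrite (partition_big (fun t : 'S_n => [ffun i => g0 (t i)]) (fun g => content g == k)) /=.
  apply: eq_bigr => g /eqP gk; have [|t0 Et0] := @content_perm g0 g; first by rewrite g0k.
  rewrite -sum1_card [RHS](reindex_inj (mulIg t0)) /=; apply: eq_bigl => s.
  apply/stabP/eqP => [h|/ffunP h i]; first by apply/ffunP => i; rewrite ffunE permM -Et0 h.
  by have := h i; rewrite ffunE permM -Et0.
move=> t _; rewrite -g0k; apply/eqP/ffunP => c; apply: val_inj; rewrite /= !contentE.
rewrite -(card_imset _ (@perm_inj _ t)); apply: eq_card => i; rewrite !inE.
apply/imsetP/idP => [[j]|h]; first by rewrite inE ffunE => h ->.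
by exists (t^-1%g i); rewrite ?inE ?ffunE ?permKV.
Qed.

Lemma orbit_sum (V : nmodType) (H : {ffun C -> 'I_n.+1} -> V) :
  \sum_g H (content g) *+ #|stab g| = (\sum_(k : {ffun C -> 'I_n.+1} | (\sum_c k c == n)%N) H k) *+ n`!.
Proof.
rewrite -sumrMnl (partition_big content (fun k : {ffun C -> 'I_n.+1} => \sum_c k c == n)%N) /= => [|g _]; last first.
  by rewrite content_sum.
apply: eq_bigr => k /eqP kn; rewrite -[in RHS](sum_card_stab kn) -sumrMnr.
by apply: eq_bigr => g /eqP ->.
Qed.

End OrbitCount.

(** * Frobenius characteristic of the exterior algebra *)

Section FrobExt.
Variable n : nat.
Hypothesis n_gt0 : (0 < n)%N.
Implicit Types (s t : 'S_n) (f : {ffun 'I_n -> 'I_n}) (al : 'X_{1..n}).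

(** Expanding the product of power sums chooses one variable per cycle, that is, a function constant
    on cycles. *)
Lemma pcycleE s :
  pcycle s = \sum_(f : {ffun 'I_n -> 'I_n} | [forall k, f (s k) == f k]) \prod_k 'X_(f k).
Proof.
pose i0 : 'I_n := Ordinal n_gt0.
rewrite /pcycle /psum (big_distr_big i0) /=.
pose F (h : {ffun {set 'I_n} -> 'I_n}) : {ffun 'I_n -> 'I_n} := [ffun k => h (porbit s k)].
(* Off the cycles, the functions produced by [big_distr_big] take the default value [i0]. *)
pose G f : {ffun {set 'I_n} -> 'I_n} :=
  [ffun D : {set 'I_n} => if D \in porbits s then
                            if [pick k in D] is Some k then f k else i0 else i0].
have Fs h k : F h (s k) = F h k by rewrite !ffunE -{2}[s]expg1 porbit_perm.
have fs f : [forall k, f (s k) == f k] -> forall k l, k \in porbit s l -> f k = f l.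
  move=> /forallP hf k l /porbitP[m ->]; elim: m => [|m IH]; first by rewrite perm1.
  by rewrite expgSr permM (eqP (hf _)).
rewrite [RHS](reindex_onto F G) => [|f hf] /=; last first.
  apply/ffunP => k; rewrite !ffunE imset_f //; case: pickP => [l lk|/(_ k)].
    exact: fs lk.
  by rewrite porbit_id.
apply: eq_big => [h|h hh].
  apply/pffun_onP/andP => [[h1 h2]|[_ /eqP <-]].
    split; first by apply/forallP => k; rewrite Fs.
    apply/eqP/ffunP => D; rewrite ffunE; case: ifP => [/imsetP[k _ ->]|hD].
      case: pickP => [l lk|/(_ k)]; last by rewrite porbit_id.
      by rewrite ffunE; congr (h _); apply/esym/eqP; rewrite eq_porbit_mem porbit_sym.
    by apply/esym/eqP; apply/negPn/negP => hD'; have := subsetP h1 D; rewrite hD => /(_ hD').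
  split; last by [].
  by apply/subsetP => D; rewrite inE ffunE; case: ifP => //; rewrite eqxx.
rewrite [RHS](partition_big (porbit s) (mem (porbits s))) /= => [|k _]; last exact: imset_f.
apply: eq_bigr => D /imsetP[k _ ->]; rewrite -prodr_const.
apply: eq_big => [l|l]; last first.
  by rewrite -eq_porbit_mem => /eqP E; rewrite ffunE E.
by rewrite -eq_porbit_mem.
Qed.

Lemma frob_symmetric (chi : 'S_n -> rat) : frob chi \is symmetric.
Proof.
apply: rpredZ; apply: rpred_sum => s _; apply: rpredZ; apply: rpred_prod => D _.
apply/issymP => t; rewrite /psum raddf_sum [RHS](reindex_inj (@perm_inj _ t)).
by apply: eq_bigr => i _ /=; rewrite rmorphXn /= /msym mmapX mmap1U.
Qed.

Lemma frob_homog (chi : 'S_n -> rat) : frob chi \is n.-homog.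
Proof.
apply: rpredZ; apply: rpred_sum => s _; apply: rpredZ; rewrite pcycleE.
apply: rpred_sum => f _; rewrite mprodXE dhomogX /= mdeg_sum.
by apply/eqP; rewrite (eq_bigr (fun=> 1%N)) ?sum1_card ?card_ord // => k _; rewrite mdeg1.
Qed.

Lemma pcycle_coeff s al :
  (pcycle s)@_al =
  \sum_(f : {ffun 'I_n -> 'I_n} | [forall k, f (s k) == f k])
     ([forall r, #|[set k | f k == r]| == al r])%:R.
Proof.
rewrite pcycleE raddf_sum; apply: eq_bigr => f _ /=.
rewrite mprodXE mcoeffX; congr (_ : bool)%:R.
have E r : (\sum_k U_(f k))%MM r = #|[set k | f k == r]|.
  rewrite mnm_sumE -sum1dep_card [RHS]big_mkcond; apply: eq_bigr => k _.
  by rewrite mnm1E; case: eqP.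
by apply/eqP/forallP => [<- r|h]; [rewrite -E|apply/mnmP => r; rewrite E (eqP (h r))].
Qed.

(** The colour of a point k records the variable x_r attached to its cycle and whether theta_k and
    xi_k occur in the monomial. *)
Local Notation colour := ('I_n * (bool * bool))%type.
Implicit Types (g : {ffun 'I_n -> colour}) (k : {ffun colour -> 'I_n.+1}).

Definition theta_set g : {set 'I_n} := [set i | (g i).2.1].
Definition xi_set g : {set 'I_n} := [set i | (g i).2.2].
Definition col_sign g s : rat := act_sign s (theta_set g) * act_sign s (xi_set g).
(** A point carrying exactly one of theta and xi contributes an odd factor, so exchanging two such
    points of equal colour changes the sign. *)
Definition odd_colour (c : colour) : bool := c.2.1 != c.2.2.
Definition odd_simple k := [forall c, odd_colour c ==> (k c <= 1)%N].

Lemma stab_imset g s (P : pred colour) :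
  s \in stab g -> s @: [set i | P (g i)] = [set i | P (g i)].
Proof.
move=> /stabP hs; apply/eqP; rewrite eqEcard card_imset ?leqnn ?andbT; last exact: perm_inj.
by apply/subsetP => _ /imsetP[i iP ->]; move: iP; rewrite !inE hs.
Qed.

(* A transposition of two points of the same odd colour stabilises g and flips the sign; if no
   odd colour is repeated, the stabiliser acts on the two colour sets by the same sign. *)
Lemma sum_col_sign g :
  \sum_(s in stab g) col_sign g s = if odd_simple (content g) then #|stab g|%:R else 0.
Proof.
have [/forallP good|] := ifPn.
  rewrite -sumr_const; apply: eq_bigr => s hs; have /stabP gs := hs.
  have fix_odd i : odd_colour (g i) -> s i = i.
    move=> oi; have := implyP (good (g i)) oi; rewrite contentE.
    move/card_le1_eqP => h; apply: h; rewrite inE ?eqxx //; exact/eqP/gs.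
  pose P (c : colour) := c.2.1 && c.2.2.
  rewrite /col_sign.
  have -> : theta_set g = [set i | P (g i)] :|: [set i | (g i).2.1 && ~~ (g i).2.2].
    by apply/setP => i; rewrite !inE /P; case: (_.2.1); case: (_.2.2).
  have -> : xi_set g = [set i | P (g i)] :|: [set i | ~~ (g i).2.1 && (g i).2.2].
    by apply/setP => i; rewrite !inE /P; case: (_.2.1); case: (_.2.2).
  rewrite !act_sign_setU_fixed ?act_sign_sqr ?(stab_imset _ hs) //.
  - by rewrite disjoints_subset; apply/subsetP => i; rewrite !inE /P; case: (_.2.1); case: (_.2.2).
  - by move=> i; rewrite inE => h; apply: fix_odd; move: h; rewrite /odd_colour; case: (_.2.1); case: (_.2.2).
  - by rewrite disjoints_subset; apply/subsetP => i; rewrite !inE /P; case: (_.2.1); case: (_.2.2).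
  - by move=> i; rewrite inE => h; apply: fix_odd; move: h; rewrite /odd_colour; case: (_.2.1); case: (_.2.2).
rewrite negb_forall => /existsP[c]; rewrite negb_imply -ltnNge contentE.
move=> /andP[oc /card_gt1P[i [j [ic jc ij]]]]; rewrite !inE in ic jc.
set S := \sum_(s in _) _; suff : S = - S by lra.
have tg : tperm i j \in stab g.
  by apply/stabP => l; case: tpermP => [->|->|//]; rewrite (eqP ic) (eqP jc).
rewrite {1}/S (reindex_inj (mulgI (tperm i j))) /= -sumrN; apply: eq_big => [s|s].
  apply/stabP/stabP => [h l|h l]; last by rewrite permM h (stabP _ _ tg).
  by have := h (tperm i j l); rewrite permM tpermK (stabP _ _ tg).
move=> _; rewrite /col_sign !act_signM.
rewrite (stab_imset (fun c => c.2.1) tg) (stab_imset (fun c => c.2.2) tg).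
rewrite mulrACA -[RHS]mulN1r; congr (_ * _).
move: oc; rewrite /odd_colour -(eqP ic) => oc.
have E : (g j) = (g i) by rewrite (eqP ic) (eqP jc).
have [h1|h1] := boolP (g i).2.1; have [h2|h2] := boolP (g i).2.2;
  move: oc; rewrite ?h1 ?h2 ?(negbTE h1) ?(negbTE h2) // => _.
  by rewrite act_sign_tperm ?act_sign_tperm_out ?inE ?E ?h1 ?h2 ?mulr1.
by rewrite act_sign_tperm_out ?act_sign_tperm ?inE ?E ?h1 ?h2 ?mul1r.
Qed.

End FrobExt.

(** * Monomial coefficients of the Frobenius characteristic of the exterior algebra *)

Section FrobExtGen.
Variable n : nat.
Hypothesis n_gt0 : (0 < n)%N.
Variables (R : comAlgType rat) (u v : R).
Local Notation colour := ('I_n * (bool * bool))%type.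
Implicit Types (s : 'S_n) (g : {ffun 'I_n -> colour}) (k : {ffun colour -> 'I_n.+1}).

(** The trace of s on bidegree (i, j) in the monomial basis, where only monomials fixed up to sign
    contribute; see [strace_bideg_ext]. *)
Definition ext_char i j s : rat :=
  \sum_(b : bmon_ n | [&& #|b.1| == i, #|b.2| == j, s @: b.1 == b.1 & s @: b.2 == b.2])
     act_sign s b.1 * act_sign s b.2.

Let wt (c : colour) : R := u ^+ c.2.1 * v ^+ c.2.2.

Let fits (al : 'X_{1..n}) k := [forall r, (\sum_ab k (r, ab) == al r)%N].

Lemma big_bool2 (T : Type) (idx : T) (op : Monoid.com_law idx) (F : bool * bool -> T) :
  \big[op/idx]_ab F ab
  = op (op (F (true, true)) (F (true, false))) (op (F (false, true)) (F (false, false))).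
Proof.
transitivity (\big[op/idx]_a \big[op/idx]_b F (a, b)); last by rewrite !big_bool.
by rewrite pair_bigA; apply: eq_bigr => -[].
Qed.

(** The contribution of one variable of multiplicity m: the Booleans count the points with only
    theta and with only xi, the third component those with both, and the remaining points carry
    neither. *)
Lemma sum_superh N m : (m <= N)%N ->
  \sum_(x : bool * bool * 'I_N.+1 | (x.1.1 + x.1.2 + x.2 <= m)%N)
     u ^+ (x.1.1 + x.2) * v ^+ (x.1.2 + x.2) = superh u v m.
Proof.
move=> kN.
transitivity (\sum_(ab : bool * bool) u ^+ ab.1 * v ^+ ab.2 *
    qnum (u * v) ((m.+1 - (ab.1 + ab.2)) : nat)).
  rewrite -(pair_big_dep predT (fun (ab : bool * bool) (e : 'I_N.+1) => (ab.1 + ab.2 + nat_of_ord e <= m)%N)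
    (fun (ab : bool * bool) (e : 'I_N.+1) => u ^+ (ab.1 + nat_of_ord e) * v ^+ (ab.2 + nat_of_ord e))) /=.
  apply: eq_bigr => -[a b] _ /=; rewrite /qnum mulr_sumr.
  rewrite (big_ord_widen N.+1 (fun e => u ^+ a * v ^+ b * (u * v) ^+ e)); last by lia.
  apply: eq_big => [e|e _]; first by apply/idP/idP; lia.
  by rewrite !exprD exprMn; ring.
transitivity (u * v * qnum (u * v) m.-1 + u * qnum (u * v) m
              + (v * qnum (u * v) m + qnum (u * v) m.+1)).
  rewrite big_bool2 /= !expr0 !expr1 !mulr1 !mul1r.
  by congr (_ * qnum _ _ + _ * qnum _ _ + (_ * qnum _ _ + qnum _ _)); lia.
case: m {kN} => [|m] /=; first by rewrite qnumS !qnum0; ring.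
have -> : qnum (u * v) m.+2 = 1 + u * v * qnum (u * v) m.+1.
  rewrite /qnum big_ord_recl mulr_sumr.
  by congr (_ + _); apply: eq_bigr => i _; rewrite -exprS.
have -> : qnum (u * v) m.+1 = 1 + u * v * qnum (u * v) m.
  rewrite /qnum big_ord_recl mulr_sumr.
  by congr (_ + _); apply: eq_bigr => i _; rewrite -exprS.
ring.
Qed.

Lemma sum_contents (al : 'X_{1..n}) : mdeg al = n ->
  \sum_(k : {ffun colour -> 'I_n.+1} | (\sum_c k c == n)%N && (odd_simple k && fits al k))
     \prod_c wt c ^+ k c = \prod_r superh u v (al r).
Proof.
move=> aln; have al_le r : (al r <= n)%N.
  by rewrite -[X in (_ <= X)%N]aln mdegE (bigD1 r) //= leq_addr.
(* The number of points carrying neither theta nor xi is determined by the exponent, so three counts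
   per variable encode a content. *)
pose K (h : {ffun 'I_n -> bool * bool * 'I_n.+1}) : {ffun colour -> 'I_n.+1} :=
  [ffun c : colour => match c.2 with
     | (true, false) => inord (h c.1).1.1
     | (false, true) => inord (h c.1).1.2
     | (true, true) => (h c.1).2
     | (false, false) => inord (al c.1 - ((h c.1).1.1 + (h c.1).1.2 + (h c.1).2))
     end].
pose H k : {ffun 'I_n -> bool * bool * 'I_n.+1} :=
  [ffun r => ((0 < k (r, (true, false)))%N, (0 < k (r, (false, true)))%N, k (r, (true, true)))].
have inb (b : bool) : @inord n b = b :> nat by rewrite inordK //; case: b.
transitivity (\prod_r \sum_(x : bool * bool * 'I_n.+1 | (x.1.1 + x.1.2 + x.2 <= al r)%N)
     u ^+ (x.1.1 + x.2) * v ^+ (x.1.2 + x.2)); last first.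
  by apply: eq_bigr => r _; rewrite sum_superh.
have Ktt h r : K h (r, (true, true)) = (h r).2 by rewrite ffunE.
have Ktf h r : K h (r, (true, false)) = (h r).1.1 :> nat by rewrite ffunE /= inb.
have Kft h r : K h (r, (false, true)) = (h r).1.2 :> nat by rewrite ffunE /= inb.
have Kff h r : K h (r, (false, false)) = (al r - ((h r).1.1 + (h r).1.2 + (h r).2))%N :> nat.
  by rewrite ffunE /= inordK // ltnS (leq_trans (leq_subr _ _)).
rewrite bigA_distr_big_dep (reindex_onto K H) => [|k /and3P[_ /forallP good /forallP fit]] /=; last first.
  apply/ffunP => -[r [a b]]; apply: val_inj => /=.
  have := implyP (good (r, (true, false))) isT; have := implyP (good (r, (false, true))) isT.
  have := eqP (fit r); rewrite big_bool2 /=.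
  case: a; case: b; rewrite ?Ktt ?Ktf ?Kft ?Kff !ffunE //=; lia.
apply: eq_big => [h|h _]; last first.
  transitivity (\prod_r \prod_ab wt (r, ab) ^+ K h (r, ab)).
    by rewrite pair_bigA; apply: eq_bigr => -[].
  apply: eq_bigr => r _; rewrite big_bool2 /= Ktt Ktf Kft Kff /wt /= !expr0 !expr1.
  by rewrite ?mulr1 ?mul1r expr1n ?exprD ?exprMn; ring.
apply/idP/familyP => [/andP[/and3P[_ _ /forallP fit] _] r|hh].
  by rewrite unfold_in; have := eqP (fit r); rewrite big_bool2 /= Ktt Ktf Kft Kff; lia.
have Ksum r : (\sum_ab K h (r, ab) = al r)%N.
  by have := hh r; rewrite unfold_in big_bool2 /= Ktt Ktf Kft Kff; lia.
apply/andP; split; last first.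
  apply/eqP/ffunP => r; rewrite [LHS]ffunE Ktt Ktf Kft.
  by case: (h r) => -[[] []] e.
apply/and3P; split.
- apply/eqP; rewrite -[RHS]aln mdegE; transitivity (\sum_r \sum_ab K h (r, ab))%N.
    by rewrite pair_bigA; apply: eq_bigr => -[].
  by apply: eq_bigr => r _; rewrite Ksum.
- by apply/forallP => -[r [[] []]]; apply/implyP; rewrite /odd_colour //= => _; rewrite ?Ktf ?Kft leq_b1.
- by apply/forallP => r; rewrite Ksum.
Qed.

Lemma content_fst g r : (\sum_ab content g (r, ab) = #|[set i | (g i).1 == r]|)%N.
Proof.
rewrite -sum1dep_card (partition_big (fun i => (g i).2) predT) //=.
apply: eq_bigr => ab _; rewrite contentE -sum1dep_card; apply: eq_bigl => i.
by rewrite -pair_eqE; case: (g i).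
Qed.

Lemma prodr_card (A : {set 'I_n}) (x : R) : \prod_i x ^+ (i \in A) = x ^+ #|A|.
Proof.
rewrite prodrXr; congr (_ ^+ _); rewrite -sum1_card [RHS]big_mkcond.
by apply: eq_bigr => i _; case: (i \in A).
Qed.

(** A Burnside count with signs: the sums over permutations and colourings are exchanged, each
    stabiliser sum is 0 or the full order by [sum_col_sign], and [orbit_sum] absorbs the factor
    n!. *)
Lemma frob_ext_coeff (al : 'X_{1..n}) : mdeg al = n ->
  \sum_(i < n.+1) \sum_(j < n.+1) (frob (ext_char i j))@_al *: (u ^+ i * v ^+ j)
  = \prod_r superh u v (al r).
Proof.
move=> aln; rewrite -sum_contents //.
pose w (b : bmon_ n) : R := u ^+ #|b.1| * v ^+ #|b.2|.
pose fixes s (b : bmon_ n) := (s @: b.1 == b.1) && (s @: b.2 == b.2).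
pose sg s (b : bmon_ n) := act_sign s b.1 * act_sign s b.2.
transitivity ((n`!%:R)^-1 *: \sum_s (pcycle s)@_al *: \sum_(b | fixes s b) sg s b *: w b).
  transitivity (\sum_(i < n.+1) \sum_(j < n.+1) (n`!%:R)^-1 *: \sum_s (pcycle s)@_al *:
      \sum_(b : bmon_ n | fixes s b && ((#|b.1| == i) && (#|b.2| == j))) sg s b *: w b).
    apply: eq_bigr => i _; apply: eq_bigr => j _.
    rewrite mcoeffZ -scalerA raddf_sum scaler_suml; congr (_ *: _); apply: eq_bigr => s _ /=.
    rewrite mcoeffZ mulrC -scalerA scaler_suml; congr (_ *: _); apply: eq_big => [b|b].
      by rewrite /fixes; do !case: (_ == _).
    by move=> /and4P[/eqP b1 /eqP b2 _ _]; rewrite /w b1 b2.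
  under eq_bigr do rewrite -scaler_sumr.
  rewrite -scaler_sumr; congr (_ *: _).
  under eq_bigr do rewrite exchange_big /=.
  rewrite exchange_big /=; apply: eq_bigr => s _.
  under eq_bigr do rewrite -scaler_sumr.
  rewrite -scaler_sumr; congr (_ *: _); rewrite pair_bigA /=.
  rewrite [RHS](partition_big (fun b : bmon_ n => (@inord n #|b.1|, @inord n #|b.2|)) predT) //=.
  apply: eq_bigr => -[i j] _; apply: eq_bigl => b; congr (_ && _).
  have c1 : (#|b.1| < n.+1)%N by rewrite ltnS -[X in (_ <= X)%N]card_ord max_card.
  have c2 : (#|b.2| < n.+1)%N by rewrite ltnS -[X in (_ <= X)%N]card_ord max_card.
  by rewrite xpair_eqE -!val_eqE /= !inordK.
have fact_n0 : n`!%:R != 0 :> rat by rewrite pnatr_eq0 -lt0n fact_gt0.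
apply: (scalerI fact_n0); rewrite scalerA mulfV // scale1r scaler_nat.
rewrite [in RHS]big_mkcondr /= -(orbit_sum (fun k => if odd_simple k && fits al k
    then \prod_c wt c ^+ k c else 0)).
transitivity (\sum_s \sum_(g | s \in stab g)
    (col_sign g s * (fits al (content g))%:R) *: \prod_i wt (g i)).
  apply: eq_bigr => s _; rewrite pcycle_coeff // scaler_suml.
  under [LHS]eq_bigr do rewrite scaler_sumr.
  rewrite pair_big_dep /=.
  (* A function constant on the cycles of s together with an s-stable monomial is the same as an
     s-stable colouring. *)
  pose P (x : {ffun 'I_n -> 'I_n} * bmon_ n) : {ffun 'I_n -> colour} :=
    [ffun i => (x.1 i, (i \in x.2.1, i \in x.2.2))].
  pose Q g : {ffun 'I_n -> 'I_n} * bmon_ n := ([ffun i => (g i).1], (theta_set g, xi_set g)).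
  have PK : cancel P Q.
    move=> [f [A B]]; rewrite /Q; congr (_, (_, _)).
    + by apply/ffunP => i; rewrite !ffunE.
    + by apply/setP => i; rewrite inE ffunE.
    + by apply/setP => i; rewrite inE ffunE.
  have QK : cancel Q P.
    by move=> g; apply/ffunP => i; rewrite !ffunE /= !inE; case: (g i) => ? [].
  rewrite [RHS](reindex P) /=; last by exists Q => x _; [apply: PK|apply: QK].
  apply: eq_big => [[f [A B]]|[f [A B]] _] /=.
    rewrite /fixes /=; apply/and3P/stabP => [[/forallP hf /eqP hA /eqP hB] i|h].
      rewrite !ffunE /= (eqP (hf i)) -{1}hA -{1}hB !(mem_imset _ _ (@perm_inj _ s)) //.
    split.
    + by apply/forallP => i; have := h i; rewrite !ffunE => -[->].
    + rewrite eqEcard card_imset ?leqnn ?andbT; last exact: perm_inj.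
      by apply/subsetP => _ /imsetP[i iA ->]; have := h i; rewrite !ffunE => -[_ -> _].
    + rewrite eqEcard card_imset ?leqnn ?andbT; last exact: perm_inj.
      by apply/subsetP => _ /imsetP[i iA ->]; have := h i; rewrite !ffunE => -[_ _ ->].
  have := PK (f, (A, B)); rewrite /Q => -[_ EA EB]; rewrite scalerA mulrC; congr (_ *: _).
    rewrite /col_sign EA EB; congr (_ * (_ : bool)%:R); apply: eq_forallb => r.
    rewrite content_fst; congr (_ == _); apply: eq_card => i.
    by rewrite !inE ffunE.
  rewrite /w /= -!prodr_card -big_split /=; apply: eq_bigr => i _.
  by rewrite /wt ffunE.
rewrite (exchange_big_dep predT) //=; apply: eq_bigr => g _.
rewrite -scaler_suml -mulr_suml sum_col_sign.
have -> : \prod_i wt (g i) = \prod_c wt c ^+ content g c.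
  rewrite (partition_big g predT) //=; apply: eq_bigr => c _.
  rewrite contentE -prodr_const; apply: eq_big => [i|i /eqP-> //].
  by rewrite inE.
case: (odd_simple _) => /=; last by rewrite mul0r scale0r mul0rn.
by case: (fits _ _); rewrite ?mulr1 ?mulr0 ?scale0r ?mul0rn // scaler_nat.
Qed.

End FrobExtGen.

(** * The multiplicity generating function as a Jacobi-Trudi determinant *)

Section JacobiTrudi.
Variable n : nat.
Hypothesis n_gt0 : (0 < n)%N.
Variables (R : comAlgType rat) (u v : R).

Lemma mcoeff_mulXl (m a : 'X_{1..n}) (f : {mpoly rat[n]}) :
  ('X_[a] * f)@_m = if (a <= m)%MM then f@_(m - a) else 0.
Proof.
case: ifP => [am|am]; first by rewrite mulrC -{1}(submK am) addmC mcoeffMX.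
rewrite mcoeffM big1 // => -[k1 k2] /= /eqP E.
rewrite mcoeffX; case: eqP => [E1|]; last by rewrite mul0r.
have : (a <= k1 + k2)%MM by rewrite E1 lem_addr.
by rewrite -E am.
Qed.

(** Expanding the Vandermonde into signed staircase monomials turns the coefficient of [hall_schurE]
    into a signed sum of monomial coefficients of the Frobenius characteristics. By [frob_ext_coeff]
    each is a product of [superh] values, which is the Leibniz formula. *)
Lemma mult_jacobi_trudi (lam : part n) : is_partition lam ->
  \sum_(i < n.+1) \sum_(j < n.+1)
     hall_schur (frob (@ext_char n i j)) lam *: (u ^+ i * v ^+ j)
  = ndet n (jtrudi (superh u v) (pext lam)).
Proof.
move=> plam; have [_ lamn] := is_partitionP _ plam.
pose m := stair n (pext lam).
pose a (s : 'S_n) : 'X_{1..n} := [multinom stair n (fun=> 0%N) (s^-1%g i) | i < n].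
have mdega s : mdeg (a s) = (\sum_(j < n) (n.-1 - j))%N.
  by rewrite mdeg_mperm mdegE; apply: eq_bigr => i _; rewrite mnmE.
have mdegm : mdeg m = (n + \sum_(j < n) (n.-1 - j))%N.
  rewrite mdegE -[X in (X + _)%N]lamn -big_split; apply: eq_bigr => i _.
  by rewrite mnmE pextE.
transitivity (\sum_(s : 'S_n) (-1) ^+ s *: (if (a s <= m)%MM then
   \prod_r superh u v ((m - a s)%MM r) else 0)).
  transitivity (\sum_(i < n.+1) \sum_(j < n.+1) \sum_(s : 'S_n)
      (-1) ^+ s *: ((if (a s <= m)%MM then (frob (@ext_char n i j))@_(m - a s) else 0)
                     *: (u ^+ i * v ^+ j))).
    apply: eq_bigr => i _; apply: eq_bigr => j _.
    rewrite hall_schurE ?frob_symmetric ?frob_homog // /altpoly mulr_suml raddf_sum scaler_suml.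
    apply: eq_bigr => s _ /=; rewrite -scalerAl mcoeffZ -scalerA; congr (_ *: (_ *: _)).
    by rewrite msymX mcoeff_mulXl.
  under eq_bigr do rewrite exchange_big /=.
  rewrite exchange_big /=; apply: eq_bigr => s _.
  under eq_bigr do rewrite -scaler_sumr.
  rewrite -scaler_sumr; congr (_ *: _); case: ifP => am; last first.
    by rewrite big1 // => i _; rewrite big1 // => j _; rewrite scale0r.
  rewrite frob_ext_coeff // -(addnK (mdeg (a s)) (mdeg (m - a s))) -mdegD submK //.
  by rewrite mdegm mdega addnK.
rewrite /ndet /determinant (reindex_inj invg_inj) /=; apply: eq_bigr => s _.
rewrite odd_permV scaler_sign mulr_sign.
suff -> : (if (a s^-1%g <= m)%MM then \prod_r superh u v ((m - a s^-1%g)%MM r) else 0)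
   = \prod_(i < n) (\matrix_(i < n, j < n) jtrudi (superh u v) (pext lam) i j) i (s i) by [].
have aE r : a s^-1%g r = (n.-1 - s r)%N by rewrite !mnmE invgK.
have mE r : m r = (lam r + (n.-1 - r))%N by rewrite mnmE pextE.
have sn r : (s r < n)%N by [].
case: ifP => [/mnm_lepP am|/negP am].
  apply: eq_bigr => r _; rewrite mxE /jtrudi /shiftc mnmBE.
  have := am r; rewrite aE mE pextE => h.
  have [rn sr] := (ltn_ord r, sn r).
  by rewrite ifT; [congr superh|]; lia.
(* A monomial that does not divide corresponds to a negative index in some row, where the matrix
   entry is 0. *)
have [r hr] : exists r, ~~ (a s^-1%g r <= m r)%N.
  by apply/existsP; rewrite -negb_forall; apply/negP => /forallP h; apply: am; apply/mnm_lepP.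
rewrite (bigD1 r) //= mxE /jtrudi /shiftc ifF ?mul0r //.
by move: hr; rewrite aE mE pextE; have := ltn_ord r; have := sn r; lia.
Qed.

End JacobiTrudi.

(** * Traces on stable subspaces *)

Section StableTrace.
Variables (F : fieldType) (N : nat).
Implicit Types (U V A G : 'M[F]_N).

Definition strace U A : F := \tr (row_base U *m A *m pinvmx (row_base U)).

Lemma strace_basis U A m (B : 'M_(m, N)) (M : 'M_m) :
  row_free B -> (B :=: U)%MS -> B *m A = M *m B -> strace U A = \tr M.
Proof.
move=> fB BU BA; set B1 := row_base U.
have B1U : (B1 :=: U)%MS := eq_row_base U.
have fB1 : row_free B1 := row_base_free U.
have B1B : (B1 <= B)%MS by rewrite B1U BU.
have BB1 : (B <= B1)%MS by rewrite B1U BU.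
pose C := B1 *m pinvmx B; pose C' := B *m pinvmx B1.
have CB : C *m B = B1 by apply: mulmxKpV.
have CB1 : C' *m B1 = B by apply: mulmxKpV.
have CC' : C *m C' = 1%:M by apply: (row_free_inj fB1); rewrite -mulmxA CB1 CB mul1mx.
have C'C : C' *m C = 1%:M by apply: (row_free_inj fB); rewrite -mulmxA CB CB1 mul1mx.
set M1 := B1 *m A *m pinvmx B1.
have M1B1 : M1 *m B1 = B1 *m A.
  apply: mulmxKpV; rewrite -{1}CB -mulmxA BA mulmxA.
  exact: submx_trans (submxMl _ _) BB1.
have M1C : M1 *m C = C *m M.
  by apply: (row_free_inj fB); rewrite -mulmxA CB M1B1 -[in RHS]mulmxA -BA mulmxA CB.
by rewrite /strace -/B1 -/M1 -[M1]mulmx1 -CC' mulmxA M1C mxtrace_mulC mulmxA C'C mul1mx.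
Qed.

Lemma strace_eqmx U V A : (V *m A <= V)%MS -> (U :=: V)%MS -> strace U A = strace V A.
Proof.
move=> sV UV; apply: (@strace_basis _ _ _ (row_base V)); first exact: row_base_free.
  by apply: eqmx_trans (eq_row_base V) (eqmx_sym UV).
by rewrite mulmxKpV // (eqmxMr A (eq_row_base V)) (submx_trans sV) // eq_row_base.
Qed.

Lemma strace_direct m1 m2 U A (B1 : 'M_(m1, N)) (B2 : 'M_(m2, N)) M1 X M2 :
    row_free B1 -> row_free B2 -> (B1 :&: B2)%MS = 0 -> (B1 + B2 :=: U)%MS ->
    B1 *m A = M1 *m B1 -> B2 *m A = X *m B1 + M2 *m B2 ->
  strace U A = \tr M1 + \tr M2.
Proof.
move=> f1 f2 B12 BU B1A B2A; rewrite -(mxtrace_block M1 0 X M2).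
apply: (@strace_basis _ _ _ (col_mx B1 B2)).
- rewrite /row_free -addsmxE mxrank_disjoint_sum //.
  by rewrite (eqP f1) (eqP f2).
- by apply: eqmx_trans BU; apply: eqmx_sym; apply: addsmxE.
- by rewrite mul_col_mx mul_block_col mul0mx addr0 B1A B2A.
Qed.

(** Traces add along the exact sequence of stable spaces from U :&: ker G through U to U G: a
    complement [B2] of the kernel in U is carried isomorphically onto U G. *)
Lemma strace_ker U A G : (U *m A <= U)%MS -> A *m G = G *m A ->
  strace U A = strace (U :&: kermx G)%MS A + strace (U *m G) A.
Proof.
move=> sU AG; set W := (U :&: kermx G)%MS.
set B1 := row_base W; set B2 := row_base (U :\: kermx G)%MS.
have B1W : (B1 :=: W)%MS := eq_row_base _.
have B2D : (B2 :=: U :\: kermx G)%MS := eq_row_base _.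
have BU : (B1 + B2 :=: U)%MS.
  apply: eqmx_trans (addsmx_diff_cap_eq U (kermx G)); rewrite addsmxC.
  exact: adds_eqmx.
have B2K : (B2 :&: kermx G)%MS = 0.
  by apply/eqP; rewrite -submx0 -(capmx_diff U (kermx G)) capmxS // B2D.
have B1G : B1 *m G = 0 by apply/sub_kermxP; rewrite B1W capmxSr.
have sW : (W *m A <= W)%MS.
  rewrite sub_capmx (submx_trans (submxMr A (capmxSl _ _))) //=.
  by apply/sub_kermxP; rewrite -mulmxA AG mulmxA (sub_kermxP (capmxSr _ _)) mul0mx.
have B1A : B1 *m A = B1 *m A *m pinvmx B1 *m B1.
  by rewrite mulmxKpV // (eqmxMr A B1W) (submx_trans sW) // B1W.
have B2A : (B2 *m A <= col_mx B1 B2)%MS.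
  rewrite -addsmxE BU; apply: submx_trans sU; apply: submxMr.
  by rewrite B2D diffmxSl.
pose X := B2 *m A *m pinvmx (col_mx B1 B2).
have XE : B2 *m A = lsubmx X *m B1 + rsubmx X *m B2.
  by rewrite -mul_row_col hsubmxK mulmxKpV.
have f2G : row_free (B2 *m G).
  by have := mxrank_mul_ker B2 G; rewrite B2K mxrank0 addn0 /row_free => ->; apply: row_base_free.
have UG : (B2 *m G :=: U *m G)%MS.
  apply: eqmx_trans (eqmxMr G BU); apply: eqmx_sym.
  apply: eqmx_trans (addsmxMr _ _ _) _; rewrite B1G.
  exact: adds0mx.
rewrite (strace_direct (row_base_free _) (row_base_free _) _ BU B1A XE); last first.
  by apply/eqP; rewrite -submx0 -B2K capmxC capmxS // B1W capmxSr.
congr (_ + _); rewrite (strace_basis f2G UG (M := rsubmx X)) //.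
by rewrite -mulmxA -AG mulmxA XE mulmxDl -mulmxA B1G mulmx0 add0r mulmxA.
Qed.

End StableTrace.

(** * Creation and annihilation operators *)

Section Operators.
Variable n : nat.
Local Notation bmon := (bmon_ n).
Local Notation gen := (bool * 'I_n)%type.
Local Notation N := (dimE n).
Implicit Types (b : bmon) (g h : gen) (s : 'S_n) (e : bool).

(* The generators are theta_i = (false, i) and xi_i = (true, i); [glt] orders all theta's
   before all xi's, as in the monomial basis. *)
Definition gmem b g := g.2 \in (if g.1 then b.2 else b.1).
Definition glt g h := (~~ g.1 && h.1) || ((g.1 == h.1) && (g.2 < h.2)%N).
Definition gadd g b : bmon := if g.1 then (b.1, g.2 |: b.2) else (g.2 |: b.1, b.2).
Definition gdel g b : bmon := if g.1 then (b.1, b.2 :\ g.2) else (b.1 :\ g.2, b.2).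
(** The sign of moving g, placed in front of b, to its sorted position. *)
Definition gsign g b : rat := \prod_(h | gmem b h) (-1) ^+ glt h g.

Lemma gmem_ext b b' : gmem b =1 gmem b' -> b = b'.
Proof.
case: b b' => [S T] [S' T'] E; congr (_, _); apply/setP => i.
  exact: (E (false, i)).
exact: (E (true, i)).
Qed.

Lemma gmem_add g b h : gmem (gadd g b) h = (h == g) || gmem b h.
Proof.
case: g h => [[] i] [[] j]; rewrite /gmem /gadd /= ?inE -?pair_eqE /= ?eqxx //=.
Qed.

Lemma gmem_del g b h : gmem (gdel g b) h = (h != g) && gmem b h.
Proof.
case: g h => [[] i] [[] j]; rewrite /gmem /gdel /= ?inE -?pair_eqE /= ?eqxx //=.
Qed.

Lemma gaddK g b : ~~ gmem b g -> gdel g (gadd g b) = b.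
Proof.
move=> gb; apply: gmem_ext => h; rewrite gmem_del gmem_add.
by case: eqVneq => [->|] //=; rewrite (negbTE gb).
Qed.

Lemma gdelK g b : gmem b g -> gadd g (gdel g b) = b.
Proof. by move=> gb; apply: gmem_ext => h; rewrite gmem_add gmem_del; case: eqVneq => [->|]. Qed.

Lemma gaddC g h b : gadd g (gadd h b) = gadd h (gadd g b).
Proof. by apply: gmem_ext => k; rewrite !gmem_add orbCA. Qed.

Lemma gadd_del g h b : g != h -> gadd g (gdel h b) = gdel h (gadd g b).
Proof.
move=> gh; apply: gmem_ext => k; rewrite !(gmem_add, gmem_del).
by case: (eqVneq k g) => [->|] //=; rewrite gh.
Qed.

Lemma gltC g h : g != h -> glt g h = ~~ glt h g.
Proof.
case: g h => [[] i] [[] j]; rewrite /glt -pair_eqE //= => ij.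
  by case: ltngtP ij => // /val_inj ->; rewrite eqxx.
by case: ltngtP ij => // /val_inj ->; rewrite eqxx.
Qed.

Lemma gltnn g : glt g g = false.
Proof. by rewrite /glt eqxx ltnn; case: g.1. Qed.

Lemma gsign_add g h b : ~~ gmem b h -> gsign g (gadd h b) = (-1) ^+ glt h g * gsign g b.
Proof.
move=> hb; rewrite /gsign (bigD1 h) ?gmem_add ?eqxx //=; congr (_ * _).
by apply: eq_bigl => k; rewrite gmem_add; case: eqVneq => [->|]; rewrite ?(negbTE hb) ?andbF ?andbT.
Qed.

Lemma gsign_add_same g b : gsign g (gadd g b) = gsign g b.
Proof.
have [gb|gb] := boolP (gmem b g); last by rewrite gsign_add // gltnn mul1r.
by congr gsign; apply: gmem_ext => h; rewrite gmem_add; case: eqP => [->|].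
Qed.

Lemma gsign_del_same g b : gsign g (gdel g b) = gsign g b.
Proof.
have [gb|gb] := boolP (gmem b g); first by rewrite -[in RHS](gdelK gb) gsign_add_same.
by congr gsign; apply: gmem_ext => h; rewrite gmem_del; case: eqP => [->|] //=; rewrite (negbTE gb).
Qed.

Lemma gsign_sqr g b : gsign g b * gsign g b = 1.
Proof. by rewrite -expr2 -prodrXl big1 // => h _; rewrite sqrr_sign. Qed.

Definition ev b : 'rV[rat]_N := delta_mx 0 (enum_rank b).

Definition monop (p : bmon -> bmon) (c : bmon -> rat) : 'M[rat]_N :=
  \matrix_(i, j) if bof j == p (bof i) then c (bof i) else 0.

Lemma ev_monop p c b : ev b *m monop p c = c b *: ev (p b).
Proof.
apply/rowP => j; rewrite -rowE !mxE /bof enum_rankK eqxx /=.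
rewrite -[j == _](inj_eq enum_val_inj) enum_rankK.
by case: eqP; rewrite ?mulr1 ?mulr0.
Qed.

Lemma row_ev x : x = \sum_b x 0 (enum_rank b) *: ev b :> 'rV[rat]_N.
Proof.
rewrite [LHS]row_sum_delta (reindex_onto (@enum_rank _) (@enum_val _ _)) /=; last first.
  by move=> i _; rewrite enum_valK.
by apply: eq_bigl => b; rewrite enum_rankK eqxx.
Qed.

Lemma ev_ext m (A B : 'M[rat]_(N, m)) : (forall b, ev b *m A = ev b *m B) -> A = B.
Proof.
move=> AB; apply/row_matrixP => i; rewrite !rowE.
by have := AB (enum_val i); rewrite /ev enum_valK.
Qed.

Definition cr g := monop (gadd g) (fun b => if gmem b g then 0 else gsign g b).
Definition an g := monop (gdel g) (fun b => if gmem b g then gsign g b else 0).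

Lemma ev_cr b g : ev b *m cr g = (if gmem b g then 0 else gsign g b) *: ev (gadd g b).
Proof. exact: ev_monop. Qed.

Lemma ev_an b g : ev b *m an g = (if gmem b g then gsign g b else 0) *: ev (gdel g b).
Proof. exact: ev_monop. Qed.

(** Monomials are orthonormal for the standard form, so contraction is the adjoint of
    multiplication. *)
Lemma cr_tr g : (cr g)^T = an g.
Proof.
apply/matrixP => i j; rewrite !mxE; set b := bof i; set b' := bof j.
have [gb|gb] := boolP (gmem b g); have [gb'|gb'] := boolP (gmem b' g); rewrite ?if_same //.
- by case: eqP => // E; move: gb'; rewrite E gmem_del eqxx.
- case: eqP => [E|E]; case: eqP => [E'|E'] //.
  + by rewrite E gsign_add_same.
  + by case: E'; rewrite E gaddK.
  + by case: E; rewrite E' gdelK.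
- by case: eqP => // E; move: gb; rewrite E gmem_add eqxx.
Qed.

Lemma cr_anticomm g h : cr g *m cr h = - (cr h *m cr g).
Proof.
apply: ev_ext => b; rewrite mulmxN !mulmxA !ev_cr -!scalemxAl !ev_cr !gmem_add !scalerA gaddC.
rewrite -scaleNr; congr (_ *: _); rewrite [h == g]eq_sym.
have [->|gh] := eqVneq g h; first by rewrite /= !mulr0 oppr0.
have [gb|gb] := boolP (gmem b g); first by rewrite mul0r !mulr0 oppr0.
have [hb|hb] := boolP (gmem b h); first by rewrite mul0r !mulr0 oppr0.
rewrite /= !gsign_add // [glt g h]gltC //.
by case: (glt h g) => /=; ring.
Qed.

(** The canonical anticommutation relations, from which the commutators of tau and omega with their
    adjoints are computed. For distinct generators the two orders differ by the single comparison of
    g with h. *)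
Lemma cr_an g h : cr g *m an h + an h *m cr g = (g == h)%:R%:M.
Proof.
apply: ev_ext => b; rewrite mulmxDr !mulmxA ev_cr ev_an -!scalemxAl ev_cr ev_an.
rewrite gmem_add gmem_del !scalerA mul_mx_scalar [h == g]eq_sym.
have [<-|gh] /= := eqVneq g h.
  have [gb|gb] := boolP (gmem b g).
    by rewrite mul0r scale0r add0r gsign_del_same gsign_sqr gdelK.
  by rewrite mul0r scale0r addr0 gsign_add_same gsign_sqr gaddK.
rewrite gadd_del // -scalerDl scale0r.
have [gb|gb] := boolP (gmem b g); first by rewrite mul0r mulr0 addr0 scale0r.
have [hb|hb] := boolP (gmem b h); last by rewrite mul0r mulr0 addr0 scale0r.
have gb' : ~~ gmem (gdel h b) g by rewrite gmem_del negb_and gb orbT.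
have hb' : ~~ gmem (gdel h b) h by rewrite gmem_del eqxx.
have -> : gsign h (gadd g b) = (-1) ^+ glt g h * gsign h (gdel h b).
  by rewrite gsign_del_same gsign_add.
have -> : gsign g b = (-1) ^+ glt h g * gsign g (gdel h b).
  by rewrite -gsign_add // gdelK.
rewrite gsign_del_same [glt g h]gltC // (_ : _ + _ = 0) ?scale0r //.
by case: (glt h g) => /=; ring.
Qed.

End Operators.

(** * The operators tau, chi, omega, their adjoints and commutators *)

Section GlobalOperators.
Variable n : nat.
Local Notation bmon := (bmon_ n).
Local Notation gen := (bool * 'I_n)%type.
Local Notation N := (dimE n).
Implicit Types (b : bmon) (g h : gen) (s t : 'S_n) (e : bool).

(* Row-vector convention: [x *m om] is omega x with omega = sum_i theta_i xi_i. *)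
Definition tau e : 'M[rat]_N := \sum_i cr (e, i).
Definition om : 'M[rat]_N := \sum_i cr (true, i) *m cr (false, i).
Definition dtau e : 'M[rat]_N := \sum_i an (e, i).
Definition domg : 'M[rat]_N := \sum_i an (false, i) *m an (true, i).
Definition numop e : 'M[rat]_N := \sum_i an (e, i) *m cr (e, i).

Lemma tau_tr e : (tau e)^T = dtau e.
Proof. by rewrite /tau raddf_sum /=; apply: eq_bigr => i _; rewrite cr_tr. Qed.

Lemma dtau_tr e : (dtau e)^T = tau e.
Proof. by rewrite -tau_tr trmxK. Qed.

Lemma om_tr : om^T = domg.
Proof. by rewrite /om raddf_sum /=; apply: eq_bigr => i _; rewrite trmx_mul !cr_tr. Qed.

Lemma dom_tr : domg^T = om.
Proof. by rewrite -om_tr trmxK. Qed.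

Lemma tau_cr e g : tau e *m cr g = - (cr g *m tau e).
Proof.
by rewrite /tau mulmx_suml mulmx_sumr -sumrN; apply: eq_bigr => i _; rewrite cr_anticomm.
Qed.

Lemma tau_anticomm e e' : tau e *m tau e' = - (tau e' *m tau e).
Proof.
by rewrite {2 3}/tau mulmx_sumr mulmx_suml -sumrN; apply: eq_bigr => i _; rewrite tau_cr.
Qed.

Lemma om_cr g : om *m cr g = cr g *m om.
Proof.
rewrite /om mulmx_suml mulmx_sumr; apply: eq_bigr => i _.
by rewrite -mulmxA (cr_anticomm _ g) mulmxN !mulmxA (cr_anticomm _ g) mulNmx opprK.
Qed.

Lemma om_tau e : om *m tau e = tau e *m om.
Proof.
by rewrite /tau [LHS]mulmx_sumr [RHS]mulmx_suml; apply: eq_bigr => i _; rewrite om_cr.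
Qed.

Lemma dtau_anticomm e e' : dtau e *m dtau e' = - (dtau e' *m dtau e).
Proof. by rewrite -!tau_tr -!trmx_mul tau_anticomm linearN. Qed.

Lemma dtau_sqr e : dtau e *m dtau e = 0.
Proof.
have := dtau_anticomm e e; move: (dtau e *m dtau e) => M /matrixP MN; apply/matrixP => i j.
by have := MN i j; rewrite !mxE; lra.
Qed.

Lemma dom_dtau e : domg *m dtau e = dtau e *m domg.
Proof. by rewrite -tau_tr -om_tr -!trmx_mul om_tau. Qed.

(** For n > 0 this makes tau / n a contracting homotopy for its adjoint, the source of the exactness
    used later. *)
Lemma tau_dtau e e' : tau e *m dtau e' + dtau e' *m tau e = ((e == e') * n)%:R%:M.
Proof.
rewrite /tau /dtau mulmx_suml.
under eq_bigr do rewrite mulmx_sumr.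
rewrite mulmx_sumr.
under [X in _ + X]eq_bigr do rewrite mulmx_suml.
rewrite -big_split /=.
transitivity (\sum_(i < n) (e == e')%:R%:M : 'M[rat]_N).
  apply: eq_bigr => i _; rewrite -big_split /= (bigD1 i) //= big1 => [|j ji].
    by rewrite cr_an addr0 -pair_eqE /= eqxx andbT.
  by rewrite cr_an -pair_eqE /= [i == j]eq_sym (negbTE ji) andbF raddf0.
rewrite sumr_const card_ord natrM mulrC -scale_scalar_mx.
by rewrite scaler_nat.
Qed.

Lemma om_an e i :
  om *m an (e, i) = an (e, i) *m om + (if e then - cr (false, i) else cr (true, i)).
Proof.
have loc g j : cr (true, j) *m cr (false, j) *m an g =
    an g *m (cr (true, j) *m cr (false, j))
    + (((false, j) == g)%:R *: cr (true, j) - ((true, j) == g)%:R *: cr (false, j)).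
  have E h : cr h *m an g = (h == g)%:R%:M - an g *m cr h.
    by rewrite -(cr_an h g) addrK.
  rewrite -[LHS]mulmxA E mulmxBr [X in _ - X]mulmxA E mulmxBl mul_mx_scalar mul_scalar_mx.
  by rewrite -[X in _ - (_ - X)]mulmxA opprB addrCA.
rewrite /om mulmx_suml mulmx_sumr; under eq_bigr do rewrite loc.
rewrite big_split /=; congr (_ + _).
rewrite (bigD1 i) //= big1 => [|j ji]; last first.
  by rewrite -!pair_eqE /= (negbTE ji) !andbF !scale0r subrr.
by case: e; rewrite -!pair_eqE /= eqxx /= scale1r scale0r ?sub0r ?subr0 addr0.
Qed.

Lemma om_dtau_f : om *m dtau false = dtau false *m om + tau true.
Proof.
rewrite /dtau [LHS]mulmx_sumr [X in X + _]mulmx_suml /tau -big_split; apply: eq_bigr => i _.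
exact: om_an.
Qed.

Lemma om_dtau_t : om *m dtau true = dtau true *m om - tau false.
Proof.
rewrite /dtau [LHS]mulmx_sumr [X in X - _]mulmx_suml /tau -sumrN -big_split; apply: eq_bigr => i _.
exact: om_an.
Qed.

Lemma tau_f_dom : tau false *m domg = domg *m tau false + dtau true.
Proof. by rewrite -dtau_tr -om_tr -trmx_mul om_dtau_f linearD /= trmx_mul tau_tr. Qed.

Lemma tau_t_dom : tau true *m domg = domg *m tau true - dtau false.
Proof. by rewrite -dtau_tr -om_tr -trmx_mul om_dtau_t linearB /= trmx_mul tau_tr. Qed.

(** The sl_2 relation: on bidegree (i, j) the commutator is the scalar n - i - j. *)
Lemma om_dom : om *m domg = domg *m om + (n%:R%:M - numop false - numop true).
Proof.
rewrite /domg [LHS]mulmx_sumr [X in X + _]mulmx_suml.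
have -> : n%:R%:M = \sum_(i < n) 1%:M :> 'M[rat]_N.
  by rewrite sumr_const card_ord -scaler_nat scale_scalar_mx mulr1.
rewrite /numop -!sumrN -!big_split; apply: eq_bigr => i _ /=.
rewrite mulmxA om_an mulmxDl -mulmxA om_an mulmxDr mulmxN mulmxA -[LHS]addrA; congr (_ + _).
have -> : cr (true, i) *m an (true, i) = 1%:M - an (true, i) *m cr (true, i).
  by have := cr_an (true, i) (true, i); rewrite eqxx => <-; rewrite addrK.
by rewrite addrCA addrA.
Qed.

Lemma ev_numop b e : ev b *m numop e = #|if e then b.2 else b.1|%:R *: ev b.
Proof.
rewrite /numop mulmx_sumr -sum1_card natr_sum scaler_suml [RHS]big_mkcond; apply: eq_bigr => i _.
rewrite mulmxA ev_an -scalemxAl ev_cr scalerA gmem_del eqxx /= gsign_del_same /gmem /=.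
case: ifP => h; last by rewrite mul0r scale0r.
by rewrite gsign_sqr gdelK.
Qed.

End GlobalOperators.

(** * Bidegree projections and equivariance under the symmetric group *)

Section Equivariance.
Variable n : nat.
Local Notation bmon := (bmon_ n).
Local Notation gen := (bool * 'I_n)%type.
Local Notation N := (dimE n).
Implicit Types (b : bmon) (g h : gen) (s t : 'S_n) (e : bool).

Lemma ev_bideg b i j :
  ev b *m bideg n i j = ((#|b.1| == i) && (#|b.2| == j))%:R *: ev b.
Proof.
have -> : bideg n i j = monop id (fun b => ((#|b.1| == i) && (#|b.2| == j))%:R).
  apply/matrixP => k l; rewrite !mxE [k == l]eq_sym (inj_eq enum_val_inj).
  by case: eqP => // _; case: (_ == _); case: (_ == _).
exact: ev_monop.
Qed.

Lemma bideg_tr i j : (bideg n i j)^T = bideg n i j.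
Proof. by apply/matrixP => k l; rewrite !mxE [l == k]eq_sym; case: eqP => // ->. Qed.

Lemma bideg_idem i j : bideg n i j *m bideg n i j = bideg n i j.
Proof.
apply: ev_ext => b; rewrite mulmxA ev_bideg -scalemxAl ev_bideg scalerA.
by case: (_ && _); rewrite ?mulr1 ?mulr0.
Qed.

Lemma card_gadd g b : ~~ gmem b g ->
  (#|(gadd g b).1| = #|b.1| + ~~ g.1)%N /\ (#|(gadd g b).2| = #|b.2| + g.1)%N.
Proof.
by case: g => [[] i]; rewrite /gmem /gadd /= => ib; rewrite cardsU1 ib addn0 addnC.
Qed.

Lemma tau_bideg_f i j : tau n false *m bideg n i.+1 j = bideg n i j *m tau n false.
Proof.
rewrite /tau [LHS]mulmx_suml [RHS]mulmx_sumr; apply: eq_bigr => k _; apply: ev_ext => b.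
rewrite !mulmxA ev_cr ev_bideg -!scalemxAl ev_cr ev_bideg !scalerA mulrC.
case: ifP => [|/negbT kb]; first by rewrite !mulr0.
by have [-> ->] := card_gadd kb; rewrite addn1 addn0.
Qed.

Lemma tau_bideg_f0 j : tau n false *m bideg n 0 j = 0.
Proof.
rewrite /tau [LHS]mulmx_suml; apply: big1 => k _; apply: ev_ext => b.
rewrite mulmx0 mulmxA ev_cr -scalemxAl ev_bideg scalerA.
case: ifP => [|/negbT kb]; first by rewrite mul0r scale0r.
by have [-> ->] := card_gadd kb; rewrite addn1 mulr0 scale0r.
Qed.

Lemma tau_bideg_t i j : tau n true *m bideg n i j.+1 = bideg n i j *m tau n true.
Proof.
rewrite /tau [LHS]mulmx_suml [RHS]mulmx_sumr; apply: eq_bigr => k _; apply: ev_ext => b.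
rewrite !mulmxA ev_cr ev_bideg -!scalemxAl ev_cr ev_bideg !scalerA mulrC.
case: ifP => [|/negbT kb]; first by rewrite !mulr0.
by have [-> ->] := card_gadd kb; rewrite addn1 addn0.
Qed.

Lemma tau_bideg_t0 i : tau n true *m bideg n i 0 = 0.
Proof.
rewrite /tau [LHS]mulmx_suml; apply: big1 => k _; apply: ev_ext => b.
rewrite mulmx0 mulmxA ev_cr -scalemxAl ev_bideg scalerA.
case: ifP => [|/negbT kb]; first by rewrite mul0r scale0r.
by have [-> ->] := card_gadd kb; rewrite addn1 andbF mulr0 scale0r.
Qed.

Let ev_om2 b k i j :
  ev b *m (cr (true, k) *m cr (false, k)) *m bideg n i j =
  ((#|b.1|.+1 == i) && (#|b.2|.+1 == j))%:R *: (ev b *m (cr (true, k) *m cr (false, k))).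
Proof.
rewrite mulmxA ev_cr -!scalemxAl ev_cr -!scalemxAl ev_bideg !scalerA.
case: ifP => [|/negbT tb]; first by rewrite !(mul0r, mulr0) !scale0r.
case: ifP => [|/negbT fb]; first by rewrite !(mul0r, mulr0) !scale0r.
have [-> ->] := card_gadd fb; have [-> ->] := card_gadd tb; rewrite !addn1 !addn0.
by congr (_ *: _); ring.
Qed.

Lemma om_bideg i j : om n *m bideg n i.+1 j.+1 = bideg n i j *m om n.
Proof.
rewrite /om [LHS]mulmx_suml [RHS]mulmx_sumr; apply: eq_bigr => k _; apply: ev_ext => b.
by rewrite [LHS]mulmxA ev_om2 [RHS]mulmxA ev_bideg -scalemxAl !eqSS.
Qed.

Lemma om_bideg0 i j : (i == 0%N) || (j == 0%N) -> om n *m bideg n i j = 0.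
Proof.
move=> ij; rewrite /om [LHS]mulmx_suml; apply: big1 => k _; apply: ev_ext => b.
rewrite mulmxA ev_om2 mulmx0; case/orP: ij => /eqP ->; rewrite ?andbF; exact: scale0r.
Qed.

Lemma bideg_dtau_f i j : bideg n i.+1 j *m dtau n false = dtau n false *m bideg n i j.
Proof. by rewrite -tau_tr -bideg_tr -trmx_mul tau_bideg_f trmx_mul bideg_tr. Qed.

Lemma bideg_dtau_f0 j : bideg n 0 j *m dtau n false = 0.
Proof. by rewrite -tau_tr -bideg_tr -trmx_mul tau_bideg_f0 trmx0. Qed.

Lemma bideg_dtau_t i j : bideg n i j.+1 *m dtau n true = dtau n true *m bideg n i j.
Proof. by rewrite -tau_tr -bideg_tr -trmx_mul tau_bideg_t trmx_mul bideg_tr. Qed.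

Lemma bideg_dtau_t0 i : bideg n i 0 *m dtau n true = 0.
Proof. by rewrite -tau_tr -bideg_tr -trmx_mul tau_bideg_t0 trmx0. Qed.

Lemma bideg_dom i j : bideg n i.+1 j.+1 *m domg n = domg n *m bideg n i j.
Proof. by rewrite -om_tr -bideg_tr -trmx_mul om_bideg trmx_mul bideg_tr. Qed.

Lemma bideg_dom0 i j : (i == 0%N) || (j == 0%N) -> bideg n i j *m domg n = 0.
Proof. by move=> ij; rewrite -om_tr -bideg_tr -trmx_mul om_bideg0 // trmx0. Qed.

Lemma bideg_numop i j e : bideg n i j *m numop n e = (if e then j else i)%:R *: bideg n i j.
Proof.
apply: ev_ext => b; rewrite mulmxA ev_bideg -scalemxAl ev_numop -scalemxAr ev_bideg !scalerA.
congr (_ *: _); rewrite mulrC; case: e.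
  by case: (#|b.2| =P j) => [->//|_]; rewrite andbF !mulr0.
by case: (#|b.1| =P i) => [->//|_]; rewrite !mulr0.
Qed.

Definition pact s b : bmon := (s @: b.1, s @: b.2).
Definition rsign s b : rat := act_sign s b.1 * act_sign s b.2.
Definition gperm s g : gen := (g.1, s g.2).

Lemma rhoE s : rho s = monop (pact s) (rsign s).
Proof. by apply/matrixP => i j; rewrite !mxE; case: (bof i). Qed.

Lemma ev_rho b s : ev b *m rho s = rsign s b *: ev (pact s b).
Proof. by rewrite rhoE ev_monop. Qed.

Lemma gmem_pact s b g : gmem (pact s b) (gperm s g) = gmem b g.
Proof. by case: g => [[] i]; rewrite /gmem /= (mem_imset _ _ (@perm_inj _ s)). Qed.

Lemma pact_gadd s g b : pact s (gadd g b) = gadd (gperm s g) (pact s b).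
Proof. by case: g => [[] i]; rewrite /pact /gadd /= imset_setU1. Qed.

Lemma prod_gen (c : gen -> bool) (F : gen -> rat) :
  \prod_(h | c h) F h
  = (\prod_(i | c (true, i)) F (true, i)) * \prod_(i | c (false, i)) F (false, i).
Proof.
transitivity (\prod_e \prod_i if c (e, i) then F (e, i) else 1).
  by rewrite pair_bigA big_mkcond; apply: eq_bigr => -[].
by rewrite big_bool -!big_mkcond.
Qed.

Lemma gsignE g b : gsign g b =
  if g.1 then (-1) ^+ #|b.1| * \prod_(i in b.2) (-1) ^+ (i < g.2)%N
  else \prod_(i in b.1) (-1) ^+ (i < g.2)%N.
Proof.
rewrite /gsign prod_gen /gmem /glt /=; case: g => [[] i] /=.
  by rewrite prodr_const mulrC.
by rewrite big1 ?mul1r.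
Qed.

(** Inserting g and then permuting must produce the same sign as permuting and then inserting the
    image of g; this is the sign content of [cr_rho]. *)
Lemma rsign_gadd s g b : ~~ gmem b g ->
  gsign g b * rsign s (gadd g b) = rsign s b * gsign (gperm s g) (pact s b).
Proof.
have key (A : {set 'I_n}) (i : 'I_n) : i \notin A ->
    (\prod_(a in A) (-1) ^+ (a < i)%N) * act_sign s (i |: A)
    = act_sign s A * \prod_(a in s @: A) (-1) ^+ (a < s i)%N.
  move=> iA; rewrite act_signU1 // mulrCA -big_split; congr (_ * _) => /=.
  rewrite big_imset /=; last by move=> ? ? _ _; apply: perm_inj.
  by apply: eq_bigr => a _; rewrite signr_addb mulrA -expr2 sqrr_sign mul1r.
case: g => [[] i]; rewrite /gmem /= => ib; rewrite !gsignE /= /rsign /= /gadd /=.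
  rewrite card_imset; last exact: perm_inj.
  by rewrite mulrACA key //; ring.
by rewrite mulrA key //; ring.
Qed.

Lemma cr_rho g s : cr g *m rho s = rho s *m cr (gperm s g).
Proof.
apply: ev_ext => b; rewrite !mulmxA ev_cr ev_rho -!scalemxAl ev_cr ev_rho !scalerA.
rewrite pact_gadd gmem_pact; congr (_ *: _); case: ifP => [|/negbT gb].
  by rewrite mul0r mulr0.
exact: rsign_gadd.
Qed.

Lemma rhoM s t : rho (s * t)%g = rho s *m rho t.
Proof.
have imsetM (A : {set 'I_n}) : (s * t)%g @: A = t @: (s @: A).
  by rewrite -imset_comp; apply: eq_imset => i; rewrite /= permM.
apply: ev_ext => b; rewrite mulmxA !ev_rho -scalemxAl ev_rho scalerA /rsign /pact /= !imsetM.
by rewrite !act_signM mulrACA.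
Qed.

Lemma rho1 : rho (1%g : 'S_n) = 1%:M.
Proof.
apply: ev_ext => b; rewrite ev_rho mulmx1 /rsign !act_sign_fixed => [|i _|i _]; rewrite ?perm1 //.
rewrite mulr1 scale1r /pact; case: b => A B /=.
by congr (ev (_, _)); rewrite (eq_imset _ (@perm1 _)) imset_id.
Qed.

Lemma rho_tr s : (rho s)^T = rho s^-1%g.
Proof.
have E (A B : {set 'I_n}) : (s @: A == B) = (A == s^-1%g @: B).
  apply/eqP/eqP => [<-|->]; rewrite -imset_comp.
    by rewrite -[LHS]imset_id; apply: eq_imset => i /=; rewrite permK.
  by rewrite -[RHS]imset_id; apply: eq_imset => i /=; rewrite permKV.
rewrite !rhoE; apply/matrixP => i j; rewrite !mxE; case: (bof i) => [A B]; case: (bof j) => [A' B'].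
rewrite /pact -!pair_eqE /= [A == _]eq_sym [B == _]eq_sym !E; case: eqP => //= ->; case: eqP => //= ->.
have F (C : {set 'I_n}) : act_sign s (s^-1%g @: C) = act_sign s^-1%g C.
  have := act_signM s^-1%g s C; rewrite mulVg [act_sign 1%g C]act_sign_fixed => [h|k _]; last exact: perm1.
  by rewrite -[RHS]mulr1 h mulrA act_sign_sqr mul1r.
by rewrite /rsign /= !F.
Qed.

Lemma rho_trK s : rho s *m (rho s)^T = 1%:M.
Proof. by rewrite rho_tr -rhoM mulgV rho1. Qed.

Lemma rho_trKV s : (rho s)^T *m rho s = 1%:M.
Proof. by rewrite rho_tr -rhoM mulVg rho1. Qed.

(** As [rho s] is orthogonal, adjoints of equivariant operators are again equivariant. *)
Lemma rho_comm_tr s (M : 'M[rat]_N) : M *m rho s = rho s *m M -> M^T *m rho s = rho s *m M^T.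
Proof.
move=> /(congr1 trmx); rewrite !trmx_mul => E.
rewrite -[LHS]mul1mx -(rho_trK s) -mulmxA; congr (_ *m _).
by rewrite mulmxA E -mulmxA rho_trKV mulmx1.
Qed.

Lemma tau_rho e s : tau n e *m rho s = rho s *m tau n e.
Proof.
rewrite /tau [LHS]mulmx_suml [RHS]mulmx_sumr [RHS](reindex_inj (@perm_inj _ s)) /=.
by apply: eq_bigr => i _; rewrite cr_rho.
Qed.

Lemma om_rho s : om n *m rho s = rho s *m om n.
Proof.
rewrite /om [LHS]mulmx_suml [RHS]mulmx_sumr [RHS](reindex_inj (@perm_inj _ s)) /=.
by apply: eq_bigr => i _; rewrite -mulmxA cr_rho mulmxA cr_rho mulmxA.
Qed.

Lemma dtau_rho e s : dtau n e *m rho s = rho s *m dtau n e.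
Proof. by rewrite -tau_tr rho_comm_tr // tau_rho. Qed.

Lemma dom_rho s : domg n *m rho s = rho s *m domg n.
Proof. by rewrite -om_tr rho_comm_tr // om_rho. Qed.

Lemma bideg_rho i j s : bideg n i j *m rho s = rho s *m bideg n i j.
Proof.
apply: ev_ext => b; rewrite !mulmxA ev_bideg ev_rho -!scalemxAl ev_bideg ev_rho !scalerA /=.
have cE (A : {set 'I_n}) : #|s @: A| = #|A| by rewrite card_imset //; apply: perm_inj.
by rewrite !cE; congr (_ *: _); rewrite mulrC.
Qed.

End Equivariance.

(** * The coinvariant ideal *)

Section CoinvIdeal.
Variable n : nat.
Local Notation bmon := (bmon_ n).
Local Notation gen := (bool * 'I_n)%type.
Local Notation N := (dimE n).
Implicit Types (b m : bmon) (g h : gen) (s t : 'S_n) (e : bool).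

Definition csgn m b : rat := (bmul m b).1.
Definition bunion m b : bmon := (bmul m b).2.
Definition bone : bmon := (set0, set0).

Lemma gmem_one g : gmem bone g = false.
Proof. by case: g => [[] i]; rewrite /gmem /= inE. Qed.

Lemma gmem_union m b g : gmem (bunion m b) g = gmem m g || gmem b g.
Proof. by case: g => [[] i]; rewrite /gmem /= inE. Qed.

Lemma gsign_neq0 g b : gsign g b != 0.
Proof.
apply/eqP => c0; have := gsign_sqr g b; rewrite c0 mul0r => /eqP.
by rewrite eq_sym oner_eq0.
Qed.

Definition bdisj m b := [forall g, ~~ (gmem m g && gmem b g)].

(** Sorting the product moves each generator of m past the smaller generators of b. *)
Lemma csgnE m b : csgn m b = if bdisj m b then \prod_(g | gmem m g) gsign g b else 0.
Proof.
rewrite /csgn /bmul /=; have -> : [disjoint m.1 & b.1] && [disjoint m.2 & b.2] = bdisj m b.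
  apply/andP/forallP => [[d1 d2] [[] i]|h].
  - by rewrite /gmem /=; apply/negP => /andP[h1 h2]; move: (disjointFr d2 h1); rewrite h2.
  - by rewrite /gmem /=; apply/negP => /andP[h1 h2]; move: (disjointFr d1 h1); rewrite h2.
  rewrite !disjoints_subset; split; apply/subsetP => i im; rewrite inE; apply/negP => ib.
    by have := h (false, i); rewrite /gmem /= im ib.
  by have := h (true, i); rewrite /gmem /= im ib.
case: ifP => // _; rewrite prod_gen /gmem /= !merge_signE.
under [X in _ = X * _]eq_bigr do rewrite gsignE /=.
under [X in _ = _ * X]eq_bigr do rewrite gsignE /=.
by rewrite big_split /= prodr_const -exprM [(#|m.2| * _)%N]mulnC mulrAC.
Qed.

Lemma gsign_union g m b : bdisj m b -> gsign g (bunion m b) = gsign g m * gsign g b.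
Proof.
move=> /forallP d; rewrite /gsign (bigID (gmem m)) /=; congr (_ * _); apply: eq_bigl => h.
  by rewrite gmem_union; case: (gmem m h); rewrite ?andbF.
by rewrite gmem_union; have := d h; case: (gmem m h) => //=; rewrite ?andbT // => /negbTE.
Qed.

Lemma csgn_gadd g m b :
  (if gmem m g then 0 else gsign g m) * csgn (gadd g m) b
  = csgn m b * (if gmem (bunion m b) g then 0 else gsign g (bunion m b)).
Proof.
rewrite gmem_union; have [gm|gm] := boolP (gmem m g); first by rewrite mul0r mulr0.
rewrite !csgnE; have [gb|gb] /= := boolP (gmem b g).
  rewrite mulr0 ifF ?mulr0 //; apply/negP => /forallP/(_ g).
  by rewrite gmem_add eqxx gb.
have -> : bdisj (gadd g m) b = bdisj m b.
  apply/forallP/forallP => d h; have := d h; rewrite gmem_add ?negb_and ?negb_or.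
    by case/orP => [/andP[_ ->]//|->]; rewrite orbT.
  by case: eqVneq => [->|] //=; rewrite gb.
case: ifP => d; last by rewrite mulr0 mul0r.
rewrite gsign_union // (bigD1 g) ?gmem_add ?eqxx //= [LHS]mulrA [RHS]mulrC; congr (_ * _).
by apply: eq_bigl => h; rewrite gmem_add; case: eqVneq => [->|]; rewrite ?(negbTE gm) ?andbF ?andbT.
Qed.

Lemma bunion_gadd g m b : bunion (gadd g m) b = gadd g (bunion m b).
Proof. by apply: gmem_ext => h; rewrite !(gmem_union, gmem_add) orbA. Qed.

Definition Lmon m : 'M[rat]_N := monop (bunion m) (csgn m).
Definition Rmon m : 'M[rat]_N := monop (fun b => bunion b m) (fun b => csgn b m).

Lemma mulmx_monE m1 m2 : mulmx_mon m1 m2 = Lmon m1 *m Rmon m2.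
Proof.
have -> : mulmx_mon m1 m2 = monop (fun b => bunion (bunion m1 b) m2)
    (fun b => csgn m1 b * csgn (bunion m1 b) m2).
  by apply/matrixP => i j; rewrite !mxE eq_sym.
by apply: ev_ext => b; rewrite mulmxA !ev_monop -scalemxAl ev_monop scalerA.
Qed.

Lemma cr_Rmon g m : cr g *m Rmon m = Rmon m *m cr g.
Proof.
apply: ev_ext => b; rewrite !mulmxA ev_cr ev_monop -!scalemxAl ev_cr ev_monop !scalerA.
by rewrite bunion_gadd csgn_gadd.
Qed.

Lemma Lmon_gadd g m : ~~ gmem m g -> Lmon (gadd g m) = gsign g m *: (Lmon m *m cr g).
Proof.
move=> gm; apply: ev_ext => b; rewrite -scalemxAr mulmxA !ev_monop -scalemxAl ev_cr !scalerA.
by rewrite bunion_gadd -mulrA -csgn_gadd (negbTE gm) mulrA gsign_sqr mul1r.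
Qed.

Lemma csgn1m b : csgn bone b = 1.
Proof.
rewrite csgnE ifT ?big_pred0 //; first by move=> g; rewrite gmem_one.
by apply/forallP => g; rewrite gmem_one.
Qed.

Lemma bunion1m b : bunion bone b = b.
Proof. by apply: gmem_ext => g; rewrite gmem_union gmem_one. Qed.

Lemma Lmon1 : Lmon bone = 1%:M.
Proof. by apply: ev_ext => b; rewrite ev_monop csgn1m bunion1m scale1r mulmx1. Qed.

Lemma bmon_ind (P : bmon -> Prop) :
  P bone -> (forall g m, ~~ gmem m g -> P m -> P (gadd g m)) -> forall m, P m.
Proof.
move=> P1 PU [S T]; elim/set_ind: S => [|i S iS IH]; last exact: (PU (false, i) (S, T)).
by elim/set_ind: T => [//|i T iT IH]; exact: (PU (true, i) (set0, T)).
Qed.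

(** The sum of the images of multiplication by tau, chi and omega. These commute up to sign with
    every generator, so the sum is a two-sided ideal. *)
Definition Jmx : 'M[rat]_N := (tau n false + tau n true + om n)%MS.

Lemma tau_J e : (tau n e <= Jmx)%MS.
Proof.
rewrite /Jmx; case: e.
  exact: submx_trans (addsmxSr _ _) (addsmxSl _ _).
exact: submx_trans (addsmxSl _ _) (addsmxSl _ _).
Qed.

Lemma om_J : (om n <= Jmx)%MS.
Proof. exact: addsmxSr. Qed.

Lemma J_stable (M : 'M[rat]_N) :
  (forall e, (tau n e *m M <= tau n e)%MS) -> (om n *m M <= om n)%MS -> (Jmx *m M <= Jmx)%MS.
Proof.
move=> ht ho; rewrite {1}/Jmx addsmxMr addsmx_sub addsmxMr addsmx_sub.
by rewrite !(submx_trans (ht _) (tau_J _)) (submx_trans ho om_J).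
Qed.

Lemma J_cr g : (Jmx *m cr g <= Jmx)%MS.
Proof.
apply: J_stable => [e|]; last by rewrite om_cr submxMl.
by rewrite tau_cr eqmx_opp submxMl.
Qed.

Lemma J_rho s : (Jmx *m rho s <= Jmx)%MS.
Proof. by apply: J_stable => [e|]; rewrite ?tau_rho ?om_rho submxMl. Qed.

Lemma J_Lmon m : (Jmx *m Lmon m <= Jmx)%MS.
Proof.
elim/bmon_ind: m => [|g m gm IH]; first by rewrite Lmon1 mulmx1.
rewrite Lmon_gadd // -scalemxAr mulmxA scalemx_sub //.
exact: submx_trans (submxMr _ IH) (J_cr g).
Qed.

Lemma tau_Rmon e m : tau n e *m Rmon m = Rmon m *m tau n e.
Proof.
by rewrite /tau [LHS]mulmx_suml [RHS]mulmx_sumr; apply: eq_bigr => i _; rewrite cr_Rmon.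
Qed.

Lemma om_Rmon m : om n *m Rmon m = Rmon m *m om n.
Proof.
rewrite /om [LHS]mulmx_suml [RHS]mulmx_sumr; apply: eq_bigr => i _.
by rewrite -mulmxA cr_Rmon mulmxA cr_Rmon mulmxA.
Qed.

Lemma J_Rmon m : (Jmx *m Rmon m <= Jmx)%MS.
Proof. by apply: J_stable => [e|]; rewrite ?tau_Rmon ?om_Rmon submxMl. Qed.

(** The averaging operator without its factor 1 / n!. *)
Definition reynolds : 'M[rat]_N := \sum_s rho s.

Lemma rho_reynolds s : rho s *m reynolds = reynolds.
Proof.
rewrite /reynolds mulmx_sumr [RHS](reindex_inj (mulgI s)).
by apply: eq_bigr => t _; rewrite rhoM.
Qed.

Lemma J_reynolds (x : 'rV[rat]_N) : (x <= Jmx)%MS -> (x *m reynolds <= Jmx)%MS.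
Proof.
move=> xJ; rewrite mulmx_sumr summx_sub // => s _.
exact: submx_trans (submxMr _ xJ) (J_rho s).
Qed.

Definition bsupp b : {set 'I_n} := b.1 :|: b.2.

Lemma bsuppE b i : (i \in bsupp b) = gmem b (false, i) || gmem b (true, i).
Proof. by rewrite inE. Qed.

Lemma ev_rho_tperm b i j : i \notin bsupp b -> j \notin bsupp b ->
  ev b *m rho (tperm i j) = ev b.
Proof.
rewrite !inE !negb_or => /andP[i1 i2] /andP[j1 j2].
have fixA (A : {set 'I_n}) : i \notin A -> j \notin A -> tperm i j @: A = A.
  move=> iA jA; rewrite -[RHS]imset_id; apply: eq_in_imset => k kA.
  by rewrite tpermD //; [apply: contraNneq iA => ->|apply: contraNneq jA => ->].
rewrite ev_rho /rsign !act_sign_tperm_out // mulr1 scale1r /pact !fixA //.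
by case: b {i1 i2 j1 j2}.
Qed.

(* If theta_i xi_i divides b = theta_i xi_i b', averaging omega b' gives a positive multiple
   of the average of b. *)
Lemma reynolds_full b i : gmem b (false, i) -> gmem b (true, i) ->
  (ev b *m reynolds <= Jmx)%MS.
Proof.
move=> fb tb; set b' := gdel (true, i) (gdel (false, i) b).
have ib' : i \notin bsupp b' by rewrite bsuppE !gmem_del !eqxx /= ?andbF.
pose X j := ev b' *m (cr (true, j) *m cr (false, j)).
have Xi : exists2 c, c != 0 & X i = c *: ev b.
  have t1 : ~~ gmem b' (true, i) by rewrite gmem_del eqxx.
  have f1 : ~~ gmem (gadd (true, i) b') (false, i).
    by rewrite gmem_add !gmem_del !eqxx /= ?andbF.
  exists (gsign (true, i) b' * gsign (false, i) (gadd (true, i) b')).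
    by rewrite mulf_neq0 ?gsign_neq0.
  rewrite /X mulmxA ev_cr (negbTE t1) -scalemxAl ev_cr (negbTE f1) scalerA.
  by rewrite gdelK ?gdelK // gmem_del tb andbT -pair_eqE.
have Xj j : X j *m reynolds = (j \notin bsupp b')%:R *: (X i *m reynolds).
  have [jb|jb] := boolP (j \in bsupp b').
    rewrite scale0r /X mulmxA ev_cr -scalemxAl ev_cr scalerA gmem_add -pair_eqE /=.
    by move: jb; rewrite bsuppE => /orP[]->; rewrite ?mulr0 ?mul0r scale0r mul0mx.
  rewrite scale1r -[in RHS](rho_reynolds (tperm i j)) /X.
  rewrite -!mulmxA [cr (false, i) *m _]mulmxA cr_rho -[rho _ *m _ *m _]mulmxA.
  rewrite [cr (true, i) *m _]mulmxA cr_rho !mulmxA ev_rho_tperm //.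
  by rewrite /gperm /= tpermL.
have : (ev b' *m om n *m reynolds <= Jmx)%MS.
  by apply: J_reynolds; apply: submx_trans (submxMl _ _) om_J.
rewrite /om mulmx_sumr mulmx_suml; under eq_bigr do rewrite Xj.
rewrite -scaler_suml -natr_sum; case: Xi => c c0 ->; rewrite -scalemxAl scalerA.
set k := (_ * c); have k0 : k != 0.
  rewrite mulf_neq0 // pnatr_eq0 -lt0n (bigD1 i) //= ib'; exact: ltn0Sn.
by rewrite (eqmx_scale _ k0).
Qed.

(** If no index is doubled, write b up to sign as g b' and average tau_e b', where e is the type of
    g. Indices outside the support of b' all give the same average as g b'. Those inside give 0 or a
    monomial with a doubled index, covered by [reynolds_full]. Hence a positive multiple of the
    average of g b' lies in the ideal. *)
Lemma reynolds_J b : b != bone -> (ev b *m reynolds <= Jmx)%MS.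
Proof.
move=> b1; have [/existsP[i /andP[]]|/existsPn dj] :=
    boolP [exists i, gmem b (false, i) && gmem b (true, i)]; first exact: reynolds_full.
have [[e i] gb] : exists g, gmem b g.
  apply/existsP; apply: contraNT b1 => /existsPn h; apply/eqP/gmem_ext => g.
  by rewrite gmem_one (negbTE (h g)).
set b' := gdel (e, i) b.
have gb' : ~~ gmem b' (e, i) by rewrite gmem_del eqxx.
have ib' : i \notin bsupp b'.
  rewrite bsuppE !gmem_del -!pair_eqE /=; have := dj i.
  by move: gb; rewrite eqxx !andbT; case: (e) => /= -> //=; rewrite andbT orbF.
pose X j := ev b' *m cr (e, j).
have Xi : X i = gsign (e, i) b' *: ev b by rewrite /X ev_cr (negbTE gb') gdelK.
have Xj j : (X j *m reynolds - (j \notin bsupp b')%:R *: (X i *m reynolds) <= Jmx)%MS.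
  have [jb|jb] := boolP (j \in bsupp b').
    rewrite scale0r subr0 /X ev_cr; case: ifP => [_|/negbT je].
      by rewrite scale0r mul0mx sub0mx.
    rewrite -scalemxAl scalemx_sub //.
    have jn : gmem b' (~~ e, j).
      move: jb je; rewrite bsuppE.
      by case: (e) => /=; case: (gmem b' (false, j)); case: (gmem b' (true, j)).
    apply: (@reynolds_full _ j); rewrite gmem_add;
      by case: (e) jn => /= jn; rewrite ?jn ?orbT ?eqxx.
  rewrite scale1r -[X in (_ - X)](_ : X j *m reynolds = _) ?subrr ?sub0mx //.
  rewrite -[in RHS](rho_reynolds (tperm i j)) /X.
  rewrite -!mulmxA [cr (e, i) *m _]mulmxA cr_rho !mulmxA ev_rho_tperm //.
  by rewrite /gperm /= tpermL.
have tJ : (ev b' *m tau n e *m reynolds <= Jmx)%MS.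
  by apply: J_reynolds; apply: submx_trans (submxMl _ _) (tau_J e).
have : ((\sum_(j < n) (j \notin bsupp b')%:R *: (X i *m reynolds))%R <= Jmx)%MS.
  have -> : \sum_(j < n) (j \notin bsupp b')%:R *: (X i *m reynolds)
      = ev b' *m tau n e *m reynolds
        - \sum_(j < n) (X j *m reynolds - (j \notin bsupp b')%:R *: (X i *m reynolds)).
    have -> : ev b' *m tau n e = \sum_j X j by rewrite /tau mulmx_sumr.
    by rewrite [X in X - _]mulmx_suml sumrB opprB addrC subrK.
  by rewrite addmx_sub // eqmx_opp summx_sub.
rewrite -scaler_suml -natr_sum Xi -scalemxAl scalerA.
set k := (_ * _); have k0 : k != 0.
  by rewrite mulf_neq0 ?gsign_neq0 // pnatr_eq0 -lt0n (bigD1 i) //= ib'.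
by rewrite (eqmx_scale _ k0).
Qed.

Lemma no_const_coeff (x : 'rV[rat]_N) : (x <= no_const n)%MS -> x 0 (enum_rank bone) = 0 :> rat.
Proof.
move=> /submxP[y ->]; rewrite mxE big1 // => i _; rewrite mxE.
by case: eqP => [->|]; rewrite ?mulr0 //= /bof enum_rankK eqxx mulr0.
Qed.

Lemma sub_no_const (x : 'rV[rat]_N) : x 0 (enum_rank bone) = 0 :> rat -> (x <= no_const n)%MS.
Proof.
move=> x0; suff -> : x = x *m no_const n by apply: submxMl.
apply/rowP => j; rewrite mxE (bigD1 j) //= big1 => [|i ij]; last first.
  by rewrite mxE (negbTE ij) mulr0.
rewrite mxE eqxx /= addr0; case: eqP => [E|]; rewrite ?mulr1 //.
by rewrite -[j]enum_valK -/(bof j) E x0 mul0r.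
Qed.

Lemma sub_invariants (x : 'rV[rat]_N) : reflect (forall s, x *m rho s = x) (x <= invariants n)%MS.
Proof.
apply: (iffP (sub_bigcapmxP)) => h s.
  have := h s isT; move/sub_kermxP; rewrite mulmxBr mulmx1 => /eqP; rewrite subr_eq0.
  by move/eqP.
by move=> _; apply/sub_kermxP; rewrite mulmxBr mulmx1 h subrr.
Qed.

Lemma invariants_J : (invariants n :&: no_const n <= Jmx)%MS.
Proof.
apply/row_subP => r; set x := row r _.
have : (x <= invariants n :&: no_const n)%MS by apply: row_sub.
rewrite sub_capmx => /andP[/sub_invariants xi /no_const_coeff x0].
have E : (n`!)%:R *: x = x *m reynolds.
  rewrite /reynolds mulmx_sumr; under eq_bigr do rewrite xi.
  by rewrite sumr_const card_Sn scaler_nat.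
have f0 : (n`!)%:R != 0 :> rat by rewrite pnatr_eq0 -lt0n fact_gt0.
rewrite -[x]scale1r -(mulVf f0) -scalerA E scalemx_sub //.
rewrite [x]row_ev mulmx_suml summx_sub // => b _; rewrite -scalemxAl.
have [->|b1] := eqVneq b bone; first by rewrite x0 scale0r sub0mx.
by rewrite scalemx_sub // reynolds_J.
Qed.

Lemma ev1_Rmon b : ev bone *m Rmon b = ev b.
Proof. by rewrite ev_monop csgn1m bunion1m scale1r. Qed.

Lemma mulmx_mon1 (x : 'rV[rat]_N) b : x *m Rmon b = x *m mulmx_mon bone b.
Proof. by rewrite mulmx_monE Lmon1 mul1mx. Qed.

Lemma ev1_rho s : ev bone *m rho s = ev bone.
Proof. by rewrite ev_rho /rsign /pact /= !act_sign0 !imset0 mulr1 scale1r. Qed.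

(** Commuting with right multiplications, M sends b to M(1) b, and M(1) is an invariant without
    constant term. *)
Lemma gen_sub_coinv (M : 'M[rat]_N) :
    (forall s, M *m rho s = rho s *m M) -> (forall b, M *m Rmon b = Rmon b *m M) ->
    (ev bone *m M) 0 (enum_rank bone) = 0 ->
  (M <= coinv_ideal n)%MS.
Proof.
move=> Mr MR M1; apply/row_subP => r; rewrite rowE.
have -> : delta_mx 0 r = ev (enum_val r) by rewrite /ev enum_valK.
set b := enum_val r; rewrite -(ev1_Rmon b) -mulmxA -MR mulmxA mulmx_mon1.
rewrite /coinv_ideal; apply: (sumsmx_sup bone) => //.
apply: (sumsmx_sup b) => //; apply: submxMr; rewrite sub_capmx sub_no_const // andbT.
by apply/sub_invariants => s; rewrite -mulmxA Mr mulmxA ev1_rho.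
Qed.

Theorem coinv_idealE : (coinv_ideal n :=: Jmx)%MS.
Proof.
apply/eqmxP/andP; split.
  apply/sumsmx_subP => m1 _; apply/sumsmx_subP => m2 _.
  rewrite mulmx_monE mulmxA; apply: submx_trans (J_Rmon m2); apply: submxMr.
  by apply: submx_trans (J_Lmon m1); apply: submxMr; apply: invariants_J.
have cr0 (x : 'rV[rat]_N) g : (x *m cr g) 0 (enum_rank bone) = 0.
  rewrite mxE big1 // => i _; rewrite mxE /bof enum_rankK; case: eqP => [E|]; rewrite ?mulr0 //.
  by have := gmem_one g; rewrite E gmem_add eqxx.
rewrite !addsmx_sub -andbA; apply/and3P; split.
- apply: gen_sub_coinv => [s|b|]; rewrite ?tau_rho ?tau_Rmon //.
  by rewrite /tau mulmx_sumr summxE big1.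
- apply: gen_sub_coinv => [s|b|]; rewrite ?tau_rho ?tau_Rmon //.
  by rewrite /tau mulmx_sumr summxE big1.
- apply: gen_sub_coinv => [s|b|]; rewrite ?om_rho ?om_Rmon //.
  by rewrite /om mulmx_sumr summxE big1 // => i _; rewrite mulmxA.
Qed.

End CoinvIdeal.

(** * Harmonic decomposition and the character of the coinvariants *)

Section Harmonic.
Variable n : nat.
Hypothesis n_gt0 : (0 < n)%N.
Local Notation N := (dimE n).
Local Notation E := (bideg n).
Local Notation tauf := (tau n false).
Local Notation taut := (tau n true).
Local Notation dtauf := (dtau n false).
Local Notation dtaut := (dtau n true).
Local Notation om := (om n).
Local Notation dom := (domg n).
Implicit Types (x y z : 'rV[rat]_N) (s : 'S_n).

Let n_neq0 : n%:R != 0 :> rat.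
Proof. by rewrite pnatr_eq0 -lt0n. Qed.

Lemma nrm_ge0 x : 0 <= (x *m x^T) 0 0.
Proof. by rewrite mxE sumr_ge0 // => i _; rewrite mxE -expr2 sqr_ge0. Qed.

Lemma nrm_eq0 x : (x *m x^T) 0 0 = 0 -> x = 0.
Proof.
rewrite mxE => /eqP; rewrite psumr_eq0 => [/allP h|i _]; last by rewrite mxE -expr2 sqr_ge0.
apply/rowP => i; have := h i; rewrite mem_index_enum => /(_ isT); rewrite !mxE mulf_eq0 orbb.
by move/eqP.
Qed.

Lemma nrm_adj x (M : 'M[rat]_N) : (x *m M) *m (x *m M)^T = x *m (M *m M^T) *m x^T.
Proof. by rewrite trmx_mul !mulmxA. Qed.

Lemma sub_bidegP i j x : reflect (x *m E i j = x) (x <= E i j)%MS.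
Proof.
apply: (iffP idP) => [/submxP[y ->]|<-]; last exact: submxMl.
by rewrite -mulmxA bideg_idem.
Qed.

Lemma bideg_stable i j s : (E i j *m rho s <= E i j)%MS.
Proof. by rewrite bideg_rho submxMl. Qed.

Lemma tau_dtau_same e : tau n e *m dtau n e = n%:R%:M - dtau n e *m tau n e.
Proof. by have := tau_dtau n e e; rewrite eqxx mul1n => <-; rewrite addrK. Qed.

Lemma tau_dtau_diff e e' : e != e' -> tau n e *m dtau n e' = - (dtau n e' *m tau n e).
Proof.
move=> ee'; apply/eqP; rewrite -addr_eq0 tau_dtau (negbTE ee') mul0n.
by rewrite raddf0.
Qed.

(* A Laplacian: being a sum of operators of the form A^T A, its kernel is the orthogonal
   complement of the ideal and its image is the ideal. *)
Definition Qop : 'M[rat]_N := dtauf *m tauf + dtaut *m taut + dom *m om.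

Lemma ker_Qop x : x *m Qop = 0 -> [/\ x *m dtauf = 0, x *m dtaut = 0 & x *m dom = 0].
Proof.
move=> xQ; have : (x *m Qop *m x^T) 0 0 = 0 by rewrite xQ mul0mx mxE.
rewrite /Qop -(dtau_tr n false) -(dtau_tr n true) -(dom_tr n) !mulmxDr !mulmxDl.
rewrite -!nrm_adj => h.
have hD (A B : 'M[rat]_1) : (A + B) 0 0 = A 0 0 + B 0 0 by rewrite mxE.
move: h; rewrite !hD => h.
have h1 := nrm_ge0 (x *m dtauf); have h2 := nrm_ge0 (x *m dtaut); have h3 := nrm_ge0 (x *m dom).
by split; apply: nrm_eq0; lra.
Qed.

Lemma ker_QopE x : x *m dtauf = 0 -> x *m dtaut = 0 -> x *m dom = 0 -> x *m Qop = 0.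
Proof. by move=> h1 h2 h3; rewrite /Qop !mulmxDr !mulmxA h1 h2 h3 !mul0mx !addr0. Qed.

Lemma Qop_J : (Qop :=: Jmx n)%MS.
Proof.
have QJ : (Qop <= Jmx n)%MS.
  rewrite !addmx_sub // (submx_trans (submxMl _ _)) ?tau_J //.
  exact: om_J.
have JK : (Jmx n :&: kermx Qop)%MS = 0.
  apply/eqP; rewrite -submx0; apply/rV_subP => x; rewrite sub_capmx => /andP[xJ /sub_kermxP/ker_Qop[h1 h2 h3]].
  have := xJ; rewrite /Jmx => /sub_addsmxP[[y1 y2] /= xE].
  have [[z1 z2] /= yE] := sub_addsmxP (submxMl y1 (tauf + taut)%MS).
  suff -> : x = 0 by apply: sub0mx.
  have t0 M : x *m M^T = 0 -> M *m x^T = 0.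
    by move=> /(congr1 trmx); rewrite trmx_mul trmxK trmx0.
  apply: nrm_eq0; rewrite {1}xE yE !mulmxDl -!mulmxA !t0 ?tau_tr ?om_tr //.
  by rewrite !mulmx0 !addr0 mxE.
(* Meeting the kernel trivially, the ideal has dimension at most the rank of [Qop]. *)
apply/eqmxP; rewrite -(geq_leqif (mxrank_leqif_eq QJ)).
have := rank_leq_col (Jmx n + kermx Qop)%MS; rewrite mxrank_disjoint_sum // mxrank_ker.
have := rank_leq_col Qop; lia.
Qed.

Lemma Qop_bideg i j : Qop *m E i j = E i j *m Qop.
Proof.
have Ef : dtauf *m tauf *m E i j = E i j *m (dtauf *m tauf).
  case: i => [|i]; first by rewrite -mulmxA tau_bideg_f0 mulmx0 mulmxA bideg_dtau_f0 mul0mx.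
  by rewrite -mulmxA tau_bideg_f !mulmxA bideg_dtau_f.
have Et : dtaut *m taut *m E i j = E i j *m (dtaut *m taut).
  case: j {Ef} => [|j]; first by rewrite -mulmxA tau_bideg_t0 mulmx0 mulmxA bideg_dtau_t0 mul0mx.
  by rewrite -mulmxA tau_bideg_t !mulmxA bideg_dtau_t.
have Eo : dom *m om *m E i j = E i j *m (dom *m om).
  have [ij|] := boolP ((i == 0%N) || (j == 0%N)).
    by rewrite -mulmxA om_bideg0 // mulmx0 mulmxA bideg_dom0 // mul0mx.
  case: i {Ef Et} => // i; case: j => // j _.
  by rewrite -mulmxA om_bideg !mulmxA bideg_dom.
by rewrite /Qop !mulmxDl !mulmxDr Ef Et Eo.
Qed.

Lemma Qop_rho s : rho s *m Qop = Qop *m rho s.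
Proof.
rewrite /Qop !mulmxDl !mulmxDr -!mulmxA !tau_rho om_rho !mulmxA.
by rewrite !dtau_rho dom_rho.
Qed.

Definition harm i j : 'M[rat]_N := (E i j :&: kermx Qop)%MS.

(** By trace additivity for [Qop], whose image on bidegree (i, j) is the ideal part, the difference
    defining [coinv_char] is the trace on the kernel. *)
Lemma coinv_char_harm i j s : coinv_char i j s = strace (harm i j) (rho s).
Proof.
rewrite /coinv_char -[restr_trace (E i j) _]/(strace (E i j) (rho s)).
rewrite -[restr_trace (_ :&: _)%MS _]/(strace (E i j :&: coinv_ideal n)%MS (rho s)).
rewrite (strace_ker (bideg_stable i j s) (Qop_rho s)) -/(harm i j).
rewrite (@strace_eqmx _ _ (E i j :&: coinv_ideal n)%MS (E i j *m Qop)) ?addrK //.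
  by rewrite -mulmxA -Qop_rho mulmxA bideg_rho -mulmxA submxMl.
apply/eqmxP/andP; split; last first.
  rewrite sub_capmx -{1}Qop_bideg submxMl coinv_idealE -Qop_J; exact: submxMl.
apply/rV_subP => x; rewrite sub_capmx coinv_idealE -Qop_J => /andP[/sub_bidegP xE /submxP[z xz]].
by rewrite -xE xz -mulmxA Qop_bideg submxMl.
Qed.

Definition kerf i j : 'M[rat]_N := (E i j :&: kermx dtauf)%MS.
Definition kerft i j : 'M[rat]_N := (kerf i j :&: kermx dtaut)%MS.

Lemma sub_kerf i j x : (x <= kerf i j)%MS <-> x *m E i j = x /\ x *m dtauf = 0.
Proof.
rewrite sub_capmx; split=> [/andP[/sub_bidegP h1 /sub_kermxP h2]|[h1 h2]] //.
by apply/andP; split; [apply/sub_bidegP|apply/sub_kermxP].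
Qed.

Lemma sub_kerft i j x :
  (x <= kerft i j)%MS <-> [/\ x *m E i j = x, x *m dtauf = 0 & x *m dtaut = 0].
Proof.
rewrite sub_capmx; split=> [/andP[/sub_kerf[h1 h2] /sub_kermxP h3]|[h1 h2 h3]] //.
by apply/andP; split; [apply/sub_kerf|apply/sub_kermxP].
Qed.

Lemma kerf_stable i j s : (kerf i j *m rho s <= kerf i j)%MS.
Proof.
apply/rV_subP => _ /submxP[y ->]; rewrite mulmxA.
have /sub_kerf[h1 h2] : (y *m kerf i j <= kerf i j)%MS := submxMl _ _.
by apply/sub_kerf; rewrite -!mulmxA -bideg_rho -dtau_rho !mulmxA h1 h2 mul0mx.
Qed.

Lemma kerft_stable i j s : (kerft i j *m rho s <= kerft i j)%MS.
Proof.
apply/rV_subP => _ /submxP[y ->]; rewrite mulmxA.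
have /sub_kerft[h1 h2 h3] : (y *m kerft i j <= kerft i j)%MS := submxMl _ _.
by apply/sub_kerft; rewrite -!mulmxA -bideg_rho -!dtau_rho !mulmxA h1 h2 h3 !mul0mx.
Qed.

Lemma strace0 s : strace (0 : 'M[rat]_N) (rho s) = 0.
Proof.
rewrite (@strace_basis _ _ _ _ 0 (0 : 'M_(0, N)) 0) ?mxtrace0 ?mulmx0 ?mul0mx //.
  by rewrite /row_free mxrank0.
by apply/eqmxP; rewrite !sub0mx.
Qed.

(** On the kernel of its adjoint, tau / n is a section of that adjoint, which therefore maps each
    bidegree onto the kernel one step lower. In generating functions this is the factor 1 + u. *)
Lemma strace_bideg i j s : strace (E i j) (rho s)
  = strace (kerf i j) (rho s) + (if i is i'.+1 then strace (kerf i' j) (rho s) else 0).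
Proof.
rewrite (strace_ker (bideg_stable i j s) (esym (dtau_rho false s))) -/(kerf i j).
congr (_ + _); case: i => [|i]; first by rewrite bideg_dtau_f0 strace0.
apply: strace_eqmx; first exact: kerf_stable.
apply/eqmxP/andP; split; apply/rV_subP => x.
  move=> /submxP[y ->]; rewrite bideg_dtau_f; apply/sub_kerf; rewrite -!mulmxA bideg_idem; split=> //.
  by rewrite [dtauf *m _]mulmxA -bideg_dtau_f -mulmxA dtau_sqr !mulmx0.
move=> /sub_kerf[h1 h2].
have -> : x = (n%:R^-1 *: x *m tauf) *m E i.+1 j *m dtauf.
  rewrite -!scalemxAl -[x *m _ *m _]mulmxA tau_bideg_f mulmxA h1 -mulmxA tau_dtau_same.
  by rewrite mulmxBr mulmxA h2 mul0mx subr0 mul_mx_scalar scalerA mulVf // scale1r.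
by rewrite -mulmxA submxMl.
Qed.

(** The same argument inside the first kernel, which chi preserves because it anticommutes with the
    adjoint of tau; this gives the factor 1 + v. *)
Lemma strace_kerf i j s : strace (kerf i j) (rho s)
  = strace (kerft i j) (rho s) + (if j is j'.+1 then strace (kerft i j') (rho s) else 0).
Proof.
rewrite (strace_ker (kerf_stable i j s) (esym (dtau_rho true s))) -/(kerft i j).
congr (_ + _); case: j => [|j].
  suff -> : kerf i 0 *m dtaut = 0 by rewrite strace0.
  apply/row_matrixP => r; rewrite row_mul row0.
  have /sub_kerf[<- _] : (row r (kerf i 0) <= kerf i 0)%MS := row_sub _ _.
  by rewrite -mulmxA bideg_dtau_t0 mulmx0.
apply: strace_eqmx; first exact: kerft_stable.
apply/eqmxP/andP; split; apply/rV_subP => x.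
  move=> /submxP[y ->]; rewrite mulmxA; move: (y *m _) (submxMl y (kerf i j.+1)) => z /sub_kerf[h1 h2].
  apply/sub_kerft; split; first by rewrite -mulmxA -bideg_dtau_t mulmxA h1.
    by rewrite -mulmxA dtau_anticomm mulmxN mulmxA h2 mul0mx oppr0.
  by rewrite -mulmxA dtau_sqr mulmx0.
move=> /sub_kerft[h1 h2 h3]; set y := n%:R^-1 *: x *m taut.
have yk : (y <= kerf i j.+1)%MS.
  apply/sub_kerf; rewrite /y -!scalemxAl; split.
    by rewrite -mulmxA tau_bideg_t mulmxA h1.
  by rewrite -mulmxA tau_dtau_diff // mulmxN mulmxA h2 mul0mx oppr0 scaler0.
suff -> : x = y *m dtaut by apply: submxMr.
rewrite /y -!scalemxAl -mulmxA tau_dtau_same mulmxBr mulmxA h3 mul0mx subr0.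
by rewrite mul_mx_scalar scalerA mulVf // scale1r.
Qed.

Lemma om_dom_bideg i j x : x *m E i j = x ->
  x *m om *m dom = x *m dom *m om + (n%:R - i%:R - j%:R) *: x.
Proof.
move=> xE; rewrite -!mulmxA om_dom !mulmxDr !mulmxN mul_mx_scalar; congr (_ + _).
have hn e : x *m numop n e = (if e then j else i)%:R *: x.
  by rewrite -{1}xE -mulmxA bideg_numop -scalemxAr xE.
by rewrite !hn !scalerBl.
Qed.

(** The squared norm of omega x is (n - i - j) times that of x, which forces x = 0 when i + j > n.
    When i + j = n, omega x = 0; commuting with the adjoint of tau gives chi x = 0, and the
    anticommutator of chi with its adjoint then gives n x = 0. *)
Lemma kerft_dom i j x : x *m E i j = x -> x *m dtauf = 0 -> x *m dtaut = 0 ->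
  (n <= i + j)%N -> x *m dom = 0 -> x = 0.
Proof.
move=> xE hf ht nij xd.
have nr : ((x *m om) *m (x *m om)^T) 0 0 = (n%:R - i%:R - j%:R) * (x *m x^T) 0 0.
  by rewrite nrm_adj om_tr !mulmxA (om_dom_bideg xE) xd mul0mx add0r -scalemxAl mxE.
have x0 := nrm_ge0 x; have xo0 := nrm_ge0 (x *m om).
move: nij; rewrite leq_eqVlt => /orP[/eqP ne|nlt].
  have xo : x *m om = 0.
    have nE : n%:R = i%:R + j%:R :> rat by rewrite -natrD -ne.
    by apply: nrm_eq0; rewrite nr -addrA -opprD -nE subrr mul0r.
  have xt : x *m taut = 0.
    have := congr1 (mulmx x) (om_dtau_f n); rewrite mulmxDr !mulmxA xo hf !mul0mx add0r.
    by move=> <-.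
  have := congr1 (mulmx x) (tau_dtau_same true); rewrite mulmxBr !mulmxA xt ht !mul0mx subr0.
  rewrite mul_mx_scalar => /esym/eqP; rewrite scaler_eq0 (negbTE n_neq0).
  by move/eqP.
apply: nrm_eq0; have : n%:R < i%:R + j%:R :> rat by rewrite -natrD ltr_nat.
by move: nr xo0; nra.
Qed.

(* The Lefschetz operator of the reflection representation: multiplication by the projection
   of omega to the exterior algebra generated by the kernel of dtau. *)
Definition Lop : 'M[rat]_N := om - n%:R^-1 *: (taut *m tauf).

(** Commuting omega past the adjoint of tau or chi leaves a multiplication by the other one, which
    the correction by 1 / n cancels exactly. *)
Lemma Lop_kerft i j y : (y <= kerft i j)%MS -> (y *m Lop <= kerft i.+1 j.+1)%MS.
Proof.
move=> /sub_kerft[yE hf ht]; rewrite /Lop mulmxBr -scalemxAr.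
have tf : y *m (taut *m tauf) *m dtauf = n%:R *: (y *m taut).
  rewrite -!mulmxA tau_dtau_same mulmxBr mulmxBr mul_mx_scalar -!scalemxAr.
  rewrite [taut *m (_ *m _)]mulmxA (tau_dtau_diff (e := true)) // mulNmx mulmxN !mulmxA hf.
  by rewrite !mul0mx oppr0 subr0.
have tt : y *m (taut *m tauf) *m dtaut = - (n%:R *: (y *m tauf)).
  rewrite -!mulmxA (tau_dtau_diff (e := false)) // !mulmxN; congr (- _).
  rewrite [taut *m (_ *m _)]mulmxA tau_dtau_same mulmxBl mulmxBr !mulmxA ht !mul0mx subr0.
  by rewrite mul_mx_scalar -scalemxAl.
apply/sub_kerft; split.
- rewrite mulmxBl -scalemxAl -[y *m om *m _]mulmxA om_bideg !mulmxA yE.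
  by rewrite -[y *m taut *m tauf *m _]mulmxA tau_bideg_f mulmxA -[y *m taut *m _]mulmxA tau_bideg_t mulmxA yE.
- rewrite mulmxBl -scalemxAl tf scalerA mulVf // scale1r -mulmxA om_dtau_f mulmxDr mulmxA hf.
  by rewrite mul0mx add0r subrr.
- rewrite mulmxBl -scalemxAl tt scalerN scalerA mulVf // scale1r -mulmxA om_dtau_t mulmxBr mulmxA ht.
  by rewrite mul0mx sub0r subrr.
Qed.

Lemma dom_kerft i j y : (y <= kerft i.+1 j.+1)%MS -> (y *m dom <= kerft i j)%MS.
Proof.
move=> /sub_kerft[yE hf ht]; apply/sub_kerft; split.
- by rewrite -mulmxA -bideg_dom mulmxA yE.
- by rewrite -mulmxA dom_dtau mulmxA hf mul0mx.
- by rewrite -mulmxA dom_dtau mulmxA ht mul0mx.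
Qed.

(** The correction contributes n * (1 / n) = 1, so the weight is n - 1 - i - j instead of n - i -
    j. *)
Lemma Lop_dom i j y : (y <= kerft i j)%MS ->
  y *m Lop *m dom = y *m dom *m Lop + (n%:R - 1 - i%:R - j%:R) *: y.
Proof.
move=> /sub_kerft[yE hf ht].
have ttd : y *m (taut *m tauf) *m dom = y *m dom *m (taut *m tauf) + n%:R *: y.
  rewrite -!mulmxA tau_f_dom mulmxDr [taut *m (_ *m _)]mulmxA tau_t_dom.
  rewrite mulmxBl mulmxDr mulmxBr !mulmxA hf mul0mx subr0; congr (_ + _).
  by rewrite -mulmxA tau_dtau_same mulmxBr mulmxA ht mul0mx subr0 mul_mx_scalar.
rewrite /Lop mulmxBr mulmxBl -scalemxAr -scalemxAl ttd (om_dom_bideg yE) mulmxBr -scalemxAr.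
rewrite scalerDr scalerA mulVf // opprD addrACA; congr (_ + _).
by rewrite -scalerBl; congr (_ *: _); ring.
Qed.

(** [Lop] followed by the adjoint of omega is an injective, hence surjective, endomorphism of the
    joint kernel in bidegree (i, j). On a vector y it kills, the squared norm of [y *m dom] equals
    -(n - 1 - i - j) times that of y, and the degree bound makes n - 1 - i - j positive. *)
Lemma kerft_dom_surj i j : (i + j + 2 <= n)%N -> (kerft i.+1 j.+1 *m dom :=: kerft i j)%MS.
Proof.
move=> ijn; apply/eqmxP/andP; split.
  by apply/rV_subP => _ /submxP[y ->]; rewrite mulmxA dom_kerft // submxMl.
have LM : (kerft i j *m (Lop *m dom) <= kerft i j)%MS.
  apply/rV_subP => _ /submxP[y ->]; rewrite !mulmxA; apply: dom_kerft; apply: Lop_kerft.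
  exact: submxMl.
have LK : (kerft i j :&: kermx (Lop *m dom))%MS = 0.
  apply/eqP; rewrite -submx0; apply/rV_subP => y; rewrite sub_capmx => /andP[yk /sub_kermxP].
  rewrite mulmxA (Lop_dom yk) => h; suff -> : y = 0 by apply: sub0mx.
  case/sub_kerft: yk => _ hf _.
  (* As y is orthogonal to the image of tau, the correction term of [Lop] vanishes in this
     pairing. *)
  have nd : ((y *m dom) *m (y *m dom)^T) 0 0 = (y *m dom *m Lop *m y^T) 0 0.
    have tfy : tauf *m y^T = 0 by rewrite -dtau_tr -trmx_mul hf trmx0.
    rewrite nrm_adj dom_tr /Lop mulmxBr mulmxBl -scalemxAr -scalemxAl.
    by rewrite -!mulmxA tfy !mulmx0 scaler0 subr0.
  move/eqP: h; rewrite addr_eq0 => /eqP h; rewrite h mulNmx -scalemxAl !mxE in nd.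
  apply: nrm_eq0; have y0 := nrm_ge0 y; have yd0 := nrm_ge0 (y *m dom).
  have : i%:R + j%:R + 2 <= n%:R :> rat by rewrite -!natrD ler_nat.
  by move: nd y0 yd0; rewrite !mxE; nra.
have : (kerft i j *m (Lop *m dom) == kerft i j)%MS.
  rewrite -(geq_leqif (mxrank_leqif_eq LM)).
  by have := mxrank_mul_ker (kerft i j) (Lop *m dom); rewrite LK mxrank0 addn0 => ->.
case/andP=> _ /submx_trans; apply; rewrite mulmxA; apply: submxMr.
by apply/rV_subP => _ /submxP[y ->]; rewrite mulmxA Lop_kerft // submxMl.
Qed.

Lemma harmE i j : (harm i j :=: kerft i j :&: kermx dom)%MS.
Proof.
apply/eqmxP/andP; split; apply/rV_subP => x; rewrite !sub_capmx.
  move=> /andP[h1 /sub_kermxP/ker_Qop[h2 h3 h4]]; rewrite h1 /=.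
  by apply/andP; split; [apply/andP; split|]; apply/sub_kermxP.
move=> /andP[/andP[/andP[h1 /sub_kermxP h2] /sub_kermxP h3] /sub_kermxP h4]; rewrite h1 /=.
by apply/sub_kermxP; apply: ker_QopE.
Qed.

(** The harmonics are the kernel of the adjoint of omega on the joint kernel; that map is onto below
    degree n and injective from degree n on. *)
Theorem coinv_charE i j s : coinv_char i j s =
  if (i + j < n)%N then
    strace (kerft i j) (rho s)
    - (match i, j with i'.+1, j'.+1 => strace (kerft i' j') (rho s) | _, _ => 0 end)
  else 0.
Proof.
rewrite coinv_char_harm.
have hs : ((kerft i j :&: kermx dom)%MS *m rho s <= kerft i j :&: kermx dom)%MS.
  rewrite sub_capmx (submx_trans (submxMr _ (capmxSl _ _)) (kerft_stable _ _ _)) /=.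
  by apply/sub_kermxP; rewrite -mulmxA -dom_rho mulmxA (sub_kermxP (capmxSr _ _)) mul0mx.
rewrite (strace_eqmx hs (harmE i j)); case: ltnP => ijn; last first.
  suff -> : (kerft i j :&: kermx dom)%MS = 0 by apply: strace0.
  apply/eqP; rewrite -submx0; apply/rV_subP => x; rewrite sub_capmx.
  move=> /andP[/sub_kerft[h1 h2 h3] /sub_kermxP h4].
  by rewrite (kerft_dom h1 h2 h3 ijn h4) sub0mx.
rewrite (strace_ker (kerft_stable i j s) (esym (dom_rho s))) -addrA.
rewrite -[LHS]addr0; congr (_ + _); apply/esym.
have ker0 : (i == 0%N) || (j == 0%N) -> strace (kerft i j *m dom) (rho s) = 0.
  move=> ij0; suff -> : kerft i j *m dom = 0 by apply: strace0.
  apply/row_matrixP => r; rewrite row_mul row0.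
  have /sub_kerft[<- _ _] : (row r (kerft i j) <= kerft i j)%MS := row_sub _ _.
  by rewrite -mulmxA bideg_dom0 // mulmx0.
case: i j ijn ker0 {hs} => [|i] [|j] ijn ker0; rewrite 1?(ker0 isT) ?subr0 //.
apply/eqP; rewrite subr_eq0; apply/eqP; apply: strace_eqmx; first exact: kerft_stable.
by apply: kerft_dom_surj; lia.
Qed.

End Harmonic.

(** * Bigraded multiplicities *)

Lemma strace_idem (F : fieldType) (N : nat) (P A : 'M[F]_N) :
  P *m P = P -> P *m A = A *m P -> strace P A = \tr (P *m A).
Proof.
move=> PP PA; set B := row_base P; pose C := P *m pinvmx B.
have CB : C *m B = P by apply: mulmxKpV; rewrite eq_row_base.
have BP : B *m P = B.
  have /submxP[D ->] : (B <= P)%MS by rewrite eq_row_base.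
  by rewrite -mulmxA PP.
rewrite (@strace_basis _ _ _ _ _ B (B *m A *m C)) ?row_base_free //.
- by rewrite mxtrace_mulC mulmxA CB.
- exact: eq_row_base.
- by rewrite -mulmxA CB -mulmxA -PA mulmxA BP.
Qed.

Lemma strace_bideg_ext n i j (s : 'S_n) : strace (bideg n i j) (rho s) = ext_char i j s.
Proof.
rewrite (strace_idem (bideg_idem n i j) (bideg_rho i j s)) /mxtrace.
rewrite (reindex_onto (@enum_rank _) (@enum_val _ _)) /= => [|k _]; last by rewrite enum_valK.
rewrite [RHS]big_mkcond (eq_bigl predT) => [|b] /=; last by rewrite enum_rankK eqxx.
apply: eq_bigr => b _.
have -> : (bideg n i j *m rho s) (enum_rank b) (enum_rank b)
    = (ev b *m (bideg n i j *m rho s)) 0 (enum_rank b) by rewrite /ev -rowE [RHS]mxE.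
rewrite mulmxA ev_bideg -scalemxAl ev_rho scalerA !mxE eqxx /= (inj_eq enum_rank_inj).
rewrite [b == _]eq_sym -pair_eqE /= /rsign.
by case: (#|b.1| == i); case: (#|b.2| == j); case: (_ == b.1); case: (_ == b.2);
  rewrite /= ?mul1r ?mulr1 ?mulr0 ?mul0r.
Qed.

Section Multiplicity.
Variables (n : nat) (lam : part n).
Hypotheses (n_gt0 : (0 < n)%N) (plam : is_partition lam).
Implicit Types (chi : 'S_n -> rat).

Definition mult chi : rat := hall_schur (frob chi) lam.

Lemma frob_ext chi chi' : chi =1 chi' -> frob chi = frob chi'.
Proof. by move=> E; congr (_ *: _); apply: eq_bigr => s _; rewrite E. Qed.

Lemma mult_ext chi chi' : chi =1 chi' -> mult chi = mult chi'.
Proof. by move=> E; rewrite /mult (frob_ext E). Qed.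

(** The choice in [schur_expansion] is not visibly linear; linearity comes from the coefficient
    formula [hall_schurE]. *)
Lemma mult_lin (a : rat) chi chi' : mult (fun s => chi s + a * chi' s) = mult chi + a * mult chi'.
Proof.
rewrite /mult !hall_schurE ?frob_symmetric ?frob_homog //.
have -> : frob (fun s => chi s + a * chi' s) = frob chi + a *: frob chi'.
  rewrite /frob [a *: (_ *: _)]scalerA [a * _]mulrC -scalerA -scalerDr; congr (_ *: _).
  rewrite scaler_sumr -big_split /=.
  by apply: eq_bigr => s _; rewrite scalerDl scalerA.
rewrite [altpoly _ _ * (_ + _)]mulrDr mcoeffD; congr (_ + _).
by rewrite -scalerAr mcoeffZ.
Qed.

Lemma multD chi chi' : mult (fun s => chi s + chi' s) = mult chi + mult chi'.
Proof.
rewrite -[mult chi']mul1r -mult_lin; apply: mult_ext => s.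
by rewrite mul1r.
Qed.

Lemma multB chi chi' : mult (fun s => chi s - chi' s) = mult chi - mult chi'.
Proof.
rewrite -[mult chi']mul1r -mulNr -mult_lin; apply: mult_ext => s.
by rewrite mulN1r.
Qed.

Lemma mult0 : mult (fun=> 0) = 0.
Proof.
by have := multB (fun=> 0) (fun=> 0); rewrite !subrr.
Qed.

Let kft i j := mult (fun s => strace (kerft n i j) (rho s)).
Let kf i j := mult (fun s => strace (kerf n i j) (rho s)).
Let ef i j := mult (@ext_char n i j).

Lemma ef_kf i j : ef i j = kf i j + (if i is i'.+1 then kf i' j else 0).
Proof.
rewrite -[X in _ + X](_ : mult (fun s => if i is i'.+1 then strace (kerf n i' j) (rho s) else 0) = _).
  by rewrite -multD; apply: mult_ext => s; rewrite -strace_bideg_ext strace_bideg.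
by case: i => [|i] //; apply: mult0.
Qed.

Lemma kf_kft i j : kf i j = kft i j + (if j is j'.+1 then kft i j' else 0).
Proof.
rewrite -[X in _ + X](_ : mult (fun s => if j is j'.+1 then strace (kerft n i j') (rho s) else 0) = _).
  by rewrite -multD; apply: mult_ext => s; rewrite strace_kerf.
by case: j => [|j] //; apply: mult0.
Qed.

Lemma mult_coinv i j : mult (coinv_char i j) =
  if (i + j < n)%N then
    kft i j - (match i, j with i'.+1, j'.+1 => kft i' j' | _, _ => 0 end) else 0.
Proof.
transitivity (mult (fun s => if (i + j < n)%N then strace (kerft n i j) (rho s)
    - (match i, j with i'.+1, j'.+1 => strace (kerft n i' j') (rho s) | _, _ => 0 end) else 0)).
  by apply: mult_ext => s; rewrite coinv_charE.
case: ifP => _; last exact: mult0.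
rewrite multB; congr (_ - _).
by case: i j => [|i] [|j] //; apply: mult0.
Qed.

Lemma bideg_out i j : (n < i)%N || (n < j)%N -> bideg n i j = 0.
Proof.
move=> h; apply: ev_ext => b; rewrite ev_bideg mulmx0 (_ : _ && _ = false) ?scale0r //.
have c1 : (#|b.1| <= n)%N by rewrite -[X in (_ <= X)%N]card_ord max_card.
have c2 : (#|b.2| <= n)%N by rewrite -[X in (_ <= X)%N]card_ord max_card.
by apply/negP => /andP[/eqP b1 /eqP b2]; move: h; rewrite -b1 -b2; lia.
Qed.

Lemma kf_out i j : (n < i)%N || (n < j)%N -> kf i j = 0.
Proof.
move=> h; rewrite -mult0; apply: mult_ext => s.
by rewrite /kerf bideg_out // cap0mx strace0.
Qed.

Lemma kft_out i j : (n < i)%N || (n < j)%N -> kft i j = 0.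
Proof.
move=> h; rewrite -mult0; apply: mult_ext => s.
by rewrite /kerft /kerf bideg_out // !cap0mx strace0.
Qed.

(** Read off from the empty bidegree (n + 1, j). The vanishing ensures that shifting a sum over i <=
    n loses no boundary term. *)
Lemma kf_n j : kf n j = 0.
Proof.
have := ef_kf n.+1 j; rewrite (kf_out (i := n.+1)) ?ltnSn // add0r => <-.
rewrite /ef -mult0; apply: mult_ext => s; rewrite -strace_bideg_ext bideg_out ?ltnSn //.
exact: strace0.
Qed.

Lemma kft_n i : kft i n = 0.
Proof.
have := kf_kft i n.+1; rewrite (kft_out (j := n.+1)) ?ltnSn ?orbT // add0r => <-.
by rewrite kf_out // ltnSn orbT.
Qed.

Local Notation P2 := {mpoly rat[2]}.
Let u : P2 := 'X_0.
Let v : P2 := 'X_1.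

Definition gen2 (a : nat -> nat -> rat) : P2 :=
  \sum_(i < n.+1) \sum_(j < n.+1) a i j *: (u ^+ i * v ^+ j).

Lemma gen2_ext a a' : (forall i j, a i j = a' i j) -> gen2 a = gen2 a'.
Proof. by move=> E; apply: eq_bigr => i _; apply: eq_bigr => j _; rewrite E. Qed.

Lemma gen2D a a' : gen2 (fun i j => a i j + a' i j) = gen2 a + gen2 a'.
Proof.
rewrite /gen2 -big_split; apply: eq_bigr => i _; rewrite -big_split; apply: eq_bigr => j _.
by rewrite scalerDl.
Qed.

Lemma gen2_shift_u (a : nat -> nat -> rat) : (forall j, a n j = 0) ->
  gen2 (fun i j => if i is i'.+1 then a i' j else 0) = u * gen2 a.
Proof.
move=> an; rewrite /gen2 big_ord_recl [X in X + _]big1 ?add0r => [|j _]; last first.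
  by rewrite scale0r.
rewrite [in RHS]big_ord_recr /= [X in _ * (_ + X)]big1 ?addr0 => [|j _]; last first.
  by rewrite an scale0r.
rewrite mulr_sumr; apply: eq_bigr => i _; rewrite mulr_sumr; apply: eq_bigr => j _.
by rewrite -scalerAr mulrA -exprS.
Qed.

Lemma gen2_shift_v (a : nat -> nat -> rat) : (forall i, a i n = 0) ->
  gen2 (fun i j => if j is j'.+1 then a i j' else 0) = v * gen2 a.
Proof.
move=> an; rewrite /gen2 mulr_sumr; apply: eq_bigr => i _.
rewrite big_ord_recl /= scale0r add0r big_ord_recr /= an scale0r addr0 mulr_sumr.
by apply: eq_bigr => j _; rewrite -scalerAr mulrCA -exprS.
Qed.

Lemma gen2_ef : gen2 ef = (1 + u) * (1 + v) * gen2 kft.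
Proof.
rewrite (gen2_ext ef_kf) gen2D gen2_shift_u; last exact: kf_n.
rewrite (gen2_ext kf_kft) gen2D gen2_shift_v; last exact: kft_n.
ring.
Qed.

Definition htrunc (p : P2) : P2 := \sum_(d < n) pihomog mdeg d p.

Lemma htruncB p q : htrunc (p - q) = htrunc p - htrunc q.
Proof. by rewrite /htrunc -sumrB; apply: eq_bigr => d _; rewrite pihomogB. Qed.

Lemma htruncD p q : htrunc (p + q) = htrunc p + htrunc q.
Proof. by rewrite /htrunc -big_split; apply: eq_bigr => d _; rewrite pihomogD. Qed.

Lemma htrunc_homog d (p : P2) : p \is d.-homog -> htrunc p = if (d < n)%N then p else 0.
Proof.
move=> hp; rewrite /htrunc; case: ifP => dn.
  rewrite (bigD1 (Ordinal dn)) //= pihomog_dE // big1 ?addr0 // => e ed.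
  by apply: (pihomog_ne0 (d := d)) => //; move: ed; rewrite -val_eqE eq_sym.
apply: big1 => e _; apply: (pihomog_ne0 (d := d)) => //.
by apply/eqP => E; move: dn; rewrite E ltn_ord.
Qed.

Lemma homog_uv i j : u ^+ i * v ^+ j \is (i + j).-homog.
Proof.
have hX (k : 'I_2) : ('X_k : P2) \is 1.-homog by rewrite dhomogX /= mdeg1.
by have := dhomogM (dhomogMn i (hX 0)) (dhomogMn j (hX 1)); rewrite !mul1n.
Qed.

Lemma htrunc_gen2 a : htrunc (gen2 a) = gen2 (fun i j => if (i + j < n)%N then a i j else 0).
Proof.
have tsum (I : finType) (F : I -> P2) : htrunc (\sum_i F i) = \sum_i htrunc (F i).
  rewrite /htrunc exchange_big; apply: eq_bigr => d _; exact: raddf_sum.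
rewrite /gen2 tsum; apply: eq_bigr => i _; rewrite tsum; apply: eq_bigr => j _.
rewrite (htrunc_homog (d := i + j)); last exact/rpredZ/homog_uv.
by case: ifP => //; rewrite scale0r.
Qed.

Lemma coinv_mult_htrunc : coinv_mult lam = htrunc ((1 - u * v) * gen2 kft).
Proof.
transitivity (htrunc (gen2 (fun i j => kft i j
    - (match i, j with i'.+1, j'.+1 => kft i' j' | _, _ => 0 end)))).
  rewrite htrunc_gen2; apply: eq_bigr => i _; apply: eq_bigr => j _.
  by rewrite -mult_coinv.
rewrite mulrBl mul1r (_ : gen2 _ = gen2 kft - gen2 (fun i j =>
    match i, j with i'.+1, j'.+1 => kft i' j' | _, _ => 0 end)); last first.
  rewrite /gen2 -sumrB; apply: eq_bigr => i _; rewrite -sumrB; apply: eq_bigr => j _.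
  by rewrite scalerBl.
rewrite !htruncB; congr (_ - _); congr htrunc.
have -> : gen2 (fun i j => match i, j with i'.+1, j'.+1 => kft i' j' | _, _ => 0 end)
  = gen2 (fun i j => if j is j'.+1 then (if i is i'.+1 then kft i' j' else 0) else 0).
  by apply: gen2_ext => -[|i] [|j].
rewrite (gen2_shift_v (a := fun i j => if i is i'.+1 then kft i' j else 0)); last first.
  by case=> // i; apply: kft_n.
rewrite gen2_shift_u ?mulrA 1?[v * u]mulrC // => j.
(* Consecutive values of [kft n] add up to [kf n j = 0], so they all vanish by induction. *)
elim: j => [|j IH]; first by have := kf_kft n 0; rewrite kf_n addr0.
by have := kf_kft n j.+1; rewrite kf_n IH addr0.
Qed.

Lemma gen2_ef_jt : gen2 ef = ndet n (jtrudi (superh u v) (pext lam)).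
Proof. exact: mult_jacobi_trudi. Qed.

Lemma onepX_neq0 (i : 'I_2) : 1 + 'X_i != 0 :> P2.
Proof.
apply/eqP => /(congr1 (mcoeff 0%MM)); rewrite mcoeffD mcoeff1 eqxx mcoeffX mcoeff0.
by rewrite mnm1_eq0 addr0 => /eqP; rewrite oner_eq0.
Qed.

Lemma gen2_kft X : ndet n (jtrudi (superh u v) (pext lam)) = (1 + u) ^+ 2 * (1 + v) ^+ 2 * X ->
  gen2 kft = (1 + u) * (1 + v) * X.
Proof.
rewrite -gen2_ef_jt gen2_ef => E.
have h : (1 + u) * (1 + v) != 0 by rewrite mulf_neq0 ?onepX_neq0.
by apply: (mulfI h); rewrite E; ring.
Qed.

End Multiplicity.

(** * Evaluation for double hooks and truncation *)

Section DoubleHook.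
Variables (n lam1 lam2 l : nat).
Hypotheses (lam2_ge2 : (2 <= lam2)%N) (lam12 : (lam2 <= lam1)%N).
Hypothesis size_le : (lam1 + lam2 + 2 * l <= n)%N.

Let k := (n - 2 * l - lam1 - lam2)%N.
Let rows := lam1 :: lam2 :: nseq l 2%N ++ nseq k 1%N.
Let lam := part_of_seq n rows.

Let rows_size : size rows = (2 + l + k)%N.
Proof. by rewrite /= size_cat !size_nseq. Qed.

Let nth_rows i : nth 0%N rows i.+2 =
  if (i < l)%N then 2%N else if (i < l + k)%N then 1%N else 0%N.
Proof.
rewrite /= nth_cat size_nseq !nth_nseq; case: ltnP => // il.
by rewrite ltn_subLR.
Qed.

Let nth_rows_le i : (nth 0%N rows i <= n)%N.
Proof.
case: i => [|[|i]]; rewrite ?nth_rows /=; try lia.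
by case: ifP => _; [lia|case: ifP => _; lia].
Qed.

Lemma pext_double_hook i : pext lam i = nth 0%N rows i.
Proof.
case: (ltnP i n) => ni.
  by rewrite -[i in LHS]/(val (Ordinal ni)) pextE ffunE inordK // ltnS nth_rows_le.
by rewrite pext_geq // nth_default // rows_size; lia.
Qed.

Lemma is_partition_double_hook : is_partition lam.
Proof.
apply/is_partitionP; split.
  move=> i j ij; rewrite -!pextE !pext_double_hook.
  case: (val i) (val j) ij => [|[|i']] [|[|j']] ij; rewrite ?nth_rows //=; try lia;
    by do ?case: ifP; lia.
under eq_bigr do rewrite -pextE pext_double_hook.
have -> : (\sum_(i < n) nth 0 rows i = \sum_(i < size rows) nth 0 rows i)%N.
  rewrite [RHS](big_ord_widen n (fun i => nth 0%N rows i)); last by rewrite rows_size; lia.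
  rewrite [RHS]big_mkcond; apply: eq_bigr => i _ /=; case: ltnP => // h.
  by rewrite nth_default // rows_size.
rewrite -(big_mkord predT (fun i => nth 0%N rows i)) -(big_nth 0%N predT id) -sumnE.
by rewrite /= sumn_cat !sumn_nseq; lia.
Qed.

Local Notation u := ('X_0 : {mpoly rat[2]}).
Local Notation v := ('X_1 : {mpoly rat[2]}).
Local Notation q := (u * v).

Lemma jt_double_hook :
  ndet n (jtrudi (superh u v) (pext lam)) =
  (1 + u) ^+ 2 * (1 + v) ^+ 2
    * (q ^+ (l + lam2 - 1) * qnum q (lam1 - lam2).+1 * qnum2 u v k.+1).
Proof.
have nE : n = (2 + (l + (k + (n - (2 + l + k)))))%N by lia.
rewrite [X in ndet X _]nE (@superjt_double_hook _ u v lam1 lam2 l k) //.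
- by rewrite (_ : (lam2 + l).-1 = (l + lam2 - 1)%N) ?mulrA //; lia.
- by rewrite pext_double_hook.
- by rewrite pext_double_hook.
- by move=> i il; rewrite pext_double_hook nth_rows il.
- by move=> i ik; rewrite pext_double_hook nth_rows ltn_add2l ik ifF //; lia.
- by move=> i; rewrite pext_double_hook nth_rows !ifF //; lia.
Qed.

Lemma homog_qpow a b p : p \is [in rat[2], b.-homog] -> q ^+ a * p \is (2 * a + b).-homog.
Proof.
move=> hp; apply: dhomogM => //; apply: dhomogMn.
by have := homog_uv 1 1.
Qed.

Lemma homog_qnum2 b : qnum2 u v b.+1 \is b.-homog.
Proof.
apply: rpred_sum => a _; have := homog_uv a (b - a).
by rewrite subnKC // -ltnS.
Qed.

Lemma htrunc_double_hook (d := (lam1 - lam2)%N) (a := (l + lam2 - 1)%N) :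
  htrunc n ((1 - q) * ((1 + u) * (1 + v) * (q ^+ a * qnum q d.+1 * qnum2 u v k.+1)))
  = q ^+ a * ((1 + u + v) * qnum2 u v k.+1 + (if d == 0%N then 0 else q * qnum2 u v k.+1)).
Proof.
have deg_n : (2 * a + k + d + 2 = n)%N by rewrite /a /d /k; lia.
have hw : (u + v) * qnum2 u v k.+1 \is k.+1.-homog.
  rewrite mulrDl; apply: rpredD.
    by have := dhomogM (homog_uv 1 0) (homog_qnum2 k); rewrite expr0 mulr1.
  by have := dhomogM (homog_uv 0 1) (homog_qnum2 k); rewrite expr0 mul1r.
have h0 c : q ^+ c * qnum2 u v k.+1 \is (2 * c + k).-homog by apply/homog_qpow/homog_qnum2.
have h1 c : q ^+ c * ((u + v) * qnum2 u v k.+1) \is (2 * c + k.+1).-homog by apply: homog_qpow.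
have -> : (1 - q) * ((1 + u) * (1 + v) * (q ^+ a * qnum q d.+1 * qnum2 u v k.+1))
  = (q ^+ a * qnum2 u v k.+1 + q ^+ a * ((u + v) * qnum2 u v k.+1) + q ^+ a.+1 * qnum2 u v k.+1)
  - (q ^+ (a + d.+1) * qnum2 u v k.+1 + q ^+ (a + d.+1) * ((u + v) * qnum2 u v k.+1)
     + q ^+ (a + d.+1).+1 * qnum2 u v k.+1).
  have E : (1 - q) * qnum q d.+1 = 1 - q ^+ d.+1.
    by rewrite -[in LHS]opprB mulNr -subrX1 opprB.
  transitivity ((1 + u) * (1 + v) * q ^+ a * ((1 - q) * qnum q d.+1) * qnum2 u v k.+1); first by ring.
  by rewrite E (exprS _ a) (exprS _ (a + d.+1)) exprD; ring.
(* By [deg_n] the positive terms have degrees n - d - 2, n - d - 1 and n - d, the negative ones n +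
   d, n + d + 1 and n + d + 2. *)
rewrite htruncB !htruncD !(htrunc_homog n (h0 _)) !(htrunc_homog n (h1 _)).
have -> : (2 * a + k < n)%N = true by lia.
have -> : (2 * a + k.+1 < n)%N = true by lia.
have -> : (2 * a.+1 + k < n)%N = (d != 0%N) by lia.
have -> : (2 * (a + d.+1) + k < n)%N = false by lia.
have -> : (2 * (a + d.+1) + k.+1 < n)%N = false by lia.
have -> : (2 * (a + d.+1).+1 + k < n)%N = false by lia.
by rewrite if_neg exprS; case: (d == 0%N); ring.
Qed.

End DoubleHook.

Theorem theorem5p2 (n lam1 lam2 l : nat) :
  (1 <= n)%N -> (2 <= lam2)%N -> (lam2 <= lam1)%N ->
  (lam1 + lam2 + 2 * l <= n)%N ->
  let lam := part_of_seq n
      (lam1 :: lam2 :: nseq l 2%N ++ nseq (n - 2 * l - lam1 - lam2) 1%N) in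
  let m := (n - 2 * l - lam1 - lam2 + 2)%N in
  let uv : {mpoly rat[2]} := 'X_0 * 'X_1 in
  coinv_mult lam =
    if lam1 == lam2 then
      uv ^+ (l + lam2 - 1) * (uv * qint (m - 2) + qint m + qint (m - 1))
    else
      uv ^+ (l + lam2 - 1)
        * (uv * qint (m - 1) + uv * qint (m - 2) + qint m + qint (m - 1)).
Proof.
move=> n1 h2 h12 hn lam m uv.
have plam := is_partition_double_hook h2 h12 hn.
rewrite (coinv_mult_htrunc n1 plam) (gen2_kft n1 plam (jt_double_hook h2 h12 hn)).
rewrite (htrunc_double_hook h2 h12 hn) -/uv.
set k := (n - 2 * l - lam1 - lam2)%N; rewrite /m addnK addn2 subn1 /=.
(* With m = k + 2, the recurrence rewrites (u + v) [m - 1] as [m] + uv [m - 2]. *)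
rewrite -[qint k.+2]/(qnum2 'X_0 'X_1 k.+2) qnum2SS -/uv.
rewrite -[qint k.+1]/(qnum2 'X_0 'X_1 k.+1) -[qint k]/(qnum2 'X_0 'X_1 k).
rewrite (_ : (lam1 - lam2 == 0)%N = (lam1 == lam2)); last by lia.
by case: (lam1 == lam2); ring.
Qed.
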